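(* Let $d,q\ge1$ be integers, let $A$ be a real $d\times d$ matrix all of whose eigenvalues lie (strictly) within the unit circle, let $(\xi_n)_{n\ge1}$ be an i.i.d. sequence of random vectors in $\mathbb{R}^d$ such that $Ee^{\delta|\xi_1|}<\infty$ for all sufficiently small $\delta>0$, and let $(X_n)_{n\ge0}$ be the Markov chain in $\mathbb{R}^d$ with $X_0=x$ for a fixed $x\in\mathbb{R}^d$ and $$X_n=AX_{n-1}+\xi_n,\qquad n\ge1.$$ Then the Markov chain is ergodic, with invariant probability measure $\mu$ satisfying $\int_{\mathbb{R}^d}\|z\|^2\,\mu(dz)<\infty$. Moreover, for every $\alpha\in(1/2,1)$ and every Lipschitz continuous function $H:\mathbb{R}^d\to\mathbb{R}^q$ with $\int_{\mathbb{R}^d}H(z)\,\mu(dz)=0$, the family $$S^\alpha_n=\frac1{n^\alpha}\sum_{i=1}^nH(X_{i-1}),\qquad n\ge1,$$ obeys the moderate deviation principle in $\mathbb{R}^q$ (with the Euclidean metric) with rate of speed $n^{-(2\alpha-1)}$ and rate function $$I(y)=\begin{cases}\tfrac12\langle y,B^{\oplus}y\rangle, & B^\oplus By=y,\\ \infty,&\text{otherwise,}\end{cases}\qquad y\in\mathbb{R}^q,$$ where $$B=\int_{\mathbb{R}^d}H(x)H^*(x)\,\mu(dx)+\sum_{n\ge1}\int_{\mathbb{R}^d}\Big[H(x)\big(P^{(n)}_xH\big)^*+\big(P^{(n)}_xH\big)H^*(x)\Big]\mu(dx).$$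
   Context: $|\cdot|$ denotes the $\mathbb{L}^1$ norm of a vector (sum of absolute values of entries), $\|\cdot\|$ the Euclidean norm, $^*$ is transposition, and $B^\oplus$ is the Moore–Penrose pseudoinverse of $B$. $P^{(n)}_x=P^{(n)}(x,dy)$ is the $n$-step transition kernel of the chain and $P^{(n)}_xH=\int_{\mathbb{R}^d}H(y)P^{(n)}(x,dy)$. ''Ergodic'' means that the chain possesses a unique invariant probability measure $\mu$. The family $(S^\alpha_n)_{n\ge1}$ obeys the moderate deviation principle (MDP) with rate of speed $n^{-(2\alpha-1)}$ and rate function $I$ if $I$ is $[0,\infty]$-valued with compact level sets $\{I\le c\}$, $c\ge 0$, and, for every closed set $F$ and every open set $G$, $$\limsup_{n\to\infty}\frac1{n^{2\alpha-1}}\log P(S^\alpha_n\in F)\le-\inf_{y\in F}I(y),\qquad \liminf_{n\to\infty}\frac1{n^{2\alpha-1}}\log P(S^\alpha_n\in G)\ge-\inf_{y\in G}I(y),$$ with $\log 0=-\infty$ and $\inf\emptyset=\infty$. *)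

(* Defs.v *)
From HB Require Import structures.
From mathcomp Require Import all_boot all_order all_algebra.
From mathcomp Require Import all_classical all_reals all_analysis.
From mathcomp Require Import measurable_realfun complex.

Set Implicit Arguments.
Unset Strict Implicit.
Unset Printing Implicit Defensive.

Import Order.TTheory GRing.Theory Num.Theory.
Import numFieldNormedType.Exports.

Local Open Scope classical_set_scope.
Local Open Scope ring_scope.

(* R^n is the type 'cV[R]_n of column vectors. The library topology on matrices
   is the product topology, i.e. that of the Euclidean metric, and matrices
   carry the corresponding Borel sigma-algebra. *)
HB.instance Definition _ (R : realType) m n :=
  Measurable.copy 'M[R]_(m, n) (g_sigma_algebraType (@open 'M[R]_(m, n))).

Section borel_matrix.
Context (R : realType) (m n : nat).

Lemma measurable_mx_coord (i : 'I_m) (j : 'I_n) :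
  measurable_fun [set: 'M[R]_(m, n)] (fun M : 'M[R]_(m, n) => M i j).
Proof.
apply: (measurability _ (RGenOpens.measurableE R)) => _ [_ [a [b ->]] <-].
rewrite setTI; apply: sub_sigma_algebra.
apply: open_comp; last exact: interval_open.
by move=> M _; exact: coord_continuous.
Qed.

Let qball (p : 'M[rat]_(m, n) * nat) : set 'M[R]_(m, n) :=
  ball (map_mx (@ratr R) p.1) p.2.+1%:R^-1.

Let open_qballs (U : set 'M[R]_(m, n)) : open U ->
  U = \bigcup_(p in [set p | qball p `<=` U]) qball p.
Proof.
move=> oU; apply/seteqP; split=> [M UM|M [p pU /pU]//].
have /nbhs_ballP[e /= e0 eU] : nbhs M U by exact: open_nbhs_nbhs.
have [k ke] : exists k : nat, k.+1%:R^-1 < e / 2 :> R.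
  have e20 : 0 < e / 2 by rewrite divr_gt0.
  have [k] := ltr_add_invr e20.
  by rewrite add0r => ?; exists k.
have k0 : 0 < k.+1%:R^-1 :> R by rewrite invr_gt0.
have /choice[Q HQ] : forall ij : 'I_m * 'I_n, exists q : rat,
    `|ratr q - M ij.1 ij.2| < k.+1%:R^-1.
  move=> ij; have /rat_in_itvoo[q] : M ij.1 ij.2 < M ij.1 ij.2 + k.+1%:R^-1.
    by rewrite ltrDl.
  rewrite in_itv/= => /andP[h1 h2]; exists q.
  by rewrite gtr0_norm ?subr_gt0// ltrBlDl.
exists (\matrix_(i, j) Q (i, j), k); last first.
  by split=> // i j; rewrite !mxE; exact: HQ (i, j).
move=> N [_ HN]; apply: eU; split=> // i j; rewrite /ball/=.
have h1 := HQ (i, j); have := HN i j; rewrite !mxE /ball/= => h2.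
rewrite -(subrKA (ratr (Q (i, j)))) (splitr e).
rewrite (le_lt_trans (ler_normD _ _))// ltrD//.
  by rewrite distrC (lt_trans h1).
by rewrite (lt_trans h2).
Qed.

(* Borel measurability into matrices is entrywise measurability. *)
Lemma measurable_mxP d (T : measurableType d) (f : T -> 'M[R]_(m, n)) :
  measurable_fun [set: T] f <->
  forall i j, measurable_fun [set: T] (fun t => f t i j).
Proof.
split=> [mf i j|mf].
  exact: measurableT_comp (measurable_mx_coord i j) mf.
apply: (@measurability _ _ T 'M[R]_(m, n) _ _ (@open 'M[R]_(m, n))) => //.
move=> _ [U oU <-]; rewrite setTI (open_qballs oU) preimage_bigcup bigcup_mkcond.
apply: countable_bigcupT_measurable => [|p]; first exact: countableP.
case: ifP => // _.
rewrite [X in measurable X](_ : _ = \bigcap_(ij in [set: 'I_m * 'I_n])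
    ((fun t => f t ij.1 ij.2) @^-1`
      ball (ratr (p.1 ij.1 ij.2) : R) p.2.+1%:R^-1)).
  apply: fin_bigcap_measurable => // ij _.
  rewrite -[X in measurable X]setTI; apply: mf => //.
  exact: measurable_ball.
apply/seteqP; split=> [t [_ H] ij _|t H] /=.
  by have := H ij.1 ij.2; rewrite mxE.
by split=> [|i j]; [rewrite invr_gt0|rewrite mxE; exact: (H (i, j) Logic.I)].
Qed.

End borel_matrix.

Section norms.
Context (R : realType) (n : nat).
Implicit Types x y : 'cV[R]_n.

Definition norm1 x : R := \sum_(i < n) `|x i 0|.
Definition dot x y : R := (x^T *m y) 0 0.
Definition norm2 x : R := Num.sqrt (dot x x).

End norms.

Definition lipschitz2 (R : realType) m n (f : 'cV[R]_m -> 'cV[R]_n) :=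
  exists L : R, forall x y, norm2 (f x - f y) <= L * norm2 (x - y).

Section iid.
Context d d' (T : measurableType d) (T' : measurableType d') (R : realType)
  (P : probability T R).
Local Open Scope ereal_scope.

Definition mutually_independent (Z : nat -> {RV P >-> T'}) :=
  forall (J : seq nat) (U : nat -> set T'),
    uniq J -> (forall j, measurable (U j)) ->
    P (\bigcap_(j in [set` J]) Z j @^-1` U j) =
      \prod_(j <- J) P (Z j @^-1` U j).

Definition identically_distributed (Z : nat -> {RV P >-> T'}) :=
  forall i j U, measurable U -> distribution P (Z i) U = distribution P (Z j) U.

Definition iid (Z : nat -> {RV P >-> T'}) :=
  mutually_independent Z /\ identically_distributed Z.

End iid.

(* The transition kernel P(x, U) = P(A x + Z \in U) of the recursion
   X_n = A X_(n-1) + Z_n, where Z is distributed as the innovations. *)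
Section ar_kernel.
Context d (T : measurableType d) (R : realType) (P : probability T R) (n : nat)
  (A : 'M[R]_n) (Z : {RV P >-> 'cV[R]_n}).

Definition ar_step (x : 'cV[R]_n) (t : T) : 'cV[R]_n := A *m x + Z t.

Let measurable_ar_step2 :
  measurable_fun [set: 'cV[R]_n * T] (fun xt => ar_step xt.1 xt.2).
Proof.
apply/measurable_mxP => i j.
rewrite (_ : (fun _ => _) = fun xt : 'cV[R]_n * T =>
    \sum_(k < n) A i k * xt.1 k j + Z xt.2 i j); last first.
  by apply/funext => xt; rewrite /ar_step !mxE.
apply: measurable_funD.
  apply: measurable_sum => k; apply: measurable_funM => //.
  exact: measurableT_comp (measurable_mx_coord k j) measurable_fst.
have mZ : measurable_fun [set: T] Z by [].
have /measurable_mxP/(_ i j) mZij := mZ.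
exact: measurableT_comp mZij measurable_snd.
Qed.

Let measurable_ar_step x : measurable_fun [set: T] (ar_step x).
Proof. exact: measurableT_comp measurable_ar_step2 (measurable_pair1 x). Qed.

HB.instance Definition _ x :=
  isMeasurableFun.Build _ _ _ _ (ar_step x) (measurable_ar_step x).

Definition ar_kernel (x : 'cV[R]_n) : {measure set 'cV[R]_n -> \bar R} :=
  distribution P (ar_step x).

Let measurable_ar_kernel U : measurable U ->
  measurable_fun [set: 'cV[R]_n] (ar_kernel ^~ U).
Proof.
move=> mU.
have mE : measurable ((fun xt : 'cV[R]_n * T => ar_step xt.1 xt.2) @^-1` U).
  by rewrite -[X in measurable X]setTI; exact: measurable_ar_step2.
have := measurable_fun_xsection P mE.
apply: eq_measurable_fun => x _ /=.
by rewrite /ar_kernel/= /distribution/= /pushforward/= xsectionE.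
Qed.

HB.instance Definition _ :=
  isKernel.Build _ _ _ _ R ar_kernel measurable_ar_kernel.

Let ar_kernel_setT x : ar_kernel x [set: 'cV[R]_n] = 1%E.
Proof. exact: probability_setT. Qed.

HB.instance Definition _ :=
  Kernel_isProbability.Build _ _ _ _ R ar_kernel ar_kernel_setT.

End ar_kernel.

Section markov.
Context d (E : measurableType d) (R : realType).
Local Open Scope ereal_scope.

(* n-step kernel, by Chapman-Kolmogorov *)
Fixpoint nstep (K : R.-spker E ~> E) (n : nat) : R.-spker E ~> E :=
  if n is n'.+1 then mkcomp_noparam (nstep K n') K
  else kdirac (@measurable_id _ E setT).

Definition invariant_measure (K : R.-spker E ~> E) (mu : probability E R) :=
  forall U, measurable U -> \int[mu]_x K x U = mu U.

(* [mu] is the invariant probability measure of the ergodic kernel [K] *)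
Definition ergodic (K : R.-spker E ~> E) (mu : probability E R) :=
  invariant_measure K mu /\
  forall nu : probability E R, invariant_measure K nu ->
    forall U, measurable U -> nu U = mu U.

End markov.

(* [Rintegral] is total; the integrands used with [mxint] below are integrable
   for a Lipschitz [H] and a [mu] with finite second moment. *)
Definition mxint d (E : measurableType d) (R : realType)
    (mu : {measure set E -> \bar R}) m n (F : E -> 'M[R]_(m, n)) :
    'M[R]_(m, n) :=
  \matrix_(i, j) \int[mu]_x (F x i j).

Section covariance.
Context d (E : measurableType d) (R : realType) (K : R.-spker E ~> E)
  (mu : probability E R) (q : nat) (H : E -> 'cV[R]_q).

Definition nstep_int (n : nat) (x : E) : 'cV[R]_q := mxint (nstep K n x) H.

Definition lag_cov (n : nat) : 'M[R]_q :=
  mxint mu (fun x => H x *m (nstep_int n x)^T + nstep_int n x *m (H x)^T).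

Definition lag_cov_sum (N : nat) : 'M[R]_q := \sum_(1 <= n < N.+1) lag_cov n.

Definition asymptotic_cov : 'M[R]_q :=
  mxint mu (fun x => H x *m (H x)^T) + limn lag_cov_sum.

End covariance.

Definition eigenvalues_in_unit_disk (R : realType) n (A : 'M[R]_n) :=
  forall z : R[i], eigenvalue (map_mx (real_complex R) A) z -> `|z| < 1.

Section moore_penrose.
Context (R : realType).

Definition is_moore_penrose m n (B : 'M[R]_(m, n)) (G : 'M[R]_(n, m)) :=
  [/\ B *m G *m B = B, G *m B *m G = G,
      (B *m G)^T = B *m G & (G *m B)^T = G *m B].

Definition moore_penrose m n (B : 'M[R]_(m, n)) : 'M[R]_(n, m) :=
  xget 0 [set G | is_moore_penrose B G].

Lemma rV_mulTmx_eq0 n (v : 'rV[R]_n) : v *m v^T = 0 -> v = 0.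
Proof.
move=> /(congr1 (fun M : 'M[R]_1 => M 0 0)); rewrite !mxE => /eqP.
under eq_bigr => k _ do rewrite mxE -expr2.
rewrite psumr_eq0 => [/allP v0|k _]; last exact: sqr_ge0.
apply/rowP => j; rewrite [RHS]mxE; apply/eqP.
by have := v0 j (mem_index_enum _); rewrite /= sqrf_eq0.
Qed.

Lemma mulTmx_unit m r (C : 'M[R]_(m, r)) : \rank C = r -> C^T *m C \in unitmx.
Proof.
move=> rC; rewrite -row_free_unit; apply/row_freeP.
suff: kermx (C^T *m C) == 0.
  by rewrite kermx_eq0 => /row_freeP.
apply/eqP/row_matrixP => i; rewrite row0.
set u := row i _.
have uCC : u *m (C^T *m C) = 0.
  by apply/sub_kermxP; exact: row_sub.
have uC0 : u *m C^T = 0.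
  by apply: rV_mulTmx_eq0; rewrite trmx_mul trmxK mulmxA -(mulmxA u) uCC mul0mx.
have fC : row_free C^T by rewrite /row_free mxrank_tr rC.
by apply: (row_free_inj fC); rewrite uC0 mul0mx.
Qed.

Lemma is_moore_penrose_uniq m n (B : 'M[R]_(m, n)) G1 G2 :
  is_moore_penrose B G1 -> is_moore_penrose B G2 -> G1 = G2.
Proof.
move=> [a1 b1 c1 d1] [a2 b2 c2 d2].
have BG : B *m G1 = B *m G2.
  rewrite -c1 -{1}a2 -(mulmxA (B *m G2)) trmx_mul c1 c2.
  by rewrite mulmxA a1.
have GB : G1 *m B = G2 *m B.
  rewrite -d1 -{1}a2 !mulmxA -(mulmxA _ G2) trmx_mul d1 d2.
  by rewrite -mulmxA (mulmxA B) a1.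
by rewrite -b1 GB -mulmxA BG mulmxA b2.
Qed.

Lemma moore_penroseP m n (B : 'M[R]_(m, n)) :
  is_moore_penrose B (moore_penrose B).
Proof.
suff: exists G, is_moore_penrose B G by exact: xgetPex.
have [r [C [F [BE rC rF]]]] : exists r (C : 'M[R]_(m, r)) (F : 'M[R]_(r, n)),
    [/\ B = C *m F, \rank C = r & \rank F = r].
  exists (\rank B), (col_base B), (row_base B); split; first by rewrite mulmx_base.
    exact/eqP/col_base_full.
  exact/eqP/row_base_free.
have uC : C^T *m C \in unitmx by exact: mulTmx_unit.
have uF : F *m F^T \in unitmx.
  by rewrite -{1}[F]trmxK; apply: mulTmx_unit; rewrite mxrank_tr.
exists (F^T *m invmx (F *m F^T) *m invmx (C^T *m C) *m C^T).
set X := invmx (F *m F^T); set Y := invmx (C^T *m C).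
have XT : X^T = X by rewrite /X trmx_inv trmx_mul trmxK.
have YT : Y^T = Y by rewrite /Y trmx_inv trmx_mul trmxK.
have BG : B *m (F^T *m X *m Y *m C^T) = C *m Y *m C^T.
  by rewrite BE !mulmxA -(mulmxA C F) -(mulmxA C) mulmxV// mulmx1.
have GB : (F^T *m X *m Y *m C^T) *m B = F^T *m X *m F.
  by rewrite BE !mulmxA -(mulmxA _ C^T) mulmxKV.
split.
- by rewrite BG BE !mulmxA -(mulmxA _ C^T) mulmxKV.
- by rewrite GB !mulmxA -(mulmxA _ F) -(mulmxA _ (F *m F^T)) mulmxV// mulmx1.
- by rewrite BG !trmx_mul trmxK YT mulmxA.
- by rewrite GB !trmx_mul trmxK XT mulmxA.
Qed.

End moore_penrose.

Definition mdp_rate (R : realType) q (B : 'M[R]_q) (y : 'cV[R]_q) : \bar R :=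
  if moore_penrose B *m B *m y == y
  then (2^-1 * dot y (moore_penrose B *m y))%:E else +oo%E.

Section mdp.
Context d (T : measurableType d) (R : realType) (P : probability T R) (q : nat).
Local Open Scope ereal_scope.

(* [lne 0 = -oo] and [ereal_inf set0 = +oo]; the term [n = 0] is irrelevant. *)
Definition scaled_log_prob (alpha : R) (S : nat -> T -> 'cV[R]_q)
    (F : set 'cV[R]_q) (n : nat) : \bar R :=
  ((n%:R `^ (2 * alpha - 1))^-1)%:E * lne (P (S n @^-1` F)).

Definition good_rate_function (I : 'cV[R]_q -> \bar R) :=
  (forall y, 0 <= I y) /\
  (forall c : R, (0 <= c)%R -> compact [set y | I y <= c%:E]).

Definition moderate_deviation_principle (alpha : R)
    (S : nat -> T -> 'cV[R]_q) (I : 'cV[R]_q -> \bar R) :=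
  [/\ good_rate_function I,
      forall F, closed F ->
        limn_esup (scaled_log_prob alpha S F) <= - ereal_inf (I @` F) &
      forall G, open G ->
        - ereal_inf (I @` G) <= limn_einf (scaled_log_prob alpha S G)].

End mdp.

(* Main.v *)
(* In a norm N adapted to A the chain contracts at a rate r < 1. Hence the
   backward iterates xi_1 + A xi_2 + ... + A^(m-1) xi_m converge almost surely,
   their limit has exponential moments, and its law mu attracts T^k f
   geometrically for every Lipschitz f, where T is the transition operator;
   this gives existence and uniqueness of mu.

   For a centred Lipschitz h = <l, H> the Poisson equation u - T u = h has a
   Lipschitz solution u = sum_k T^k h. The conditional variance of u(X_1) is
   again Lipschitz, so the Poisson equation for its centring has a Lipschitz
   solution as well; call v half of it. Then exp(e u + e^2 v) is an
   approximate eigenfunction of f |-> exp(e h) T f, with eigenvalue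
   1 + e^2 s2 / 2 + O(e^3), uniformly in the starting point, where
   s2 = <l, B l> is the asymptotic variance. Iterating n times with
   e = n^(alpha - 1) gives
   E exp(e sum_(i < n) h(X_i) + W(X_n)) = exp(n^(2 alpha - 1) (s2 / 2 + o(1)))
   with W of linear growth and of size e; Hoelder's inequality with an exponent
   near 1 and the uniform exponential moments of X_n remove W. The limiting
   cumulant is the quadratic form <l, B l> / 2, which is finite and smooth, so
   the Gaertner-Ellis argument yields the deviation principle, with Legendre
   dual the rate I even when B is singular. *)
From HB Require Import structures.
Require Import Defs.
From mathcomp Require Import all_boot all_order all_algebra.
From mathcomp Require Import all_classical all_reals all_analysis.
From mathcomp Require Import measurable_realfun complex ring lra.

Set Implicit Arguments.
Unset Strict Implicit.
Unset Printing Implicit Defensive.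

Import Order.TTheory GRing.Theory Num.Theory.
Import numFieldNormedType.Exports.

Local Open Scope classical_set_scope.
Local Open Scope ring_scope.

(** * Adapted norm *)

(** The innovations may be discrete, so no irreducibility and no spectral gap on bounded functions
    can be expected: the one contraction at hand is that of [T] on Lipschitz seminorms, got by
    running two copies of the chain with the same noise. The state space is unbounded, which
    threatens every error term. Uniformity in [x] is saved because [u (A x + z) - T u x] is bounded
    by a multiple of [1 + N z] whatever [x] is. Hence the conditional variance is bounded and
    Lipschitz although [u] grows linearly, and the cubic remainder is controlled by the exponential
    moment of the noise alone. The corrector [v] is there because the conditional variance still
    depends on [x]: without it the factor at order [e^2] would vary along the path. The remainder
    adds [n e^3 = n^(3 alpha - 2)] to the exponent, negligible against [n e^2 = n^(2 alpha - 1)]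
    since [alpha < 1]. In the deviation lower bound only points [B l] matter, as the rate is
    infinite off the range of [B]; no tilted measure is built, a pointwise inequality between
    exponentials takes its place. *)

Section adapted_norm.
Context (R : realType).
Local Notation nc := (@Normc.normc R).

Lemma normc_ge0 (z : R[i]) : 0 <= nc z.
Proof. by case: z => a b /=; exact: sqrtr_ge0. Qed.

Lemma real_seq_bound (T : eqType) (f : T -> R) (s : seq T) (M : R) :
  (forall z, z \in s -> f z < M) -> exists2 M', M' < M & forall z, z \in s -> f z <= M'.
Proof.
elim: s => [_|a s ih H]; first by exists (M - 1) => //; rewrite ltrBlDr ltrDl.
have [|M' M'M HM'] := ih; first by move=> z zs; apply: H; rewrite inE zs orbT.
exists (Num.max M' (f a)); first by rewrite gt_max M'M H// mem_head.
move=> z; rewrite inE => /predU1P[->|/HM' zM']; first by rewrite le_max lexx orbT.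
by rewrite le_max zM'.
Qed.

(* Peeling the linear factors off [\prod (X - lambda)] one at a time turns the
   Cayley-Hamilton identity into geometric decay of the entries of [A ^+ n]. *)
Lemma geometric_decay_factor n (A : 'M[R[i]]_n.+1) (r : R) (s : seq R[i]) i j
    (Q : 'M[R[i]]_n.+1) : 0 < r ->
  (forall z, z \in s -> nc z < r) ->
  (exists2 C, 0 <= C & forall k, nc ((A ^+ k * horner_mx A (\prod_(z <- s) ('X - z%:P)) * Q) i j) <= C * r ^+ k) ->
  exists2 C, 0 <= C & forall k, nc ((A ^+ k * Q) i j) <= C * r ^+ k.
Proof.
move=> r0; elim: s Q => [|z s ih] Q zr.
  by rewrite big_nil rmorph1 => -[C C0 H]; exists C => // k; have := H k; rewrite mulr1.
have zr' w : w \in s -> nc w < r by move=> ws; apply: zr; rewrite inE ws orbT.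
rewrite big_cons mulrC rmorphM/= => -[C C0 H].
have [|{}C {}C0 {}H] := ih (horner_mx A ('X - z%:P) * Q) zr'.
  by exists C => // k; have := H k; rewrite !mulrA.
have zlt : nc z < r by apply: zr; rewrite mem_head.
have rz0 : 0 < r - nc z by rewrite subr_gt0.
(* The recursion [a_(k+1) <= C r^k + |z| a_k] preserves [a_k <= C' r^k] as soon as
   [C' (r - |z|) >= C]; the second summand covers [k = 0]. *)
set C' := C / (r - nc z) + nc (Q i j).
exists C' => [|k].
  by rewrite addr_ge0 ?normc_ge0// divr_ge0// ltW.
elim: k => [|k ihk].
  by rewrite expr0 mul1r expr0 mulr1 ler_wpDl// divr_ge0// ltW.
have -> : A ^+ k.+1 * Q = A ^+ k * (horner_mx A ('X - z%:P) * Q) + z *: (A ^+ k * Q).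
  rewrite rmorphB/= horner_mx_X horner_mx_C mulrBl mulrBr exprSr -!mulrA.
  by rewrite [z%:M * Q]mul_scalar_mx scalerAr subrK.
rewrite mxE [X in nc (_ + X)]mxE.
apply: (le_trans (le_normcD _ _)); rewrite Normc.normcM.
apply: (le_trans (lerD (H k) (ler_wpM2l (normc_ge0 _) ihk))).
rewrite exprS -subr_ge0.
have -> : C' * (r * r ^+ k) - (C * r ^+ k + nc z * (C' * r ^+ k)) = ((r - nc z) * C' - C) * r ^+ k by ring.
rewrite mulr_ge0 ?exprn_ge0 ?(ltW r0)//.
by rewrite /C' mulrDr mulrCA divff ?gt_eqF// mulr1 addrC addKr mulr_ge0 ?normc_ge0 ?ltW.
Qed.

Lemma matrix_power_decay n (A : 'M[R]_n.+1) : eigenvalues_in_unit_disk A ->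
  exists2 r : R, 0 < r < 1 & exists2 C, 0 <= C & forall k i j, `|(A ^+ k) i j| <= C * r ^+ k.
Proof.
move=> hA; set B := map_mx (real_complex R) A.
have [s sE] := closed_field_poly_normal (char_poly B).
have sl z : z \in s -> nc z < 1.
  move=> zs; rewrite -ltcR; apply: hA.
  rewrite eigenvalue_root_char sE rootZ ?(monicP (char_poly_monic _)) ?oner_eq0//.
  by rewrite root_prod_XsubC.
have [M M1 HM] := real_seq_bound sl.
(* Only [M < 1] is known of [M]: the midpoint of [M] and 1 lies strictly above every eigenvalue
   modulus, and the maximum with 1/2 keeps [r] positive. *)
pose r := Num.max (2^-1) ((M + 1) / 2).
have r0 : 0 < r by rewrite lt_max invr_gt0 ltr0n.
have r1 : r < 1.
  by rewrite gt_max invf_lt1 ?ltr1n//= ltr_pdivrMr// mul1r -[2]/(1+1) ltrD2r.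
have sr z : z \in s -> nc z < r.
  move=> /HM /le_lt_trans; apply; rewrite lt_max; apply/orP; right.
  by rewrite ltr_pdivlMr// mulr_natr mulr2n ltrD2l.
exists r; first by rewrite r0.
have dec i j : exists2 C, 0 <= C & forall k, `|(A ^+ k) i j| <= C * r ^+ k.
  have [|C C0 H] := @geometric_decay_factor _ B r s i j 1 r0 sr.
    exists 0 => // k; have := Cayley_Hamilton B; rewrite sE.
    rewrite (monicP (char_poly_monic _)) scale1r => ->.
    by rewrite mulr0 mul0r mxE mul0r Normc.normc0.
  exists C => // k; have := H k; rewrite mulr1.
  have -> : (B ^+ k) i j = real_complex R ((A ^+ k) i j).
    by rewrite /B -rmorphXn/= mxE.
  by rewrite /= expr0n/= addr0 sqrtr_sqr.
have /choice[Cf Hf] : forall ij, exists C, 0 <= C /\ forall k, `|(A ^+ k) ij.1 ij.2| <= C * r ^+ k.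
  by move=> [i j]; have [C C0 H] := dec i j; exists C.
exists (\sum_ij Cf ij); first by apply: sumr_ge0 => ij _; case: (Hf ij).
move=> k i j; have [C0 /(_ k)/= H] := Hf (i, j).
apply: (le_trans H); rewrite ler_wpM2r ?exprn_ge0 ?(ltW r0)//.
rewrite (bigD1 (i, j))//= lerDl; apply: sumr_ge0 => ij _; by case: (Hf ij).
Qed.

End adapted_norm.

Section norm1.
Context (R : realType) (n : nat).
Implicit Types x y : 'cV[R]_n.

Lemma norm1_ge0 x : 0 <= norm1 x.
Proof. by apply: sumr_ge0. Qed.

Lemma norm1D x y : norm1 (x + y) <= norm1 x + norm1 y.
Proof. by rewrite -big_split/=; apply: ler_sum => i _; rewrite mxE ler_normD. Qed.

Lemma norm1N x : norm1 (- x) = norm1 x.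
Proof. by apply: eq_bigr => i _; rewrite mxE normrN. Qed.

Lemma norm1_coord x i : `|x i 0| <= norm1 x.
Proof. by rewrite /norm1 (bigD1 i)//= lerDl sumr_ge0. Qed.

Lemma norm1_mulmx (A : 'M[R]_n) c x : (forall i j, `|A i j| <= c) ->
  norm1 (A *m x) <= n%:R * c * norm1 x.
Proof.
move=> Ac; apply: (@le_trans _ _ (\sum_(i < n) c * norm1 x)); last first.
  by rewrite sumr_const card_ord mulr_natl mulrnAl.
apply: ler_sum => i _; rewrite mxE mulr_sumr.
apply: (le_trans (ler_norm_sum _ _ _)); apply: ler_sum => j _.
by rewrite normrM ler_wpM2r.
Qed.

End norm1.

Definition contracting_norm (R : realType) n (A : 'M[R]_n) (N : 'cV[R]_n -> R) (r c : R) :=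
  [/\ 0 < r < 1, (forall x y, N (x + y) <= N x + N y), (forall x, N (- x) = N x),
      (forall x, norm1 x <= N x <= c * norm1 x) & (forall x, N (A *m x) <= r * N x)].

(** The norm sums [r^(-k) |A^k x|_1] over [k <= m], with [r] strictly between the decay rate [r0]
    and 1. Multiplication by [A] shifts the sum and gains a factor [r] on each term; the one new
    term, at [k = m + 1], folds back onto the term [k = 0] once [m] is so large that
    [|A^(m+1) x|_1 <= r^(m+1) |x|_1]. *)
Lemma exists_contracting_norm (R : realType) n (A : 'M[R]_n) : (1 <= n)%N ->
  eigenvalues_in_unit_disk A -> exists N r c, contracting_norm A N r c.
Proof.
case: n A => // n A _ /matrix_power_decay[r0 /andP[r00 r01] [C C0 HC]].
have [r r0r r_lt1] : exists2 r : R, r0 < r & r < 1.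
  exists ((r0 + 1) / 2); first by rewrite ltr_pdivlMr// mulr_natr mulr2n ltrD2l.
  by rewrite ltr_pdivrMr// mul1r -[2]/(1+1) ltrD2r.
have r_gt0 : 0 < r by exact: lt_trans r0r.
have [m Hm] : exists m, n.+1%:R * C * (r0 / r) ^+ m.+1 <= 1.
  have : (n.+1%:R * C * (r0 / r) ^+ m) @[m --> \oo] --> (0 : R).
    rewrite -[X in _ --> X](mulr0 (n.+1%:R * C)).
    apply: cvgMr; apply: cvg_expr; rewrite ger0_norm ?divr_ge0 ?ltW//.
    by rewrite ltr_pdivrMr// mul1r.
  move=> /cvgrPdist_le/(_ 1 ltr01)[m _ /(_ m.+1 (leqnSn m))] /=.
  rewrite sub0r normrN => H; exists m; exact: le_trans (ler_norm _) H.
have Am x : norm1 (A ^+ m.+1 *m x) <= r ^+ m.+1 * norm1 x.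
  apply: (le_trans (norm1_mulmx _ (HC m.+1))).
  rewrite ler_wpM2r ?norm1_ge0//.
  have := ler_wpM2r (exprn_ge0 m.+1 (ltW r_gt0)) Hm.
  rewrite mul1r -!mulrA exprMn exprVn mulfVK//.
  by rewrite expf_neq0// gt_eqF.
have rV k : 0 <= r ^- k by rewrite invr_ge0 exprn_ge0// ltW.
pose N (x : 'cV[R]_n.+1) := \sum_(k < m.+1) r ^- k * norm1 (A ^+ k *m x).
pose K := \sum_(k < m.+1) r ^- k * (n.+1%:R * (C * r0 ^+ k)).
exists N, r, K; split.
- by rewrite r_gt0.
- move=> x y; rewrite /N -big_split/=.
  by apply: ler_sum => k _; rewrite mulmxDr -mulrDr ler_wpM2l ?norm1D.
- by move=> x; apply: eq_bigr => k _; rewrite mulmxN norm1N.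
- move=> x; apply/andP; split.
    rewrite /N big_ord_recl expr0 invr1 mul1r mul1mx lerDl.
    by apply: sumr_ge0 => k _; rewrite mulr_ge0 ?norm1_ge0.
  rewrite /K mulr_suml; apply: ler_sum => k _.
  by rewrite -mulrA ler_wpM2l//; exact: norm1_mulmx.
- move=> x; have AS k : A ^+ k *m (A *m x) = A ^+ k.+1 *m x by rewrite mulmxA exprSr.
  rewrite /N big_ord_recr big_ord_recl/= mulrDr addrC.
  apply: lerD.
    rewrite expr0 invr1 mul1r mul1mx AS mulrC ler_pdivrMr ?exprn_gt0//.
    by rewrite mulrAC -exprS.
  rewrite mulr_sumr; apply: ler_sum => k _; rewrite -[bump 0 k]/(k.+1).
  by rewrite AS [r ^+ k.+1]exprS invfM !mulrA divff ?mul1r ?(gt_eqF r_gt0).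
Qed.

(** * The quadratic rate function *)

Section dot.
Context (R : realType) (q : nat).
Implicit Types (x y z : 'cV[R]_q) (B : 'M[R]_q).

Lemma dotE x y : dot x y = \sum_i x i 0 * y i 0.
Proof. by rewrite /dot mxE; apply: eq_bigr => i _; rewrite mxE. Qed.

Lemma dotC x y : dot x y = dot y x.
Proof. by rewrite !dotE; apply: eq_bigr => i _; rewrite mulrC. Qed.

Lemma dotDr x y z : dot x (y + z) = dot x y + dot x z.
Proof. by rewrite /dot mulmxDr mxE. Qed.

Lemma dotDl x y z : dot (x + y) z = dot x z + dot y z.
Proof. by rewrite dotC dotDr !(dotC z). Qed.

Lemma dotZr k x y : dot x (k *: y) = k * dot x y.
Proof. by rewrite /dot -scalemxAr mxE. Qed.

Lemma dotZl k x y : dot (k *: x) y = k * dot x y.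
Proof. by rewrite dotC dotZr dotC. Qed.

Lemma dotNr x y : dot x (- y) = - dot x y.
Proof. by rewrite -scaleN1r dotZr mulN1r. Qed.

Lemma dotBr x y z : dot x (y - z) = dot x y - dot x z.
Proof. by rewrite dotDr dotNr. Qed.

Lemma dot0l y : dot 0 y = 0.
Proof. by rewrite -(scale0r y) dotZl mul0r. Qed.

Lemma dot_trmx B x y : dot x (B *m y) = dot (B^T *m x) y.
Proof. by rewrite /dot trmx_mul trmxK mulmxA. Qed.

Lemma dot_ge0 x : 0 <= dot x x.
Proof. by rewrite dotE sumr_ge0// => i _; rewrite -expr2 sqr_ge0. Qed.

Lemma dot_eq0 x : dot x x = 0 -> x = 0.
Proof.
move=> x0; apply: (can_inj (@trmxK _ _ _)); rewrite trmx0.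
by apply: rV_mulTmx_eq0; rewrite trmxK; apply/matrixP => i j; rewrite !ord1 [RHS]mxE.
Qed.

Lemma dot_delta i y : dot (delta_mx i 0) y = y i 0.
Proof.
rewrite dotE (bigD1 i)//= big1 ?addr0 => [|j ji]; first by rewrite mxE !eqxx mul1r.
by rewrite mxE (negbTE ji) mul0r.
Qed.

Lemma dot_norm1_le x y : `|dot x y| <= norm1 x * norm1 y.
Proof.
rewrite dotE (le_trans (ler_norm_sum _ _ _))// mulr_suml; apply: ler_sum => i _.
by rewrite normrM ler_wpM2l// norm1_coord.
Qed.

End dot.

Section rate.
Context (R : realType) (q : nat) (B : 'M[R]_q).
Hypothesis BT : B^T = B.
Hypothesis B_ge0 : forall l, 0 <= dot l (B *m l).
Implicit Types (l y : 'cV[R]_q).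

Definition half_quad l := 2^-1 * dot l (B *m l).
Local Notation Q := half_quad.
Local Notation G := (moore_penrose B).
Local Notation I := (mdp_rate B).

Lemma half_quad_ge0 l : 0 <= Q l.
Proof. by rewrite mulr_ge0 ?invr_ge0. Qed.

Lemma dot_sym l y : dot l (B *m y) = dot (B *m l) y.
Proof. by rewrite dot_trmx BT. Qed.

Lemma half_quadD l y : Q (l + y) = Q l + dot (B *m l) y + Q y.
Proof.
rewrite /Q mulmxDr !dotDr !dotDl (dot_sym y l) (dotC (B *m y)) -(dot_sym l y).
by field.
Qed.

Lemma half_quadZ k l : Q (k *: l) = k ^+ 2 * Q l.
Proof. by rewrite /Q -scalemxAr dotZr dotZl; ring. Qed.

(** For symmetric [B], transposing the four Penrose equations permutes them, so [G^T] is again a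
    pseudoinverse of [B]; uniqueness concludes. *)
Lemma moore_penrose_sym : G^T = G.
Proof.
apply: (@is_moore_penrose_uniq _ _ _ B); last exact: moore_penroseP.
move: (moore_penrose B) (moore_penroseP B) => g [h1 h2 h3 h4]; split.
- by rewrite -[RHS]BT -[in RHS]h1 !trmx_mul BT mulmxA.
- by rewrite -[in RHS]h2 !trmx_mul BT mulmxA.
- by rewrite trmx_mul trmxK BT -h4 trmx_mul BT.
- by rewrite trmx_mul trmxK BT -h3 trmx_mul BT.
Qed.

Lemma moore_penrose_comm : G *m B = B *m G.
Proof.
have [_ _ h3 h4] := moore_penroseP B.
by rewrite -h4 trmx_mul moore_penrose_sym BT.
Qed.

(** Since [G] commutes with [B], the condition [G B y = y] says that [y] lies in the range of [B],
    and [l = G y] is a preimage. This parametrization by [l] serves both weak duality and the lower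
    bound. *)
Lemma mdp_rate_fin y : I y != +oo%E -> exists l, y = B *m l /\ I y = (Q l)%:E.
Proof.
rewrite /mdp_rate; case: ifPn => // /eqP yE _; exists (G *m y).
have yE2 : B *m (G *m y) = y by rewrite mulmxA -moore_penrose_comm.
by rewrite {1}yE2 /Q yE2 dotC.
Qed.

Lemma mdp_rate_ge0 y : (0 <= I y)%E.
Proof.
have [->//|/mdp_rate_fin[l [_ ->]]] := eqVneq (I y) +oo%E.
by rewrite lee_fin half_quad_ge0.
Qed.

(** On the range of [B] the tilt [l = G y] attains the rate exactly. Off it, [w = y - B G y] is a
    nonzero vector of the kernel of [B], so [Q] vanishes along its ray while [<w, y> = <w, w> > 0];
    a large multiple of [w] exceeds any [c]. *)
Lemma mdp_rate_dual y c : (c%:E < I y)%E -> exists l, c < dot l y - Q l.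
Proof.
rewrite /mdp_rate; case: ifPn => [/eqP yE|yE].
  rewrite lte_fin => cI; exists (G *m y).
  have yE2 : B *m (G *m y) = y by rewrite mulmxA -moore_penrose_comm.
  rewrite /Q yE2 (dotC _ y) (_ : dot y _ - _ = 2^-1 * dot y (G *m y))//.
  by field.
move=> _; pose w := y - B *m G *m y.
have Bw : B *m w = 0.
  rewrite /w mulmxBr -moore_penrose_comm !mulmxA.
  by have [-> _ _ _] := moore_penroseP B; rewrite subrr.
have w0 : w != 0.
  by apply: contra yE; rewrite /w subr_eq0 moore_penrose_comm eq_sym.
have wy : dot w y = dot w w.
  by rewrite {3}/w dotBr -mulmxA dot_sym Bw dot0l subr0.
have ww : 0 < dot w w.
  rewrite lt_def dot_ge0 andbT; apply: contra w0 => /eqP/dot_eq0 ->//.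
exists ((`|c| + 1) / dot w w *: w).
rewrite half_quadZ /Q Bw (_ : dot w 0 = 0) ?mulr0 ?subr0; last by rewrite dotC dot0l.
rewrite dotZl wy mulfVK ?gt_eqF// (le_lt_trans (ler_norm c))//.
by rewrite ltrDl.
Qed.

(** With [y = B m], this is [Q (l - m) >= 0] expanded. *)
Lemma mdp_rate_weak_dual y l c : (I y <= c%:E)%E -> dot l y - Q l <= c.
Proof.
move=> Iy; have [Iy0|/mdp_rate_fin[m [yE IE]]] := eqVneq (I y) +oo%E.
  by move: Iy; rewrite Iy0.
move: Iy; rewrite IE lee_fin; apply: le_trans; rewrite -subr_ge0 yE.
have := half_quad_ge0 (l - m); rewrite half_quadD.
have -> : Q (- m) = Q m by rewrite -scaleN1r half_quadZ sqrrN expr1n mul1r.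
by rewrite dotNr -dot_sym; lra.
Qed.

End rate.

(** * Topology and measurability on column vectors *)

Section cV_topology.
Context (R : realType) (n : nat).

Lemma norm1_le_normr (x : 'cV[R]_n) : norm1 x <= n%:R * `|x|.
Proof.
rewrite -[n in n%:R]card_ord mulr_natl -sumr_const; apply: ler_sum => i _.
rewrite [`|x|]mx_normrE.
exact: (le_bigmax _ (fun ij : 'I_n * 'I_1 => `|x ij.1 ij.2|) (i, 0)).
Qed.

Lemma norm1_lip_continuous (f : 'cV[R]_n -> R) (K : R) :
  (forall x y, `|f x - f y| <= K * norm1 (x - y)) -> continuous f.
Proof.
move=> fK x U /nbhs_ballP[e /= e0 eU].
pose K' := `|K| * n%:R + 1.
have K'0 : 0 < K' by rewrite ltr_wpDl// mulr_ge0.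
apply/nbhs_ballP; exists (e / K') => /=; first by rewrite divr_gt0.
move=> y; rewrite mx_norm_ball /ball_/= => xy; apply: eU; rewrite /ball/=.
rewrite (le_lt_trans (fK _ _))//.
have := norm1_le_normr (x - y); set u := norm1 _ => nu.
apply: (@le_lt_trans _ _ (K' * `|x - y|)); last by rewrite mulrC -ltr_pdivlMr.
apply: (@le_trans _ _ (`|K| * u)).
  by rewrite ler_wpM2r ?ler_norm// norm1_ge0.
by rewrite /K' mulrDl mul1r -mulrA ler_wpDr// ler_wpM2l.
Qed.

Lemma continuous_measurable_cV (f : 'cV[R]_n -> R) :
  continuous f -> measurable_fun setT f.
Proof.
move=> /continuousP cf.
apply: (measurability _ (RGenOpens.measurableE R)) => _ [_ [a [b ->]] <-].
rewrite setTI; apply: sub_sigma_algebra; apply: cf; exact: interval_open.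
Qed.

Lemma norm1_lip_measurable (f : 'cV[R]_n -> R) (K : R) :
  (forall x y, `|f x - f y| <= K * norm1 (x - y)) -> measurable_fun setT f.
Proof. by move=> /norm1_lip_continuous; exact: continuous_measurable_cV. Qed.

Lemma dot_continuous (l : 'cV[R]_n) : continuous (dot l).
Proof.
apply: (@norm1_lip_continuous _ (norm1 l)) => x y.
by rewrite -dotBr dot_norm1_le.
Qed.

Lemma open_measurable_cV (U : set 'cV[R]_n) : open U -> measurable U.
Proof. exact: sub_sigma_algebra. Qed.

Lemma closed_measurable_cV (U : set 'cV[R]_n) : closed U -> measurable U.
Proof.
by move=> /closed_openC/open_measurable_cV/measurableC; rewrite setCK.
Qed.

(** A box of row vectors is compact as a product of segments, and transposition carries it to
    columns. *)
Lemma cV_closed_bounded_compact (A : set 'cV[R]_n) (M : R) :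
  closed A -> (forall x, A x -> forall i, `|x i 0| <= M) -> compact A.
Proof.
move=> cA AM.
pose K := [set v : 'rV[R]_n | forall i, `[- M, M]%classic (v ord0 i)].
have cK : compact K by apply: (@rV_compact _ _ (fun=> `[- M, M]%classic)) => i; exact: segment_compact.
have ctr : continuous (fun v : 'rV[R]_n => v^T : 'cV[R]_n).
  move=> v U /nbhs_ballP[e e0 eU]; apply/nbhs_ballP; exists e => // w [_ vw].
  by apply: eU; split=> // i j; rewrite !mxE.
apply: (@subclosed_compact _ _ ((fun v : 'rV[R]_n => v^T : 'cV[R]_n) @` K)) => //.
  apply: continuous_compact => //; exact: continuous_subspaceT.
move=> x Ax; exists x^T; last exact: trmxK.
by move=> i /=; rewrite mxE in_itv/= -ler_norml AM.
Qed.

End cV_topology.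

Section rate_topology.
Context (R : realType) (q : nat) (B : 'M[R]_q).
Hypothesis BT : B^T = B.
Hypothesis B_ge0 : forall l, 0 <= dot l (B *m l).
Local Notation Q := (half_quad B).
Local Notation I := (mdp_rate B).

(** The set on which the Chernoff bound with tilt [l] yields a decay rate of at least [c]. By
    duality these open halfspaces cover [{I > c}]. *)
Definition dual_halfspace (c : R) l := [set y | c < dot l y - Q l].

Lemma open_dual_halfspace c l : open (dual_halfspace c l).
Proof.
rewrite (_ : dual_halfspace c l = dot l @^-1` [set x | c + Q l < x]).
  by apply: open_comp; [move=> x _; exact: dot_continuous|exact: open_gt].
by apply/seteqP; split=> y; rewrite /dual_halfspace /= ltrBrDr.
Qed.


(** Far from the origin the [2 q] tilts by signed unit vectors suffice, because [Q] takes there the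
    value [B i i / 2], below the sum of all [|B j j|]. This plays the part of exponential
    tightness. *)
Lemma delta_dual_halfspace (c : R) (y : 'cV[R]_q) (s : bool) i :
  c + \sum_j `|B j j| < (-1) ^+ s * y i 0 ->
  dual_halfspace c ((-1) ^+ s *: delta_mx i 0) y.
Proof.
rewrite /dual_halfspace /= half_quadZ sqrr_sign mul1r dotZl dot_delta.
rewrite /half_quad dot_delta ltrBrDr; apply: le_lt_trans; rewrite lerD2l.
have -> : (B *m (delta_mx i 0 : 'cV[R]_q)) i 0 = B i i.
  rewrite mxE (bigD1 i)//= big1 ?addr0 => [|j ji]; first by rewrite mxE !eqxx mulr1.
  by rewrite mxE (negbTE ji) mulr0.
apply: (@le_trans _ _ `|B i i|); last by rewrite (bigD1 i)//= lerDl sumr_ge0.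
apply: (@le_trans _ _ (2^-1 * `|B i i|)); first by rewrite ler_wpM2l ?invr_ge0// ler_norm.
by rewrite ler_piMl// invf_le1// ler1n.
Qed.

(** Inside a large box, compactness extracts finitely many halfspaces from the cover given by
    [mdp_rate_dual]; outside it, the signed unit vectors take over. Finiteness is what allows a
    union bound later. *)
Lemma finite_dual_cover (F : set 'cV[R]_q) (c : R) : closed F ->
  (forall y, F y -> (c%:E < I y)%E) ->
  exists s : seq 'cV[R]_q, forall y, F y -> exists2 l, l \in s & dual_halfspace c l y.
Proof.
move=> cF FI; pose M := c + \sum_j `|B j j|.
pose K := F `&` [set y | forall i, `|y i 0| <= M].
have cK : compact K.
  apply: (@cV_closed_bounded_compact _ _ _ M) => [|x []//].
  apply: closedI => //.
  rewrite [X in closed X](_ : _ = \bigcap_(i in [set: 'I_q]) ((fun y : 'cV[R]_q => y i 0) @^-1` [set x | `|x| <= M])).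
    apply: closed_bigI => i _; apply: closed_comp.
      by move=> x _; exact: coord_continuous.
    rewrite (_ : [set x | _] = (fun x : R => `|x|) @^-1` [set x | x <= M])//.
    by apply: closed_comp; [move=> x _; exact: norm_continuous|exact: closed_le].
  by apply/seteqP; split=> [y H i _|y H i]; apply: H.
have := cK; rewrite compact_cover => /(_ _ setT (dual_halfspace c)).
case=> [l _|y [Fy _]|D _ KD]; first exact: open_dual_halfspace.
  by have [l] := mdp_rate_dual BT (FI _ Fy); exists l.
pose E := map (fun p : bool * 'I_q => (-1) ^+ p.1 *: delta_mx p.2 0 : 'cV[R]_q) (enum {: bool * 'I_q}).
exists (E ++ finmap.enum_fset D) => y Fy.
have [yM|/existsNP[i /negP]] := pselect (forall i, `|y i 0| <= M).
  by have [l Dl yl] := KD y (conj Fy yM); exists l; rewrite // mem_cat orbC Dl.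
rewrite -ltNge => Mi; pose s := y i 0 < 0.
exists ((-1) ^+ s *: delta_mx i 0).
  rewrite mem_cat; apply/orP; left; apply/mapP; exists (s, i) => //.
  by rewrite mem_enum.
by apply: delta_dual_halfspace; rewrite -normrEsign.
Qed.

(** By the two halves of duality a level set is the intersection of the complements of all dual
    halfspaces, hence closed; the signed unit vectors among the tilts bound it. *)
Lemma good_rate_mdp_rate : good_rate_function I.
Proof.
split=> [y|c c0]; first exact: mdp_rate_ge0.
have -> : [set y | (I y <= c%:E)%E] = \bigcap_(l in [set: 'cV[R]_q]) ~` dual_halfspace c l.
  apply/seteqP; split=> y /=.
    by move=> Iy l _; apply/negP; rewrite -leNgt; exact: mdp_rate_weak_dual.
  move=> H; rewrite leNgt; apply/negP => /(mdp_rate_dual BT)[l].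
  exact: H.
apply: (@cV_closed_bounded_compact _ _ _ (c + \sum_j `|B j j|)).
  apply: closed_bigI => l _; apply: open_closedC; exact: open_dual_halfspace.
move=> y H i; rewrite leNgt; apply/negP => yi.
apply: (H ((-1) ^+ (y i 0 < 0)%R *: delta_mx i 0)) => //.
by apply: delta_dual_halfspace; rewrite -normrEsign.
Qed.

End rate_topology.

(** * From cumulants to the deviation principle *)

Section lim_esup.
Context (R : realType).
Local Open Scope ereal_scope.

Lemma limn_esup_le_near (u : nat -> \bar R) (x : \bar R) :
  (\forall n \near \oo, u n <= x) -> limn_esup u <= x.
Proof.
move=> ux; rewrite /limn_esup limf_esupE.
apply: (@le_trans _ _ (ereal_sup (u @` [set n | u n <= x]))).
  by apply: ereal_inf_lbound; exists [set n | u n <= x].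
by apply: ge_ereal_sup => _ [n /= un <-].
Qed.

Lemma limn_einf_ge_near (u : nat -> \bar R) (x : \bar R) :
  (\forall n \near \oo, x <= u n) -> x <= limn_einf u.
Proof.
move=> ux; rewrite /limn_einf leeNr; apply: limn_esup_le_near.
by apply: filterS ux => n; rewrite leeN2.
Qed.

(** Testing with real [c] below [x] treats a finite infimum of the rate and an infinite one at the
    same time. *)
Lemma le_oppe_real (x y : \bar R) : (forall c : R, c%:E < x -> y <= (- c)%:E) -> y <= - x.
Proof.
case: x => [x| |] H.
- apply/lee_addgt0Pr => e e0; have := H (x - e)%R; rewrite lte_fin gtrBl => /(_ e0).
  by rewrite opprB EFinB addeC.
- rewrite /= leNgt; apply/negP; move: H; case: y => [y| |] H // _.
    by have := H (1 - y)%R (ltry _); rewrite lee_fin; lra.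
  by have := H 0%R (ltry _); rewrite leye_eq.
- by rewrite leey.
Qed.
End lim_esup.

Section gartner_ellis.
Context d (T : measurableType d) (R : realType) (P : probability T R) (q : nat).
Context (S : nat -> T -> 'cV[R]_q) (a : nat -> R) (B : 'M[R]_q).
Hypothesis mS : forall n, measurable_fun setT (S n).
Hypothesis a_oo : a n @[n --> \oo] --> +oo.
Hypothesis BT : B^T = B.
Hypothesis B_ge0 : forall l, 0 <= dot l (B *m l).
Local Notation Q := (half_quad B).
Local Notation I := (mdp_rate B).

(** Valued in the extended reals: for small [n] the moment may be infinite, and only for large [n]
    do the hypotheses below bound it. *)
Definition mgf n l : \bar R := (\int[P]_w (expR (a n * dot l (S n w)))%:E)%E.

Hypothesis mgf_le : forall l e, 0 < e ->
  \forall n \near \oo, (mgf n l <= (expR (a n * (Q l + e)))%:E)%E.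
Hypothesis mgf_ge : forall l e, 0 < e ->
  \forall n \near \oo, ((expR (a n * (Q l - e)))%:E <= mgf n l)%E.

Lemma near_scale_ge (x : R) : \forall n \near \oo, x <= a n.
Proof. by move/cvgryPge : a_oo => /(_ x). Qed.

(** As the speed tends to infinity, any fixed prefactor (a number of halfspaces, a moment bound, a
    factor 2) is absorbed into an arbitrarily small exponential rate. *)
Lemma near_mul_exp (k e : R) : 0 < e -> \forall n \near \oo, k <= expR (a n * e).
Proof.
move=> e0; apply: filterS (near_scale_ge (k / e)) => n an.
apply: (@le_trans _ _ (a n * e)); first by rewrite -ler_pdivrMr.
by apply: le_trans (expR_ge1Dx _); rewrite lerDr.
Qed.

Lemma measurable_dot_comp n l : measurable_fun setT (fun w => dot l (S n w)).
Proof.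
apply: measurableT_comp (mS n).
by apply: continuous_measurable_cV; exact: dot_continuous.
Qed.

Lemma measurable_mgf n l : measurable_fun setT (fun w => (expR (a n * dot l (S n w)))%:E).
Proof.
apply/measurable_EFinP; apply: measurableT_comp => //.
by apply: measurable_funM => //; exact: measurable_dot_comp.
Qed.

Lemma measurable_preimage n (U : set 'cV[R]_q) : measurable U -> measurable (S n @^-1` U).
Proof. by move=> mU; rewrite -[X in measurable X]setTI; exact: mS. Qed.

Lemma chernoff n l c : 0 <= a n ->
  (P (S n @^-1` dual_halfspace B c l) <= (expR (- (a n * (c + Q l))))%:E * mgf n l)%E.
Proof.
move=> an0; have mE : measurable (S n @^-1` dual_halfspace B c l).
  by apply: measurable_preimage; apply: open_measurable_cV; exact: open_dual_halfspace.
rewrite -[X in P X]setIT -integral_indic// -ge0_integralZl//; last exact: measurable_mgf.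
apply: ge0_le_integral => //.
- exact/measurable_EFinP/measurable_indic.
- by apply: emeasurable_funM => //; exact: measurable_mgf.
move=> w _; rewrite -EFinM lee_fin -expRD indicE.
case: (boolP (w \in _)) => [|_]; last by rewrite expR_ge0.
rewrite inE /dual_halfspace/= => H; rewrite -[1%:R]expR0 ler_expR.
by rewrite -mulrN -mulrDr mulr_ge0//; lra.
Qed.

(** Union bound over the finite cover of [F], each halfspace being handled by its own tilt. Half of
    [e] pays for the cumulant estimate, the other half for the number of halfspaces. *)
Lemma ldp_upper_near (F : set 'cV[R]_q) c e : closed F -> 0 < e ->
  (forall y, F y -> (c%:E < I y)%E) ->
  \forall n \near \oo, (P (S n @^-1` F) <= (expR (- (a n * (c - e))))%:E)%E.
Proof.
move=> cF e0 /(finite_dual_cover BT cF)[s Fs].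
have e20 : 0 < e / 2 by rewrite divr_gt0.
have Hl (l : 'cV[R]_q) : \forall n \near \oo,
    (P (S n @^-1` dual_halfspace B c l) <= (expR (- (a n * (c - e / 2))))%:E)%E.
  near=> n.
  have an0 : 0 <= a n by near: n; exact: near_scale_ge.
  apply: (le_trans (chernoff l c an0)).
  apply: (@le_trans _ _ ((expR (- (a n * (c + Q l))))%:E * (expR (a n * (Q l + e / 2)))%:E)%E).
    by apply: lee_wpmul2l; [rewrite lee_fin expR_ge0|near: n; exact: mgf_le].
  by rewrite -EFinM lee_fin -expRD ler_expR; lra.
have Hs (t : seq 'cV[R]_q) : \forall n \near \oo,
    (P (S n @^-1` [set y | exists2 l, l \in t & dual_halfspace B c l y])
      <= (size t)%:R%:E * (expR (- (a n * (c - e / 2))))%:E)%E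
  /\ measurable [set y | exists2 l, l \in t & dual_halfspace B c l y].
  elim: t => [|l t ih].
    apply: nearW => n; have -> : [set y | exists2 l, l \in [::] & dual_halfspace B c l y] = set0.
      by rewrite -subset0 => y [].
    by rewrite preimage_set0 measure0 mul0e.
  have -> : [set y | exists2 l0, l0 \in l :: t & dual_halfspace B c l0 y] =
     dual_halfspace B c l `|` [set y | exists2 l, l \in t & dual_halfspace B c l y].
    apply/seteqP; split=> y.
      by move=> [l0]; rewrite inE => /predU1P[->|]; [left|right; exists l0].
    by move=> [|[l0 lt H]]; [exists l; rewrite ?mem_head|exists l0; rewrite // inE lt orbT].
  near=> n.
  have mH : measurable (dual_halfspace B c l).
    by apply: open_measurable_cV; exact: open_dual_halfspace.
  have [ihn mt] : (P (S n @^-1` [set y | exists2 l, l \in t & dual_halfspace B c l y])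
      <= (size t)%:R%:E * (expR (- (a n * (c - e / 2))))%:E)%E
     /\ measurable [set y | exists2 l, l \in t & dual_halfspace B c l y].
    by near: n.
  split; last exact: measurableU.
  rewrite preimage_setU; apply: (le_trans (measureU2 _ _ _)); try exact: measurable_preimage.
  rewrite /= -natr1 EFinD muleDl// addeC mul1e; apply: leeD => //.
  by near: n; exact: Hl.
near=> n; have [H1 m1] : (P (S n @^-1` [set y | exists2 l, l \in s & dual_halfspace B c l y])
      <= (size s)%:R%:E * (expR (- (a n * (c - e / 2))))%:E)%E
  /\ measurable [set y | exists2 l, l \in s & dual_halfspace B c l y].
  by near: n.
apply: (@le_trans _ _ (P (S n @^-1` [set y | exists2 l, l \in s & dual_halfspace B c l y]))).
  apply: le_measure; rewrite ?inE; try apply: measurable_preimage => //.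
    exact: closed_measurable_cV.
  by move=> w /= /Fs.
apply: (le_trans H1).
apply: (@le_trans _ _ ((expR (a n * (e / 2)))%:E * (expR (- (a n * (c - e / 2))))%:E)%E).
  rewrite -!EFinM lee_fin ler_wpM2r ?expR_ge0//.
  by near: n; exact: near_mul_exp.
by rewrite -EFinM lee_fin -expRD ler_expR; lra.
Unshelve. all: end_near. Qed.

(* Exponential tilting by [l]: on [{S_n \in G}] the density is at most
   [expR (a n * (2 Q l + rho * norm1 l))], and off it some coordinate of [S_n]
   is [rho] away from [B *m l]. *)
Lemma tilting_bound n l (t rho : R) (G : set 'cV[R]_q) w : 0 <= a n -> 0 <= t ->
  (forall z : 'cV[R]_q, (forall i, `|z i 0 - (B *m l) i 0| < rho) -> G z) ->
  expR (a n * dot l (S n w)) <=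
    expR (a n * (2 * Q l + rho * norm1 l)) * \1_(S n @^-1` G) w +
    \sum_(p : bool * 'I_q) expR (- (a n * (t * rho + (-1) ^+ p.1 * t * (B *m l) p.2 0))) *
       expR (a n * dot (l + ((-1) ^+ p.1 * t) *: delta_mx p.2 0) (S n w)).
Proof.
move=> an0 t0 HG; set y := B *m l.
have sum0 : 0 <= \sum_(p : bool * 'I_q) expR (- (a n * (t * rho + (-1) ^+ p.1 * t * y p.2 0))) *
       expR (a n * dot (l + ((-1) ^+ p.1 * t) *: delta_mx p.2 0) (S n w)).
  by apply: sumr_ge0 => p _; rewrite mulr_ge0 ?expR_ge0.
have [H|/existsNP[i /negP]] := pselect (forall i, `|(S n w) i 0 - y i 0| < rho).
  rewrite indicE mem_set/=; last exact: HG.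
  rewrite mulr1 ler_wpDr// ler_expR ler_wpM2l//.
  have -> : S n w = y + (S n w - y) by rewrite addrC subrK.
  rewrite dotDr lerD//; first by rewrite /half_quad mulrA divff ?mul1r.
  apply: (le_trans (ler_norm _)); rewrite dotE mulr_sumr.
  rewrite (le_trans (ler_norm_sum _ _ _))//; apply: ler_sum => i _.
  by rewrite normrM mulrC ler_wpM2r// !mxE; have := H i; rewrite !mxE => /ltW.
rewrite -leNgt => Hi;
set u := _ * \1_ _ _.
have u0 : 0 <= u by rewrite /u indicE mulr_ge0// expR_ge0.
apply: (le_trans _ (lerD u0 (lexx _))).
rewrite add0r.
(* The single summand [p = (s, i)] is enough: its exponent exceeds that of the left-hand side by
   [a n * t * (|(S n w - y) i| - rho)], which is nonnegative. *)
pose s := (S n w) i 0 - y i 0 < 0.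
rewrite (bigD1 (s, i))//=; apply: ler_wpDr.
  by apply: sumr_ge0 => p _; rewrite mulr_ge0 ?expR_ge0.
rewrite -expRD ler_expR dotDl dotZl dot_delta -subr_ge0.
have E (g z v D : R) : - (a n * (t * rho + g * t * z)) + a n * (D + g * t * v) - a n * D =
    a n * t * (g * (v - z) - rho) by ring.
rewrite E.
by rewrite mulr_ge0 ?mulr_ge0// subr_ge0 -normrEsign.
Qed.

(** Integrating [tilting_bound] compares [mgf n l], of order [exp (a Q l)], with [P (S n in G)]
    times an explicit factor plus remainders of order [exp (a (Q l - k))]. The remainders are
    eventually below half of the left-hand side, so the probability must carry the rest. *)
Lemma ldp_lower_near (G : set 'cV[R]_q) l e : open G -> G (B *m l) -> 0 < e ->
  \forall n \near \oo, ((expR (- (a n * (Q l + e))))%:E <= P (S n @^-1` G))%E.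
Proof.
move=> oG; set y := B *m l => Gy e0.
have l1 : 0 < norm1 l + 1 by rewrite ltr_wpDl// norm1_ge0.
have [rho [rho0 rhol HG]] : exists rho : R, [/\ 0 < rho, rho * norm1 l <= e / 4 &
    forall z : 'cV[R]_q, (forall i, `|z i 0 - y i 0| < rho) -> G z].
  have /nbhs_ballP[r0 /= r00 r0G] : nbhs y G by exact: open_nbhs_nbhs.
  exists (Num.min r0 (e / 4 / (norm1 l + 1))); split.
  - by rewrite lt_min r00/= !divr_gt0.
  - apply: (@le_trans _ _ (e / 4 / (norm1 l + 1) * norm1 l)).
      by rewrite ler_wpM2r ?norm1_ge0// ge_min lexx orbT.
    rewrite mulrAC ler_pdivrMr// ler_wpM2l ?divr_ge0 ?(ltW e0)//.
    by rewrite lerDl.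
  - move=> z Hz; apply: r0G; split=> // i j; rewrite ord1 /ball/= distrC.
    by rewrite (lt_le_trans (Hz i))// ge_min lexx.
(* Shifting the tilt by [t] in a coordinate direction gains [t * rho] and costs at most [t^2 C / 2]
   in [Q]. The choice [t = rho / C] is optimal and leaves the net gain [k = t * rho / 2]. *)
pose C := \sum_i `|B i i| + 1.
have C0 : 0 < C by rewrite ltr_wpDl// sumr_ge0.
pose t := rho / C.
have t0 : 0 < t by rewrite divr_gt0.
pose k := t * rho / 2.
have k0 : 0 < k by rewrite divr_gt0// mulr_gt0.
(* The tolerance [dl] is spent on the tilt [l] and on the shifted tilts: [k - 2 dl] must stay
   positive for the remainders to be negligible, and [dl <= e / 4] is one share of the final
   error. *)
pose dl := Num.min (k / 4) (e / 4).
have dl0 : 0 < dl by rewrite lt_min (divr_gt0 k0)// (divr_gt0 e0).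
have dlk : dl <= k / 4 by rewrite ge_min lexx.
have dle : dl <= e / 4 by rewrite ge_min lexx orbT.
pose lp (p : bool * 'I_q) : 'cV[R]_q := l + ((-1) ^+ p.1 * t) *: delta_mx p.2 0.
have Qlp p : Q (lp p) <= Q l + (-1) ^+ p.1 * t * y p.2 0 + k.
  rewrite /lp half_quadD// half_quadZ dotZr (dotC _ (delta_mx _ _)) dot_delta lerD2l.
  rewrite exprMn sqrr_sign mul1r /half_quad dot_delta.
  have -> : (B *m (delta_mx p.2 0 : 'cV[R]_q)) p.2 0 = B p.2 p.2.
    rewrite mxE (bigD1 p.2)//= big1 ?addr0 => [|j ji]; first by rewrite mxE !eqxx mulr1.
    by rewrite mxE (negbTE ji) mulr0.
  have BC : B p.2 p.2 <= C.
    rewrite (le_trans (ler_norm _))// /C (bigD1 p.2)//= -addrA lerDl addr_ge0// sumr_ge0//.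
  have -> : k = t ^+ 2 * (2^-1 * C).
    by rewrite /k /t; field; rewrite gt_eqF.
  by rewrite ler_wpM2l ?sqr_ge0// ler_wpM2l// invr_ge0.
have Hp : \forall n \near \oo, forall p, (mgf n (lp p) <= (expR (a n * (Q (lp p) + dl)))%:E)%E.
  by apply: filter_forall => p; exact: mgf_le.
pose K : R := #|{: bool * 'I_q}|%:R.
near=> n.
have an0 : 0 <= a n by near: n; exact: near_scale_ge.
have mG : measurable (S n @^-1` G) by apply: measurable_preimage; exact: open_measurable_cV.
have Pfin : P (S n @^-1` G) \is a fin_num by exact: fin_num_measure.
set cG := expR (a n * (2 * Q l + rho * norm1 l)).
pose cp (p : bool * 'I_q) := expR (- (a n * (t * rho + (-1) ^+ p.1 * t * y p.2 0))).
have H1 : (mgf n l <= cG%:E * P (S n @^-1` G) + \sum_p (cp p)%:E * mgf n (lp p))%E.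
  have <- : (\int[P]_w (cG * \1_(S n @^-1` G) w)%:E = cG%:E * P (S n @^-1` G))%E.
    under eq_integral do rewrite EFinM.
    rewrite ge0_integralZl ?lee_fin ?expR_ge0//.
      by rewrite integral_indic// setIT.
    exact/measurable_EFinP/measurable_indic.
  have mt p : measurable_fun setT (fun w => (cp p * expR (a n * dot (lp p) (S n w)))%:E).
    under eq_fun do rewrite EFinM.
    apply: emeasurable_funM => //; exact: measurable_mgf.
  have <- : (\int[P]_w (\sum_p (cp p * expR (a n * dot (lp p) (S n w)))%:E) = \sum_p (cp p)%:E * mgf n (lp p))%E.
    rewrite ge0_integral_sum//; last by move=> p w _; rewrite lee_fin mulr_ge0 ?expR_ge0.
    apply: eq_bigr => p _; under eq_integral do rewrite EFinM.
    by rewrite ge0_integralZl ?lee_fin ?expR_ge0//; exact: measurable_mgf.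
  have mi : measurable_fun setT (fun w => (cG * \1_(S n @^-1` G) w)%:E).
    by apply/measurable_EFinP; apply: measurable_funM => //; exact: measurable_indic.
  rewrite -ge0_integralD//; last 3 first.
  - by move=> w _; rewrite lee_fin mulr_ge0 ?expR_ge0.
  - by move=> w _; apply: sume_ge0 => p _; rewrite lee_fin mulr_ge0 ?expR_ge0.
  - exact: emeasurable_sum.
  apply: ge0_le_integral => //.
  - exact: measurable_mgf.
  - by apply: emeasurable_funD => //; exact: emeasurable_sum.
  move=> w _; rewrite sumEFin -EFinD lee_fin.
  exact: tilting_bound (ltW t0) HG.
have Hpn : forall p, (mgf n (lp p) <= (expR (a n * (Q (lp p) + dl)))%:E)%E by near: n.
have H2 : (\sum_p (cp p)%:E * mgf n (lp p) <= (K * expR (a n * (Q l - k + dl)))%:E)%E.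
  rewrite /K -sum1_card natr_sum mulr_suml -sumEFin; apply: lee_sum => p _.
  apply: (@le_trans _ _ ((cp p)%:E * (expR (a n * (Q (lp p) + dl)))%:E)%E).
    by apply: lee_wpmul2l; [rewrite lee_fin expR_ge0|exact: Hpn].
  rewrite -EFinM lee_fin -expRD mul1r ler_expR -mulrN -mulrDr ler_wpM2l//.
  have := Qlp p; have : t * rho = 2 * k by rewrite /k; field.
  by move: (_ * y _ _) => u -> ; lra.
have H3 : ((expR (a n * (Q l - dl)))%:E <= mgf n l)%E by near: n; exact: mgf_ge.
have := le_trans H3 (le_trans H1 (leeD2l _ H2)).
rewrite -(fineK Pfin); set p := fine _; rewrite -EFinM -EFinD !lee_fin => H4.
have H5 : 2 * K <= expR (a n * (k - 2 * dl)).
  near: n; apply: near_mul_exp; lra.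
have H6 : 2 <= expR (a n * (e / 2)) by near: n; apply: near_mul_exp; rewrite divr_gt0.
have H7 : K * expR (a n * (Q l - k + dl)) <= 2^-1 * expR (a n * (Q l - dl)).
  have -> : a n * (Q l - dl) = a n * (k - 2 * dl) + a n * (Q l - k + dl) by ring.
  by rewrite expRD mulrA ler_wpM2r ?expR_ge0//; lra.
have H8 : 2^-1 * expR (a n * (Q l - dl)) <= cG * p by lra.
have cG0 : 0 < cG by exact: expR_gt0.
rewrite -(ler_pM2l cG0); apply: le_trans H8; rewrite -expRD.
apply: (@le_trans _ _ (2^-1 * (expR (a n * (e / 2)) * expR (a n * (2 * Q l + rho * norm1 l) - a n * (Q l + e))))).
  set u := expR (_ - _).
  apply: (@le_trans _ _ (1 * u)); first by rewrite mul1r.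
  rewrite [leRHS]mulrA ler_wpM2r ?expR_ge0//.
  by rewrite ler_pdivlMl// mulr1.
rewrite ler_wpM2l ?invr_ge0// -expRD ler_expR -mulrN -!mulrDr ler_wpM2l//; lra.
Unshelve. all: end_near. Qed.

End gartner_ellis.

Definition mdp_speed (R : realType) (alpha : R) (n : nat) : R := n%:R `^ (2 * alpha - 1).

Lemma mdp_speed_cvgy (R : realType) (alpha : R) : 2^-1 < alpha ->
  mdp_speed alpha n @[n --> \oo] --> +oo.
Proof.
move=> a2; have b0 : 0 < 2 * alpha - 1 by lra.
apply/cvgryPge => M; near=> n.
pose M' := Num.max 1 M `^ (2 * alpha - 1)^-1.
have nM : M' <= n%:R by near: n; exact: nbhs_infty_ger.
apply: (@le_trans _ _ (M' `^ (2 * alpha - 1))).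
  rewrite /M' -powRrM mulVf ?gt_eqF// powRr1 ?le_max ?ler01//.
  by rewrite lexx orbT.
by rewrite /mdp_speed ge0_ler_powR ?nnegrE ?(ltW b0)// powR_ge0.
Unshelve. all: end_near. Qed.

Lemma gartner_ellis_mdp d (T : measurableType d) (R : realType) (P : probability T R)
    (q : nat) (S : nat -> T -> 'cV[R]_q) (B : 'M[R]_q) (alpha : R) :
  2^-1 < alpha -> (forall n, measurable_fun setT (S n)) -> B^T = B ->
  (forall l, 0 <= dot l (B *m l)) ->
  (forall l (e : R), 0 < e -> \forall n \near \oo,
     (mgf P S (mdp_speed alpha) n l <=
      (expR (mdp_speed alpha n * (half_quad B l + e)))%:E)%E) ->
  (forall l (e : R), 0 < e -> \forall n \near \oo,
     ((expR (mdp_speed alpha n * (half_quad B l - e)))%:E <=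
      mgf P S (mdp_speed alpha) n l)%E) ->
  moderate_deviation_principle P alpha S (mdp_rate B).
Proof.
move=> a2 mS BT B0 Hle Hge; pose a := mdp_speed alpha.
have a_oo : a n @[n --> \oo] --> +oo by exact: mdp_speed_cvgy.
have a_gt0 : \forall n \near \oo, 0 < a n.
  by apply: filterS (near_scale_ge a_oo 1) => n; exact: lt_le_trans.
split; first exact: good_rate_mdp_rate.
- move=> F cF; apply: le_oppe_real => c cI.
  apply/lee_addgt0Pr => e e0; apply: limn_esup_le_near.
  have FI y : F y -> (c%:E < mdp_rate B y)%E.
    by move=> Fy; apply: (lt_le_trans cI); apply: ereal_inf_lbound; exists y.
  have H := ldp_upper_near mS a_oo BT Hle cF e0 FI.
  near=> n; have an0 : 0 < a n by near: n.
  apply: (@le_trans _ _ ((a n)^-1%:E * lne (expR (- (a n * (c - e))))%:E)%E).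
    apply: lee_wpmul2l; first by rewrite lee_fin invr_ge0 ltW.
    rewrite lee_lne ?in_itv/= ?leey ?measure_ge0 ?lee_fin ?expR_ge0//.
    by near: n.
  rewrite lne_EFin ?expR_gt0// expRK -EFinM -EFinD lee_fin.
  by rewrite mulrN mulKf ?gt_eqF// opprB addrC.
- move=> G oG; rewrite leeNl; apply: le_ereal_inf_tmp => _ [y Gy <-].
  (* Points of infinite rate impose nothing; every other point is some [B l], which is where
     [ldp_lower_near] applies. *)
  have [->|/(mdp_rate_fin BT)[l [yE ->]]] := eqVneq (mdp_rate B y) +oo%E; first exact: leey.
  rewrite leeNl; apply/lee_addgt0Pr => e e0; rewrite -leeBlDr//.
  apply: limn_einf_ge_near.
  have H : \forall n \near \oo, ((expR (- (a n * (half_quad B l + e))))%:E <= P (S n @^-1` G))%E.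
    by apply: ldp_lower_near => //; rewrite -yE.
  near=> n; have an0 : 0 < a n by near: n.
  apply: (@le_trans _ _ ((a n)^-1%:E * lne (expR (- (a n * (half_quad B l + e))))%:E)%E); last first.
    apply: lee_wpmul2l; first by rewrite lee_fin invr_ge0 ltW.
    rewrite lee_lne ?in_itv/= ?leey ?measure_ge0 ?lee_fin ?expR_ge0//.
    by near: n.
  rewrite lne_EFin ?expR_gt0// expRK -EFinM -EFinN -EFinB lee_fin.
  by rewrite mulrN mulKf ?gt_eqF// opprD.
Unshelve. all: end_near. Qed.

(** * Driven recursions *)

Section mfun_of.
Context d d' (T : measurableType d) (E : measurableType d').

Definition mfun_of (f : T -> E) (mf : measurable_fun setT f) : {mfun T >-> E} :=
  HB.pack f (isMeasurableFun.Build _ _ _ _ f mf).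

End mfun_of.

Section driven_recursion.
Context d dV dE (T : measurableType d) (V : measurableType dV) (E : measurableType dE)
  (R : realType) (P : probability T R) (Z : nat -> {RV P >-> V}).
Context (y0 : E) (Y : nat -> T -> E) (Phi : nat -> E * V -> E).
Hypothesis indep : mutually_independent Z.
Hypothesis mPhi : forall n, measurable_fun setT (Phi n).
Hypothesis Y0 : forall w, Y 0%N w = y0.
Hypothesis YS : forall n w, Y n.+1 w = Phi n (Y n w, Z n w).

Lemma driven_measurable n : measurable_fun setT (Y n).
Proof.
elim: n => [|n ih].
  by rewrite (_ : Y 0 = cst y0)//; apply/funext => w; rewrite Y0.
rewrite (_ : Y n.+1 = Phi n \o (fun w => (Y n w, Z n w))); last first.
  by apply/funext => w; rewrite YS.
by apply: measurableT_comp => //; apply/measurable_fun_pairP; split.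
Qed.

Let X n : {RV P >-> E} := mfun_of (driven_measurable n).
Let YZ n : {RV P >-> (E * V)%type} :=
  mfun_of (measurable_fun_pair (driven_measurable n) (measurable_funPT (Z n))).
Let future (J : seq nat) (U : nat -> set V) := \bigcap_(j in [set` J]) Z j @^-1` U j.

Lemma measurable_future J U : (forall j, measurable (U j)) -> measurable (future J U).
Proof.
move=> mU; apply: fin_bigcap_measurable => // j _.
by rewrite -[X in measurable X]setTI; exact: measurable_funPT.
Qed.

(** Both sides are finite measures in [W]: the image under [(Y n, Z n)] of [P] restricted to the
    future event, and a multiple of the product law. They agree on rectangles, a generating class
    closed under intersection, hence everywhere. *)
Lemma joint_future n J U (mU : forall j, measurable (U j)) :
  (forall A B, measurable A -> measurable B ->
    P (Y n @^-1` A `&` (Z n @^-1` B `&` future J U)) =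
    (P (Y n @^-1` A) * P (Z n @^-1` B) * \prod_(j <- J) P (Z j @^-1` U j))%E) ->
  forall W, measurable W -> P ((fun w => (Y n w, Z n w)) @^-1` W `&` future J U) =
    ((\prod_(j <- J) P (Z j @^-1` U j)) * (distribution P (X n) \x distribution P (Z n)) W)%E.
Proof.
move=> H W mW.
have c_fin : (\prod_(j <- J) P (Z j @^-1` U j))%E \is a fin_num.
  elim: J {H} => [|j J ih]; first by rewrite big_nil.
  rewrite big_cons fin_numM// fin_num_measure// -[X in measurable X]setTI.
  exact: measurable_funPT.
have c_ge0 : 0 <= fine (\prod_(j <- J) P (Z j @^-1` U j))%E.
  by apply/fine_ge0/prode_ge0 => j _; exact: measure_ge0.
pose c : {nonneg R} := NngNum c_ge0.
pose m1 := pushforward (mrestr P (measurable_future J mU)) (YZ n).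
pose m2 := mscale c (distribution P (X n) \x distribution P (Z n))%E.
have cE : (c%:num%:E = \prod_(j <- J) P (Z j @^-1` U j))%E by rewrite /= fineK.
suff : m1 W = m2 W by rewrite /m2 /mscale cE.
pose G : set (set (E * V)) :=
  [set C | exists A, measurable A /\ exists B, measurable B /\ C = A `*` B].
apply: (measure_unique G (fun=> setT)) => //.
- rewrite measurable_prod_measurableType //; congr (<<s _ >>).
  rewrite predeqE => C; split => [[A mA [B mB <-]]|[A [mA [B [mB ->]]]]].
    by exists A; split => //; exists B.
  by exists A => //; exists B.
- move=> /= _ _ [X1 [mX1 [X2 [mX2 ->]]]] [Y1 [mY1 [Y2 [mY2 ->]]]].
  rewrite -setXI; exists (X1 `&` Y1); split; first exact: measurableI.
  by exists (X2 `&` Y2); split => //; exact: measurableI.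
- by move=> _; exists setT; split=> //; exists setT; split=> //; rewrite setXTT.
- by rewrite bigcup_const.
- move=> _ [A [mA [B [mB ->]]]].
  change (P (YZ n @^-1` (A `*` B) `&` future J U) =
    (c%:num%:E * (distribution P (X n) \x distribution P (Z n)) (A `*` B))%E).
  rewrite cE product_measure1E//.
  have -> : YZ n @^-1` (A `*` B) = Y n @^-1` A `&` Z n @^-1` B by [].
  by rewrite -setIA H// muleC.
- move=> k; change (P (YZ n @^-1` setT `&` future J U) < +oo)%E.
  rewrite preimage_setT setTI.
  by rewrite (le_lt_trans (probability_le1 _ _)) ?ltry//; exact: measurable_future.
Qed.

Lemma bigcap_consE (j : nat) (J : seq nat) (U : nat -> set T) :
  \bigcap_(i in [set` j :: J]) U i = U j `&` \bigcap_(i in [set` J]) U i.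
Proof.
apply/seteqP; split=> w.
  by move=> H; split=> [|i /= iJ]; apply: H; rewrite /= inE ?eqxx// iJ orbT.
by move=> [H1 H2] i; rewrite /= inE => /predU1P[->//|]; exact: H2.
Qed.

(** Induction on [n], with all finite families of times from [n] on quantified inside. To pass to
    [n + 1], the innovation at time [n] is moved from the future into the present, so the induction
    hypothesis is needed for a family that contains [n]. *)
Lemma driven_independent n J U : uniq J -> (forall j, j \in J -> (n <= j)%N) ->
  (forall j, measurable (U j)) -> forall A, measurable A ->
  P (Y n @^-1` A `&` future J U) =
    (P (Y n @^-1` A) * \prod_(j <- J) P (Z j @^-1` U j))%E.
Proof.
elim: n J U => [|n ih] J U uJ nJ mU A mA.
  have [Ay|nAy] := pselect (A y0).
    have -> : Y 0 @^-1` A = setT by apply/seteqP; split=> w //= _; rewrite Y0.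
    by rewrite setTI probability_setT mul1e; exact: indep.
  have -> : Y 0 @^-1` A = set0 by apply/seteqP; split=> w //=; rewrite Y0.
  by rewrite set0I measure0 mul0e.
have joint (K : seq nat) (B : nat -> set V) : uniq K -> (forall j, j \in K -> (n < j)%N) ->
    (forall j, measurable (B j)) -> forall W, measurable W ->
    P ((fun w => (Y n w, Z n w)) @^-1` W `&` future K B) =
    ((\prod_(j <- K) P (Z j @^-1` B j)) * (distribution P (X n) \x distribution P (Z n)) W)%E.
  move=> uK nK mB; apply: joint_future => // A' C mA' mC.
  (* Prescribing [C] at time [n] and [B] afterwards turns the event on [Z n] and the later events
     into one family indexed by [n :: K]. *)
  pose B' j := if j == n then C else B j.
  have nnK : n \notin K by apply/negP => /nK; rewrite ltnn.
  have B'E j : j \in K -> B' j = B j.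
    by move=> jK; rewrite /B'; case: eqP => // jn; move: nnK; rewrite -jn jK.
  have := ih (n :: K) B'; rewrite /= nnK uK => /(_ isT).
  have -> : future (n :: K) B' = Z n @^-1` C `&` future K B.
    rewrite /future bigcap_consE {1}/B' eqxx; congr (_ `&` _).
    by apply: eq_bigcapr => j jK; rewrite B'E.
  move=> ->//; last 2 first.
  - by move=> j; rewrite inE => /predU1P[->//|/nK/ltnW].
  - by move=> j; rewrite /B'; case: ifP.
  rewrite big_cons {1}/B' eqxx muleA; congr (_ * _)%E.
  by apply: eq_big_seq => j jK; rewrite B'E.
have YSE : Y n.+1 @^-1` A = (fun w => (Y n w, Z n w)) @^-1` (Phi n @^-1` A).
  by apply/seteqP; split=> w /=; rewrite YS.
have mW : measurable (Phi n @^-1` A) by rewrite -[X in measurable X]setTI; exact: mPhi.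
rewrite YSE joint//.
have := joint [::] U isT (fun _ => _) mU _ mW.
rewrite big_nil mul1e => <- //; rewrite muleC; congr (_ * _)%E; congr (P _).
by rewrite /future set_nil bigcap_set0 setIT.
Qed.

Lemma driven_joint n W : measurable W ->
  P ((fun w => (Y n w, Z n w)) @^-1` W) = (distribution P (X n) \x distribution P (Z n))%E W.
Proof.
move=> mW; have := @joint_future n [::] (fun=> setT) (fun=> measurableT) _ W mW.
rewrite /future set_nil bigcap_set0 setIT big_nil mul1e; apply => A B mA mB.
have := @driven_independent n [:: n] (fun=> B) isT _ (fun=> mB) A mA.
rewrite /future bigcap_consE set_nil bigcap_set0 !setIT !mule1 big_cons big_nil mule1; apply.
by move=> j; rewrite inE => /eqP ->.
Qed.

(** The Markov property in integrated form. Independence of the innovations enters all later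
    arguments through this identity, both for the chain with its running sum and for the backward
    iteration, whose map depends on time. *)
Lemma driven_integral n (f : E * V -> \bar R) : measurable_fun setT f ->
  (forall z, 0 <= f z)%E ->
  (\int[P]_w f (Y n w, Z n w) = \int[P]_w \int[distribution P (Z n)]_z f (Y n w, z))%E.
Proof.
move=> mf f0.
have -> : (\int[P]_w f (Y n w, Z n w) = \int[distribution P (YZ n)]_x f x)%E.
  by rewrite ge0_integral_distribution.
have -> : (\int[distribution P (YZ n)]_x f x =
    \int[distribution P (X n) \x distribution P (Z n)]_x f x)%E.
  by apply: eq_measure_integral => W mW _; exact: driven_joint.
rewrite fubini_tonelli1// ge0_integral_distribution//.
- exact: measurable_fun_fubini_tonelli_F.
- by move=> y; apply: integral_ge0 => z _; exact: f0.
Qed.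

End driven_recursion.

(** * Lipschitz functions and integrability in the adapted norm *)

Section contracting_norm_theory.
Context (R : realType) (n : nat) (A : 'M[R]_n) (N : 'cV[R]_n -> R) (r c : R).
Hypothesis hN : contracting_norm A N r c.
Implicit Types (x y z : 'cV[R]_n) (f g : 'cV[R]_n -> R) (K L : R).

Lemma cn_r_gt0 : 0 < r. Proof. by case: hN => /andP[]. Qed.
Lemma cn_r_lt1 : r < 1. Proof. by case: hN => /andP[]. Qed.
Lemma cnD x y : N (x + y) <= N x + N y. Proof. by case: hN. Qed.
Lemma cnN x : N (- x) = N x. Proof. by case: hN. Qed.
Lemma cn_ge_norm1 x : norm1 x <= N x. Proof. by case: hN => _ _ _ /(_ x)/andP[]. Qed.
Lemma cn_le_norm1 x : N x <= c * norm1 x. Proof. by case: hN => _ _ _ /(_ x)/andP[]. Qed.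
Lemma cn_mulmx x : N (A *m x) <= r * N x. Proof. by case: hN. Qed.
Lemma cn_ge0 x : 0 <= N x. Proof. exact: le_trans (norm1_ge0 _) (cn_ge_norm1 x). Qed.

Lemma cnB x y : N (x - y) <= N x + N y.
Proof. by rewrite (le_trans (cnD _ _))// cnN. Qed.

Lemma cn0 : N 0 = 0.
Proof.
apply/eqP; rewrite eq_le cn_ge0 andbT (le_trans (cn_le_norm1 _))//.
by rewrite /norm1 big1 ?mulr0// => i _; rewrite mxE normr0.
Qed.

Definition lipN (L : R) (f : 'cV[R]_n -> R) := forall x y, `|f x - f y| <= L * N (x - y).

Lemma cn_lip : lipN 1 N.
Proof.
move=> x y; rewrite mul1r ler_distl; apply/andP; split.
  by rewrite lerBlDr addrC -lerBlDr; have := cnB x (x - y); rewrite opprB addrC subrK; lra.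
have := cnD y (x - y); rewrite addrC subrK; lra.
Qed.

Lemma lipN_norm1 L f : lipN L f -> forall x y, `|f x - f y| <= `|L| * c * norm1 (x - y).
Proof.
move=> Lf x y; rewrite (le_trans (Lf x y))//.
rewrite (le_trans (ler_wpM2r (cn_ge0 _) (ler_norm L)))// -mulrA ler_wpM2l//.
exact: cn_le_norm1.
Qed.

Lemma lipN_continuous L f : lipN L f -> continuous f.
Proof. by move=> /lipN_norm1 /norm1_lip_continuous. Qed.

Lemma lipN_measurable L f : lipN L f -> measurable_fun setT f.
Proof. by move=> /lipN_norm1 /norm1_lip_measurable. Qed.

Lemma cn_measurable : measurable_fun setT N.
Proof. exact: lipN_measurable cn_lip. Qed.

Lemma lipN_growth L f x : 0 <= L -> lipN L f -> `|f x| <= (`|f 0| + L) * (1 + N x).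
Proof.
move=> L0 Lf; have := Lf x 0; rewrite subr0 => H.
have : `|f x| <= `|f x - f 0| + `|f 0| by rewrite -{1}(subrK (f 0) (f x)) ler_normD.
have := cn_ge0 x; have : 0 <= `|f 0| by []; nra.
Qed.

Lemma lipN_shift L f a : lipN L f -> lipN L (fun z => f (a + z)).
Proof. by move=> Lf x y; have := Lf (a + x) (a + y); rewrite opprD addrACA subrr add0r. Qed.

Lemma lipND L L' f g : lipN L f -> lipN L' g -> lipN (L + L') (fun x => f x + g x).
Proof.
move=> Lf Lg x y; rewrite mulrDl opprD addrACA (le_trans (ler_normD _ _))//.
by rewrite lerD.
Qed.

Lemma lipNZ L k f : lipN L f -> lipN (`|k| * L) (fun x => k * f x).
Proof. by move=> Lf x y; rewrite -mulrBr normrM -mulrA ler_wpM2l. Qed.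

Lemma lipN_cst k : lipN 0 (fun=> k).
Proof. by move=> x y; rewrite subrr normr0 mul0r. Qed.

Lemma lipN_weak L L' f : L <= L' -> lipN L f -> lipN L' f.
Proof. by move=> LL Lf x y; rewrite (le_trans (Lf x y))// ler_wpM2r// cn_ge0. Qed.

Lemma lipN_sum (I : Type) (s : seq I) (L : I -> R) (f : I -> 'cV[R]_n -> R) :
  (forall i, lipN (L i) (f i)) -> lipN (\sum_(i <- s) L i) (fun x => \sum_(i <- s) f i x).
Proof.
move=> Lf x y; rewrite -sumrB (le_trans (ler_norm_sum _ _ _))// mulr_suml.
by apply: ler_sum => i _; exact: Lf.
Qed.

Section integrable.
Context (m : probability 'cV[R]_n R) (k : R).
Hypothesis k0 : 0 < k.
Hypothesis mexp : (\int[m]_z (expR (k * N z))%:E < +oo)%E.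

Lemma measurable_expN a : measurable_fun setT (fun z => expR (a * N z)).
Proof.
apply: measurableT_comp => //; apply: measurable_funM => //; exact: cn_measurable.
Qed.

Lemma integrable_expN : m.-integrable setT (EFin \o (fun z => expR (k * N z))).
Proof.
apply/integrableP; split; first by apply/measurable_EFinP; exact: measurable_expN.
under eq_integral do rewrite gee0_abs ?lee_fin ?expR_ge0//.
exact: mexp.
Qed.

Lemma integrable_exp_growth f K : measurable_fun setT f ->
  (forall z, `|f z| <= K * expR (k * N z)) -> m.-integrable setT (EFin \o f).
Proof.
move=> mf fK; apply: (@le_integrable _ _ _ m setT measurableT _ (EFin \o (fun z => K * expR (k * N z)))).
- exact/measurable_EFinP.
- by move=> z _ /=; rewrite lee_fin (le_trans (fK z))// ler_norm.
- rewrite (_ : _ \o _ = (fun z => K%:E * (EFin \o (fun z => expR (k * N z))) z)%E)//.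
  exact: integrableZl integrable_expN.
Qed.

Lemma one_plus_cn_le_exp a z : 0 < a -> 1 + N z <= (1 + a^-1) * expR (a * N z).
Proof.
move=> a0; rewrite mulrDl mul1r; apply: lerD.
  by rewrite -expR0 ler_expR mulr_ge0 ?cn_ge0// ltW.
rewrite ler_pdivlMl//; apply: le_trans (expR_ge1Dx _); by rewrite lerDr.
Qed.

Lemma integrable_growth f K : measurable_fun setT f ->
  (forall z, `|f z| <= K * (1 + N z)) -> m.-integrable setT (EFin \o f).
Proof.
move=> mf fK; apply: (@integrable_exp_growth _ (`|K| * (1 + k^-1))) => // z.
rewrite (le_trans (fK z))//; have N1 : 0 <= 1 + N z by rewrite addr_ge0 ?cn_ge0.
rewrite (le_trans (ler_wpM2r N1 (ler_norm K)))// -mulrA ler_wpM2l//.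
exact: one_plus_cn_le_exp.
Qed.

Lemma integrable_growthM f g K L : measurable_fun setT f -> measurable_fun setT g ->
  (forall z, `|f z| <= K * (1 + N z)) -> (forall z, `|g z| <= L * (1 + N z)) ->
  m.-integrable setT (EFin \o (fun z => f z * g z)).
Proof.
move=> mf mg fK gL; pose a := k / 2.
have a0 : 0 < a by rewrite divr_gt0.
have ab f' K' z : (forall z, `|f' z| <= K' * (1 + N z)) ->
    `|f' z| <= (`|K'| * (1 + a^-1)) * expR (a * N z).
  move=> /(_ z)/le_trans; apply; have N1 : 0 <= 1 + N z by rewrite addr_ge0 ?cn_ge0.
  rewrite (le_trans (ler_wpM2r N1 (ler_norm K')))// -mulrA ler_wpM2l//.
  exact: one_plus_cn_le_exp.
apply: (@integrable_exp_growth _ ((`|K| * (1 + a^-1)) * (`|L| * (1 + a^-1)))).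
  exact: measurable_funM.
move=> z; rewrite normrM.
have -> : expR (k * N z) = expR (a * N z) * expR (a * N z).
  by rewrite -expRD -mulrDl -splitr.
by rewrite mulrACA ler_pM// ab.
Qed.

Lemma integrable_lipN L f : 0 <= L -> lipN L f -> m.-integrable setT (EFin \o f).
Proof.
move=> L0 Lf; apply: (@integrable_growth _ (`|f 0| + L)); first exact: lipN_measurable Lf.
by move=> z; exact: lipN_growth.
Qed.

Lemma integrable_cN : m.-integrable setT (EFin \o N).
Proof. exact: (integrable_lipN ler01 cn_lip). Qed.

End integrable.
End contracting_norm_theory.

Section Rintegral_bounds.
Context d (T : measurableType d) (R : realType) (m : probability T R).
Implicit Types f g : T -> R.

Lemma Rintegral_prob_cst (a : R) : \int[m]_x a = a.
Proof.
rewrite Rintegral_cst//.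
have -> : fine (m setT) = 1 by rewrite probability_setT.
by rewrite mulr1.
Qed.

Lemma integrable_prob_cst (a : R) : m.-integrable setT (EFin \o (fun=> a)).
Proof. exact: finite_measure_integrable_cst. Qed.

Lemma normr_Rintegral_le f g : m.-integrable setT (EFin \o f) ->
  m.-integrable setT (EFin \o g) -> (forall x, `|f x| <= g x) ->
  `|\int[m]_x f x| <= \int[m]_x g x.
Proof.
move=> fi gi fg; rewrite (le_trans (le_normr_Rintegral _ _))//.
apply: le_Rintegral => //.
have := integrable_abse fi; apply: eq_integrable => //.
Qed.

Lemma normr_Rintegral_cst_le f (K : R) : m.-integrable setT (EFin \o f) ->
  (forall x, `|f x| <= K) -> `|\int[m]_x f x| <= K.
Proof.
move=> fi fK; rewrite -[leRHS]Rintegral_prob_cst.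
by apply: normr_Rintegral_le => //; exact: integrable_prob_cst.
Qed.

End Rintegral_bounds.

Section real_integrable.
Context d (T : measurableType d) (R : realType) (m : {measure set T -> \bar R}).
Implicit Types f g : T -> R.
Local Notation int f := (m.-integrable setT (EFin \o f)).

Lemma integrable_addf f g : int f -> int g -> int (fun x => f x + g x).
Proof. by move=> fi gi; exact: (integrableD measurableT fi gi). Qed.

Lemma integrable_subf f g : int f -> int g -> int (fun x => f x - g x).
Proof. by move=> fi gi; exact: (integrableB measurableT fi gi). Qed.

Lemma integrable_scalef (k : R) f : int f -> int (fun x => k * f x).
Proof. by move=> fi; exact: (integrableZl measurableT k fi). Qed.

Lemma integrable_measurable f : int f -> measurable_fun setT f.
Proof. by case/integrableP => /measurable_EFinP. Qed.

End real_integrable.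

Section image_measure.
Context d d' (T : measurableType d) (S : measurableType d') (R : realType).
Context (m : {measure set T -> \bar R}) (mu : {measure set S -> \bar R}) (phi : T -> S).
Hypothesis mphi : measurable_fun setT phi.
Hypothesis muE : forall U, measurable U -> mu U = m (phi @^-1` U).

Lemma ge0_integral_image (g : S -> \bar R) : measurable_fun setT g -> (forall y, 0 <= g y)%E ->
  (\int[mu]_y g y = \int[m]_x g (phi x))%E.
Proof.
move=> mg g0.
transitivity (\int[pushforward m phi]_y g y)%E.
  by apply: eq_measure_integral => U mU _; exact: muE.
by rewrite ge0_integral_pushforward// preimage_setT.
Qed.

Lemma integrable_image (f : S -> R) : mu.-integrable setT (EFin \o f) ->
  m.-integrable setT (EFin \o (f \o phi)) /\
  (\int[mu]_y (f y)%:E = \int[m]_x (f (phi x))%:E)%E.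
Proof.
move=> fi; have mf := integrable_measurable fi.
have fphi : m.-integrable setT (EFin \o (f \o phi)).
  apply/integrableP; split.
    by apply/measurable_EFinP; exact: measurableT_comp.
  case/integrableP : fi => _; rewrite ge0_integral_image//.
  by apply: measurableT_comp => //; exact/measurable_EFinP.
split=> //; transitivity (\int[pushforward m phi]_y (f y)%:E)%E.
  by apply: eq_measure_integral => U mU _; exact: muE.
rewrite (integral_pushforward mphi)// ?preimage_setT//.
exact/measurable_EFinP.
Qed.

End image_measure.

(** * Transition operator and Poisson equation *)

Section geometric_domination.
Context (R : realType) (r : R).
Hypothesis r01 : 0 < r < 1.

Lemma geometric_sum_le n m : \sum_(n <= k < m) r ^+ k <= r ^+ n / (1 - r).
Proof.
have [r0 r1] := andP r01; have r1' : 0 < 1 - r by rewrite subr_gt0.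
have [mn|nm] := leqP m n; first by rewrite big_geq// divr_ge0 ?exprn_ge0// ltW.
suff -> : \sum_(n <= k < m) r ^+ k = (r ^+ n - r ^+ m) / (1 - r).
  by rewrite ler_pM2r ?invr_gt0// gerBl exprn_ge0// ltW.
elim: m nm => // m ih; rewrite ltnS leq_eqVlt => /predU1P[<-|nm].
  by rewrite big_nat1 exprS; field; rewrite subr_eq0 gt_eqF.
rewrite big_nat_recr ?(ltnW nm)//= ih// exprS; field.
by rewrite subr_eq0 gt_eqF.
Qed.

Lemma geometric_dominated_cvg (a : nat -> R) C : (forall k, `|a k| <= C * r ^+ k) ->
  cvgn (series a) /\ forall n, `|limn (series a) - series a n| <= C * (r ^+ n / (1 - r)).
Proof.
move=> aC; have [r0 r1] := andP r01.
have C0 : 0 <= C by have := aC 0%N; rewrite expr0 mulr1; exact: le_trans.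
have ca : cvgn (series a).
  apply: normed_cvg; apply: (@series_le_cvg _ _ (geometric C r)) => //.
  - by move=> n /=.
  - by move=> n; rewrite /geometric/= mulr_ge0 ?exprn_ge0// ltW.
  - by apply: is_cvg_geometric_series; rewrite ger0_norm// ltW.
split=> // n; have cb : (fun m => `|series a m - series a n|) @ \oo --> `|limn (series a) - series a n|.
  by apply: cvg_norm; apply: cvgB => //; exact: cvg_cst.
rewrite -(cvg_lim _ cb)//; apply: limr_le; first by apply/cvg_ex; eexists; exact: cb.
near=> m; have nm : (n <= m)%N by near: m; exact: nbhs_infty_ge.
rewrite /series/= sub_series_geq// (le_trans (ler_norm_sum _ _ _))//.
apply: (@le_trans _ _ (\sum_(n <= k < m) C * r ^+ k)); first by apply: ler_sum => k _.
by rewrite -mulr_sumr ler_wpM2l// geometric_sum_le.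
Unshelve. all: end_near. Qed.

End geometric_domination.

Section transition.
Context (R : realType) (n : nat) (A : 'M[R]_n) (N : 'cV[R]_n -> R) (r c : R).
Hypothesis hN : contracting_norm A N r c.
Context (nu : probability 'cV[R]_n R) (dl : R).
Hypothesis dl0 : 0 < dl.
Hypothesis nuexp : (\int[nu]_z (expR (dl * N z))%:E < +oo)%E.
Implicit Types (x y z : 'cV[R]_n) (f g h u : 'cV[R]_n -> R) (K L : R).
Local Notation lip := (lipN N).

Definition transition_op f x : R := \int[nu]_z f (A *m x + z).
Local Notation T := transition_op.

Definition noise_moment : R := \int[nu]_z N z.
Local Notation n1 := noise_moment.

Lemma noise_moment_ge0 : 0 <= n1.
Proof. by apply: Rintegral_ge0 => z _; exact: cn_ge0 hN z. Qed.

Lemma shift_integrable L f a : 0 <= L -> lip L f ->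
  nu.-integrable setT (EFin \o (fun z => f (a + z))).
Proof.
by move=> L0 Lf; apply: (integrable_lipN hN dl0 nuexp L0); exact: lipN_shift.
Qed.

(** Synchronous coupling: both integrals use the same [z], so the arguments differ by [A (x - y)],
    which [N] contracts by [r]. *)
Lemma transition_lip L f : 0 <= L -> lip L f -> lip (r * L) (T f).
Proof.
move=> L0 Lf x y; rewrite /T -RintegralB//; try exact: (shift_integrable _ L0 Lf).
apply: normr_Rintegral_cst_le.
  by apply: integrable_subf; exact: (shift_integrable _ L0 Lf).
move=> z; rewrite (le_trans (Lf _ _))// opprD addrACA subrr addr0 -mulmxBr.
rewrite (mulrC r) -mulrA ler_wpM2l//; exact: cn_mulmx hN _.
Qed.

Lemma transitionD L L' f g x : 0 <= L -> lip L f -> 0 <= L' -> lip L' g ->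
  T (fun y => f y + g y) x = T f x + T g x.
Proof.
move=> L0 Lf L0' Lg; rewrite /T RintegralD//; first exact: (shift_integrable _ L0 Lf).
exact: (shift_integrable _ L0' Lg).
Qed.

Lemma transitionZ L k f x : 0 <= L -> lip L f -> T (fun y => k * f y) x = k * T f x.
Proof. by move=> L0 Lf; rewrite /T RintegralZl//; exact: (shift_integrable _ L0 Lf). Qed.

Lemma transition_cst k x : T (fun=> k) x = k.
Proof. exact: Rintegral_prob_cst. Qed.

Lemma transition_iter_lip k L f : 0 <= L -> lip L f -> lip (r ^+ k * L) (iter k T f).
Proof.
move=> L0 Lf; elim: k => [|k ih]; first by rewrite expr0 mul1r.
rewrite iterS exprS -mulrA; apply: transition_lip => //.
by rewrite mulr_ge0// exprn_ge0// ltW// (cn_r_gt0 hN).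
Qed.

Lemma transition_iterD k L L' f g : 0 <= L -> lip L f -> 0 <= L' -> lip L' g ->
  iter k T (fun y => f y + g y) = (fun y => iter k T f y + iter k T g y).
Proof.
move=> L0 Lf L0' Lg; elim: k => // k ih; rewrite iterS ih; apply/funext => x.
have rk : 0 <= r ^+ k by rewrite exprn_ge0// ltW// (cn_r_gt0 hN).
apply: (@transitionD (r ^+ k * L) (r ^+ k * L')); rewrite ?mulr_ge0//;
 exact: transition_iter_lip.
Qed.

Lemma transition_iterZ k L a f : 0 <= L -> lip L f ->
  iter k T (fun y => a * f y) = (fun y => a * iter k T f y).
Proof.
move=> L0 Lf; elim: k => // k ih; rewrite iterS ih; apply/funext => x.
have rk : 0 <= r ^+ k by rewrite exprn_ge0// ltW// (cn_r_gt0 hN).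
apply: (@transitionZ (r ^+ k * L)); rewrite ?mulr_ge0//.
exact: transition_iter_lip.
Qed.

(** Two noises are compared from the same point, so [A x] cancels. This is the source of all
    estimates uniform in [x]. *)
Lemma transition_noise_bound L u x z : 0 <= L -> lip L u ->
  `|u (A *m x + z) - T u x| <= L * (N z + n1).
Proof.
move=> L0 Lu; rewrite -[X in `|X - _|](Rintegral_prob_cst nu) /T -RintegralB//; last 2 first.
- exact: integrable_prob_cst.
- exact: (shift_integrable _ L0 Lu).
have iN := integrable_cN hN dl0 nuexp.
have -> : L * (N z + n1) = \int[nu]_z' (L * (N z + N z')).
  rewrite RintegralZl//.
    by rewrite RintegralD// ?Rintegral_prob_cst//; exact: integrable_prob_cst.
  by apply: integrable_addf => //; exact: integrable_prob_cst.
apply: normr_Rintegral_le.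
- by apply: integrable_subf; [exact: integrable_prob_cst|exact: (shift_integrable _ L0 Lu)].
- apply: integrable_scalef; apply: integrable_addf => //; exact: integrable_prob_cst.
move=> z'; rewrite (le_trans (Lu _ _))// opprD addrACA subrr add0r ler_wpM2l//.
exact: cnB hN _ _.
Qed.

Section stationary.
Context (mu : probability 'cV[R]_n R) (kp : R).
Hypothesis kp0 : 0 < kp.
Hypothesis muexp : (\int[mu]_z (expR (kp * N z))%:E < +oo)%E.

Definition ar_map (xz : 'cV[R]_n * 'cV[R]_n) : 'cV[R]_n := A *m xz.1 + xz.2.

Lemma measurable_ar_map : measurable_fun setT ar_map.
Proof.
apply/measurable_mxP => i j.
rewrite (_ : (fun _ => _) = fun xt : 'cV[R]_n * 'cV[R]_n =>
    \sum_(k < n) A i k * xt.1 k j + xt.2 i j); last first.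
  by apply/funext => xt; rewrite /ar_map !mxE.
apply: measurable_funD.
  apply: measurable_sum => k; apply: measurable_funM => //.
  exact: measurableT_comp (measurable_mx_coord k j) measurable_fst.
exact: measurableT_comp (measurable_mx_coord i j) measurable_snd.
Qed.

Hypothesis mu_inv : forall U, measurable U -> mu U = (mu \x nu)%E (ar_map @^-1` U).

(** Change of variables along [ar_map] followed by Fubini. It is stated for integrable [f] because
    it is also applied to the square of a Lipschitz function. *)
Lemma stationary_integral f : mu.-integrable setT (EFin \o f) ->
  (forall x, nu.-integrable setT (EFin \o (fun z => f (A *m x + z)))) ->
  mu.-integrable setT (EFin \o T f) /\ \int[mu]_x f x = \int[mu]_x T f x.
Proof.
move=> fi fxi; have [ifa fE] := integrable_image measurable_ar_map mu_inv fi.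
have FE : fubini_F nu (EFin \o (f \o ar_map)) = EFin \o T f.
  by apply/funext => x; rewrite /fubini_F /T /Rintegral/= fineK//; exact: integrable_fin_num (fxi x).
split; first by rewrite -FE; exact: integrable_fubini_F.
rewrite /Rintegral fE; congr fine.
have := integral12_prod_meas1 ifa; rewrite FE => <-//.
Qed.

Definition stationary_moment : R := \int[mu]_z N z.
Local Notation m1 := stationary_moment.

Lemma stationary_moment_ge0 : 0 <= m1.
Proof. by apply: Rintegral_ge0 => z _; exact: cn_ge0 hN z. Qed.

Lemma stationary_lip L f : 0 <= L -> lip L f -> \int[mu]_x T f x = \int[mu]_x f x.
Proof.
move=> L0 Lf; apply/esym; apply: (@stationary_integral f _ _).2.
- exact: (integrable_lipN hN kp0 muexp L0 Lf).
- by move=> x; exact: (shift_integrable _ L0 Lf).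
Qed.

Lemma stationary_iter k L f : 0 <= L -> lip L f -> \int[mu]_x iter k T f x = \int[mu]_x f x.
Proof.
move=> L0 Lf; elim: k => // k ih; rewrite -[RHS]ih; apply: (@stationary_lip (r ^+ k * L)).
  by rewrite mulr_ge0// exprn_ge0// ltW// (cn_r_gt0 hN).
exact: transition_iter_lip.
Qed.

Lemma lip_near_mean L f x : 0 <= L -> lip L f ->
  `|f x - \int[mu]_y f y| <= L * (N x + m1).
Proof.
move=> L0 Lf; rewrite -[X in `|X - _|](Rintegral_prob_cst mu) -RintegralB//; last 2 first.
- exact: integrable_prob_cst.
- exact: (integrable_lipN hN kp0 muexp L0 Lf).
have iN := integrable_cN hN kp0 muexp.
have -> : L * (N x + m1) = \int[mu]_y (L * (N x + N y)).
  rewrite RintegralZl//.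
    by rewrite RintegralD// ?Rintegral_prob_cst//; exact: integrable_prob_cst.
  by apply: integrable_addf => //; exact: integrable_prob_cst.
apply: normr_Rintegral_le.
- apply: integrable_subf; first exact: integrable_prob_cst.
  exact: (integrable_lipN hN kp0 muexp L0 Lf).
- apply: integrable_scalef; apply: integrable_addf => //; exact: integrable_prob_cst.
move=> y; rewrite (le_trans (Lf _ _))// ler_wpM2l//.
exact: cnB hN _ _.
Qed.

(** Invariance replaces the mean of [f] by that of [T^k f], whose Lipschitz constant is [r^k L]. *)
Lemma transition_iter_ergodic k L f x : 0 <= L -> lip L f ->
  `|iter k T f x - \int[mu]_y f y| <= L * (N x + m1) * r ^+ k.
Proof.
move=> L0 Lf; rewrite -(stationary_iter k L0 Lf) mulrAC -[X in X * _]mulrC.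
apply: lip_near_mean; last exact: transition_iter_lip.
by rewrite mulr_ge0// exprn_ge0// ltW// (cn_r_gt0 hN).
Qed.

(* The solution is [u = \sum_k T^k h], which converges geometrically. *)
Lemma poisson_equation h L : 0 <= L -> lip L h -> \int[mu]_x h x = 0 ->
  exists u, [/\ lip (L / (1 - r)) u, forall x, T u x = u x - h x &
    forall x k, `|u x - \sum_(0 <= i < k) iter i T h x| <= L * (N x + m1) * (r ^+ k / (1 - r))].
Proof.
move=> L0 Lh h0.
have r01 : 0 < r < 1 by rewrite (cn_r_gt0 hN) (cn_r_lt1 hN).
have [r0 r1] := andP r01; have r1' : 0 < 1 - r by rewrite subr_gt0.
have hd x k : `|iter k T h x| <= L * (N x + m1) * r ^+ k.
  by have := transition_iter_ergodic k x L0 Lh; rewrite h0 subr0.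
pose a x k := iter k T h x; pose u x := limn (series (a x)).
have cu x := (geometric_dominated_cvg r01 (hd x)).1.
have du x k := (geometric_dominated_cvg r01 (hd x)).2 k.
pose s k x := series (a x) k.
have Ls k : lip (L / (1 - r)) (s k).
  apply: (@lipN_weak _ _ _ _ _ _ hN (\sum_(0 <= i < k) r ^+ i * L)).
    rewrite -mulr_suml mulrC ler_wpM2l//.
    by rewrite (le_trans (geometric_sum_le r01 0 k))// expr0 mul1r.
  by apply: lipN_sum => i; exact: transition_iter_lip.
have L1 : 0 <= L / (1 - r) by rewrite divr_ge0// ltW.
have Lu : lip (L / (1 - r)) u.
  move=> x y; have cb : (fun k => `|s k x - s k y|) @ \oo --> `|u x - u y|.
    by apply: cvg_norm; apply: cvgB; exact: cu.
  rewrite -(cvg_lim _ cb)//; apply: limr_le; first by apply/cvg_ex; eexists; exact: cb.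
  by apply: nearW => k; exact: Ls.
have Ts k x : T (s k) x = s k.+1 x - h x.
  elim: k x => [|k ih] x.
    rewrite (_ : s 0%N = fun=> 0); last by apply/funext => y; rewrite /s /series/= big_geq.
    by rewrite transition_cst /s /series/= big_nat1 /a/= subrr.
  rewrite (_ : s k.+1 = fun y => s k y + iter k T h y); last first.
    by apply/funext => y; rewrite /s /series/= big_nat_recr.
  rewrite (@transitionD (L / (1 - r)) (r ^+ k * L))//; first last.
  - exact: transition_iter_lip.
  - by rewrite mulr_ge0// exprn_ge0// ltW.
  by rewrite ih /s /series/= [in RHS]big_nat_recr//= addrAC.
exists u; split=> //.
move=> x; pose C := L * (T N x + m1) / (1 - r).
have iN := shift_integrable (A *m x) ler01 (cn_lip hN).
(* Passing to the limit under [T]: the tail of the series at [A x + z] is geometric in [k] with a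
   prefactor of linear growth in [z], which the noise integrates. Together with the telescoping
   identity [Ts] this yields the Poisson equation. *)
have sT : (fun k => T (s k) x) @ \oo --> T u x.
  have Tdist k : `|T u x - T (s k) x| <= C * r ^+ k.
    rewrite /T -RintegralB//; try exact: (shift_integrable _ L1).
    have -> : C * r ^+ k = \int[nu]_z (L * r ^+ k / (1 - r) * (N (A *m x + z) + m1)).
      rewrite RintegralZl//.
        rewrite RintegralD// ?Rintegral_prob_cst//; last exact: integrable_prob_cst.
        by rewrite /C -/(T N x); ring.
      by apply: integrable_addf => //; exact: integrable_prob_cst.
    apply: normr_Rintegral_le.
    - by apply: integrable_subf; exact: (shift_integrable _ L1).
    - by apply: integrable_scalef; apply: integrable_addf => //; exact: integrable_prob_cst.
    - move=> z; rewrite (le_trans (du _ k))// [leLHS](_ : _ = L * r ^+ k / (1 - r) * (N (A *m x + z) + m1))//; ring.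
  apply/cvgrPdist_le => e e0.
  have Cr : (fun k => C * r ^+ k) @ \oo --> (0 : R).
    rewrite -[X in _ --> X](mulr0 C); apply: cvgMr; apply: cvg_expr.
    by rewrite ger0_norm// ltW.
  near=> k; rewrite (le_trans (Tdist k))// (le_trans (ler_norm _))//.
  near: k; move/cvgrPdist_le : Cr => /(_ _ e0); apply: filterS => k.
  by rewrite sub0r normrN.
have sT' : (fun k => T (s k) x) @ \oo --> u x - h x.
  rewrite (_ : (fun k => T (s k) x) = (fun k => s k.+1 x - h x)); last first.
    by apply/funext => k; exact: Ts.
  apply: cvgB; last exact: cvg_cst.
  by have := cu x; rewrite -[cvgn _]/(series (a x) @ \oo --> u x) -(cvg_shiftS (series (a x))).
exact: (cvg_unique _ sT sT').
Unshelve. all: end_near. Qed.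

Section variance.
Context (u : 'cV[R]_n -> R) (L : R).
Hypothesis L0 : 0 <= L.
Hypothesis Lu : lip L u.

Definition innovation x z : R := u (A *m x + z) - T u x.
Definition cond_variance x : R := \int[nu]_z (innovation x z) ^+ 2.

Let L_le x z : `|innovation x z| <= L * (1 + n1) * (1 + N z).
Proof.
rewrite (le_trans (transition_noise_bound _ _ L0 Lu))// -mulrA ler_wpM2l//.
by have := noise_moment_ge0; have := cn_ge0 hN z; nra.
Qed.

Lemma innovation_integrable x : nu.-integrable setT (EFin \o innovation x).
Proof.
by apply: integrable_subf; [exact: (shift_integrable _ L0 Lu)|exact: integrable_prob_cst].
Qed.

Lemma innovation_measurable x : measurable_fun setT (innovation x).
Proof. exact: integrable_measurable (innovation_integrable x). Qed.

Lemma innovation_mean x : \int[nu]_z innovation x z = 0.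
Proof.
rewrite RintegralB ?Rintegral_prob_cst ?subrr//; first exact: (shift_integrable _ L0 Lu).
exact: integrable_prob_cst.
Qed.

Lemma innovation_bound x z : `|innovation x z| <= L * (1 + n1) * (1 + N z).
Proof. exact: L_le. Qed.

Lemma innovation_sqr_integrable x : nu.-integrable setT (EFin \o (fun z => innovation x z ^+ 2)).
Proof.
under eq_fun do rewrite expr2.
apply: (integrable_growthM hN dl0 nuexp (innovation_measurable x) (innovation_measurable x));
  exact: L_le.
Qed.

Lemma cond_variance_ge0 x : 0 <= cond_variance x.
Proof. by apply: Rintegral_ge0 => z _; exact: sqr_ge0. Qed.

Let D z := L * (1 + n1) * (1 + N z).
Let mD : measurable_fun setT D.
Proof.
by apply: measurable_funM => //; apply: measurable_funD => //; exact: cn_measurable hN.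
Qed.
Let D0 z : 0 <= D z.
Proof. by rewrite !mulr_ge0 ?addr_ge0 ?noise_moment_ge0 ?(cn_ge0 hN). Qed.
Let DL z : `|D z| <= L * (1 + n1) * (1 + N z).
Proof. by rewrite ger0_norm. Qed.
Let iDD : nu.-integrable setT (EFin \o (fun z => D z * D z)).
Proof. exact: (integrable_growthM hN dl0 nuexp mD mD DL DL). Qed.
Let iD : nu.-integrable setT (EFin \o D).
Proof. exact: (integrable_growth hN dl0 nuexp mD DL). Qed.

Lemma cond_variance_bounded : exists2 K, 0 <= K & forall x, cond_variance x <= K.
Proof.
exists (\int[nu]_z (D z * D z)).
  by apply: Rintegral_ge0 => z _; rewrite mulr_ge0.
move=> x; apply: le_Rintegral => //; first exact: innovation_sqr_integrable.
by move=> z _; rewrite -real_normK ?num_real// expr2 ler_pM// L_le.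
Qed.

(** In the difference of squares, the difference of the two innovations is at most
    [2 r L N (x - y)], while their sum is dominated by [2 D z] without dependence on [x] and [y].
    The square of a Lipschitz function would not be Lipschitz; centring by [T u] is what makes it
    work. *)
Lemma cond_variance_lip : exists2 K, 0 <= K & lip K cond_variance.
Proof.
exists (4 * r * L * \int[nu]_z D z).
  by rewrite !mulr_ge0 ?(ltW (cn_r_gt0 hN))//; apply: Rintegral_ge0.
move=> x y; rewrite /cond_variance -RintegralB//; try exact: innovation_sqr_integrable.
have -> : 4 * r * L * (\int[nu]_z D z) * N (x - y) = \int[nu]_z (4 * r * L * N (x - y) * D z).
  by rewrite RintegralZl//; ring.
apply: normr_Rintegral_le.
- by apply: integrable_subf; exact: innovation_sqr_integrable.
- exact: integrable_scalef.
move=> z; rewrite subr_sqr normrM.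
have -> : 4 * r * L * N (x - y) * D z = (2 * r * L * N (x - y)) * (D z + D z) by ring.
apply: ler_pM => //; last by rewrite (le_trans (ler_normD _ _))// lerD ?L_le.
have -> : innovation x z - innovation y z = (u (A *m x + z) - u (A *m y + z)) - (T u x - T u y).
  by rewrite /innovation; ring.
rewrite (le_trans (ler_normB _ _))//.
have -> : 2 * r * L * N (x - y) = L * (r * N (x - y)) + r * L * N (x - y) by ring.
apply: lerD; last exact: transition_lip.
rewrite (le_trans (Lu _ _))// opprD addrACA subrr addr0 -mulmxBr ler_wpM2l//.
exact: cn_mulmx hN _.
Qed.

Lemma u_growth x : `|u x| <= (`|u 0| + L) * (1 + N x).
Proof. exact: (lipN_growth hN). Qed.

(** The conditional variance is [T (u^2) - (T u)^2]. By invariance the first term integrates like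
    [u^2], and [T u = u - h] leaves [u^2 - (u - h)^2 = 2 u h - h^2]. *)
Lemma stationary_mean_variance h (Lh : R) : 0 <= Lh -> lip Lh h -> (forall x, T u x = u x - h x) ->
  \int[mu]_x cond_variance x = \int[mu]_x (2 * (u x * h x) - h x * h x).
Proof.
move=> Lh0 hLh Tu.
have mu' := lipN_measurable hN Lu; have mh := lipN_measurable hN hLh.
have hg x : `|h x| <= (`|h 0| + Lh) * (1 + N x) by exact: (lipN_growth hN).
have iuu : mu.-integrable setT (EFin \o (fun x => u x * u x)).
  by apply: (integrable_growthM hN kp0 muexp mu' mu') => x; exact: u_growth.
have iuh : mu.-integrable setT (EFin \o (fun x => u x * h x)).
  exact: (integrable_growthM hN kp0 muexp mu' mh u_growth hg).
have ihh : mu.-integrable setT (EFin \o (fun x => h x * h x)).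
  exact: (integrable_growthM hN kp0 muexp mh mh hg hg).
have iuuA x : nu.-integrable setT (EFin \o (fun z => u (A *m x + z) * u (A *m x + z))).
  have Ls := lipN_shift (A *m x) Lu.
  have gs z := lipN_growth hN z L0 Ls.
  exact: (integrable_growthM hN dl0 nuexp (lipN_measurable hN Ls) (lipN_measurable hN Ls) gs gs).
have [iT ET] := stationary_integral iuu iuuA.
have bE x : cond_variance x = T (fun y => u y * u y) x - T u x * T u x.
  have iu := shift_integrable (A *m x) L0 Lu.
  rewrite /cond_variance /innovation.
  transitivity (\int[nu]_z (u (A *m x + z) * u (A *m x + z) - 2 * T u x * u (A *m x + z) + T u x * T u x)).
    by apply: eq_Rintegral => z _; ring.
  rewrite RintegralD//; last 2 first.
  - by apply: integrable_subf => //; exact: integrable_scalef.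
  - exact: integrable_prob_cst.
  rewrite RintegralB//; last exact: integrable_scalef.
  rewrite RintegralZl// Rintegral_prob_cst -/(T u x) /T; ring.
transitivity (\int[mu]_x (T (fun y => u y * u y) x - (u x * u x - (2 * (u x * h x) - h x * h x)))).
  by apply: eq_Rintegral => x _; rewrite bE Tu; ring.
have i2 : mu.-integrable setT (EFin \o (fun x => 2 * (u x * h x) - h x * h x)).
  by apply: integrable_subf => //; exact: integrable_scalef.
rewrite RintegralB//; last exact: integrable_subf.
rewrite -ET RintegralB//; ring.
Qed.

End variance.

End stationary.
End transition.

(** * Exponential moments of additive functionals *)

Section exp_taylor.
Context (R : realType).

(** The remainder series starts at the cubic term, and [(k + 3)!] is at least [k!]. *)
Lemma expR_taylor2 (y : R) : `|expR y - (1 + y + y ^+ 2 / 2)| <= `|y| ^+ 3 * expR `|y|.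
Proof.
pose e k := exp_coeff y k.
have ce : (fun m => `|series (exp_coeff y) (m + 3)%N - (1 + y + y ^+ 2 / 2)|) @ \oo
    --> `|expR y - (1 + y + y ^+ 2 / 2)|.
  apply: cvg_norm; apply: cvgB; last exact: cvg_cst.
  by rewrite (cvg_shiftn 3 (series (exp_coeff y))); exact: is_cvg_series_exp_coeff.
rewrite -(cvg_lim _ ce)//; apply: limr_le; first by apply/cvg_ex; eexists; exact: ce.
apply: nearW => m.
apply: (@le_trans _ _ (`|y| ^+ 3 * series (exp_coeff `|y|) m)); last first.
  rewrite ler_wpM2l ?exprn_ge0//; apply: nondecreasing_cvgn_le.
    by apply: nondecreasing_series => k _; rewrite /exp_coeff/= divr_ge0 ?exprn_ge0.
  exact: is_cvg_series_exp_coeff.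
have -> : series (exp_coeff y) (m + 3)%N - (1 + y + y ^+ 2 / 2) =
    \sum_(0 <= k < m) exp_coeff y (k + 3)%N.
  rewrite /series/= addnC (big_cat_nat (leq0n 3)) ?leq_addr//= -{2}[3%N]add0n big_addn addKn.
  rewrite !big_nat_recr//= big_geq// /exp_coeff/= expr0 expr1 fact0 !divr1.
  by rewrite (_ : 2`!%:R = 2 :> R)// add0r; set w := 1 + y + _; rewrite addrAC subrr add0r.
rewrite (le_trans (ler_norm_sum _ _ _))// /series/= mulr_sumr.
apply: ler_sum => k _; rewrite /exp_coeff/= normrM normrX normfV.
rewrite (ger0_norm (_ : 0 <= (k + 3)`!%:R :> R))// exprD (mulrC (_ ^+ k)) -mulrA ler_wpM2l ?exprn_ge0//.
rewrite ler_wpM2l ?exprn_ge0// lef_pV2 ?posrE ?ltr0n ?fact_gt0// ler_nat.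
by rewrite addn3 !factS !mulnA leq_pmull// !muln_gt0.
Qed.

(** The exponent is at most [3 e D], whose cube gives 27; the terms of order three and four in the
    square of the exponent give the remaining 4 of the constant 31. The square [a^2 / 2] is grouped
    with [c] because the two are meant to cancel in the mean up to a constant. *)
Lemma exp_expansion (a b c D e : R) : 0 < e <= 1 -> 1 <= D ->
  `|a| <= D -> `|b| <= D -> `|c| <= D ->
  `|expR (e * a + e ^+ 2 * (b + c)) - (1 + e * a + e ^+ 2 * (b + (c + a ^+ 2 / 2)))| <=
    e ^+ 3 * (31 * (D ^+ 3 * expR (3 * e * D))).
Proof.
move=> /andP[e0 e1] D1 aD bD cD; set y := e * a + _.
have D0 : 0 < D by exact: lt_le_trans D1.
have yD : `|y| <= 3 * e * D.
  rewrite /y (le_trans (ler_normD _ _))//.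
  have -> : `|e * a| = e * `|a| by rewrite normrM (gtr0_norm e0).
  have -> : `|e ^+ 2 * (b + c)| = e ^+ 2 * `|b + c| by rewrite normrM (gtr0_norm (exprn_gt0 2 e0)).
  have : `|b + c| <= 2 * D by rewrite (le_trans (ler_normD _ _))//; lra.
  set w := `|b + c|; set v := `|a| in aD *; have w0 : 0 <= w := normr_ge0 _; move=> wD.
  have : e ^+ 2 * w <= e * (2 * D).
    by rewrite expr2 -mulrA ler_pM2l// (le_trans _ wD)// ler_piMl.
  have : e * v <= e * D by rewrite ler_pM2l.
  by lra.
have T := expR_taylor2 y.
have H1 : `|y| ^+ 3 * expR `|y| <= e ^+ 3 * (27 * (D ^+ 3 * expR (3 * e * D))).
  have -> : e ^+ 3 * (27 * (D ^+ 3 * expR (3 * e * D))) = (3 * e * D) ^+ 3 * expR (3 * e * D) by ring.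
  apply: ler_pM; rewrite ?exprn_ge0 ?expR_ge0 ?ler_expR//.
  by rewrite lerXn2r ?nnegrE// (le_trans _ yD).
have -> : expR y - (1 + e * a + e ^+ 2 * (b + (c + a ^+ 2 / 2))) =
    (expR y - (1 + y + y ^+ 2 / 2)) + e ^+ 3 * (a * (b + c) + e * ((b + c) ^+ 2 / 2)).
  by rewrite /y; field.
rewrite (le_trans (ler_normD _ _))//.
have H2 : `|e ^+ 3 * (a * (b + c) + e * ((b + c) ^+ 2 / 2))| <= e ^+ 3 * (4 * (D ^+ 3 * expR (3 * e * D))).
  rewrite normrM normrX (gtr0_norm e0) ler_wpM2l ?exprn_ge0 ?(ltW e0)//.
  have bc : `|b + c| <= 2 * D by rewrite (le_trans (ler_normD _ _))//; lra.
  apply: (@le_trans _ _ (4 * D ^+ 2)).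
    rewrite (le_trans (ler_normD _ _))//.
    have -> : `|e * ((b + c) ^+ 2 / 2)| = e * (`|b + c| ^+ 2 * 2^-1).
      rewrite normrM (gtr0_norm e0) normrM normrX.
      by rewrite (@ger0_norm _ 2^-1) ?invr_ge0.
    rewrite normrM.
    have : `|a| * `|b + c| <= D * (2 * D) by apply: ler_pM.
    have : e * (`|b + c| ^+ 2 * 2^-1) <= 1 * ((2 * D) ^+ 2 * 2^-1).
      apply: ler_pM => //; first by rewrite ltW.
      by rewrite ler_wpM2r ?invr_ge0// lerXn2r ?nnegrE// mulr_ge0// ltW.
    by move=> h1 h2; rewrite (le_trans (lerD h2 h1))//; lra.
  rewrite ler_wpM2l//.
  have E1 : 1 <= expR (3 * e * D).
    by rewrite -expR0 ler_expR !mulr_ge0// ltW.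
  apply: (@le_trans _ _ (D ^+ 3)).
    by rewrite [leRHS]exprS ler_peMl// exprn_ge0// ltW.
  by rewrite ler_peMr// exprn_ge0// ltW.
rewrite (le_trans (lerD (le_trans T H1) H2))//; lra.
Qed.

End exp_taylor.

(** * One-step expansion of the twisted transition *)

Section twisted_transition.
Context (R : realType) (n : nat) (A : 'M[R]_n) (N : 'cV[R]_n -> R) (r c : R).
Hypothesis hN : contracting_norm A N r c.
Context (nu : probability 'cV[R]_n R) (dl : R).
Hypothesis dl0 : 0 < dl.
Hypothesis nuexp : (\int[nu]_z (expR (dl * N z))%:E < +oo)%E.
Context (mu : probability 'cV[R]_n R) (kp : R).
Hypothesis kp0 : 0 < kp.
Hypothesis muexp : (\int[mu]_z (expR (kp * N z))%:E < +oo)%E.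
Hypothesis mu_inv : forall U, measurable U -> mu U = (mu \x nu)%E (ar_map A @^-1` U).
Implicit Types (x y z : 'cV[R]_n) (f g h u : 'cV[R]_n -> R) (K L : R).
Local Notation lip := (lipN N).
Local Notation T := (transition_op A nu).
Local Notation n1 := (noise_moment N nu).
Local Notation m1 := (stationary_moment N mu).

(** As [u] is the sum of all [T^k h], the partial sums of the covariance series equal
    [2 <h, s> - <h, h>] in the inner product of [mu], with [s] a partial sum of that series. The
    geometric tail of [u - s], multiplied by [|h|], is integrable, so [s] may be replaced by [u] in
    the limit. *)
Lemma avar_cvg h u L : 0 <= L -> lip L h -> 0 <= L / (1 - r) -> lip (L / (1 - r)) u ->
  (forall x k, `|u x - \sum_(0 <= i < k) iter i T h x| <= L * (N x + m1) * (r ^+ k / (1 - r))) ->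
  (fun k => \int[mu]_x (h x * h x) + 2 * \sum_(1 <= i < k.+1) \int[mu]_x (h x * iter i T h x)) @ \oo -->
  \int[mu]_x (2 * (u x * h x) - h x * h x).
Proof.
move=> L0 Lh L10 Lu ud.
have [r0 r1] : 0 < r /\ r < 1 by rewrite (cn_r_gt0 hN) (cn_r_lt1 hN).
have r1' : 0 < 1 - r by rewrite subr_gt0.
have mh := lipN_measurable hN Lh.
have hg x := lipN_growth hN x L0 Lh.
have ug x := lipN_growth hN x L10 Lu.
have L1 i : 0 <= r ^+ i * L by rewrite mulr_ge0// exprn_ge0// ltW.
have Li i := transition_iter_lip hN dl0 nuexp i L0 Lh.
have iprod f L' : 0 <= L' -> lip L' f -> mu.-integrable setT (EFin \o (fun x => h x * f x)).
  move=> L'0 Lf; have fg x := lipN_growth hN x L'0 Lf.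
  exact: (integrable_growthM hN kp0 muexp mh (lipN_measurable hN Lf) hg fg).
have ihu := iprod _ _ L10 Lu.
have ihh := iprod _ _ L0 Lh.
pose D x : R := L * (N x + m1) / (1 - r).
have m10 : 0 <= m1 := stationary_moment_ge0 hN mu.
have mD : measurable_fun setT D.
  apply: measurable_funM => //; apply: measurable_funM => //.
  by apply: measurable_funD => //; exact: cn_measurable hN.
have D0 x : 0 <= D x.
  by rewrite /D divr_ge0// ?(ltW r1')// mulr_ge0// addr_ge0// (cn_ge0 hN).
have DL x : `|D x| <= (L * (1 + m1) / (1 - r)) * (1 + N x).
  rewrite (ger0_norm (D0 x)) /D [leRHS]mulrAC ler_wpM2r ?invr_ge0 ?(ltW r1')//.
  by rewrite -mulrA ler_wpM2l//; have := cn_ge0 hN x; nra.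
have ma : measurable_fun setT (fun x => `|h x|) by exact: measurableT_comp.
have hga x : `| (`|h x|) | <= (`|h 0| + L) * (1 + N x) by rewrite normr_id.
have ihD := integrable_growthM hN kp0 muexp ma mD hga DL.
set C := \int[mu]_x (`|h x| * D x) in ihD *.
have sumE k : \int[mu]_x (h x * h x) + 2 * \sum_(1 <= i < k.+1) \int[mu]_x (h x * iter i T h x) =
    2 * (\int[mu]_x (h x * \sum_(0 <= i < k.+1) iter i T h x)) - \int[mu]_x (h x * h x).
  have -> : \int[mu]_x (h x * \sum_(0 <= i < k.+1) iter i T h x) = \sum_(0 <= i < k.+1) \int[mu]_x (h x * iter i T h x).
    elim: k => [|k ih].
      rewrite big_nat1; apply: eq_Rintegral => x _; by rewrite big_nat1.
    rewrite [RHS]big_nat_recr//= -ih -RintegralD//.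
    - by apply: eq_Rintegral => x _; rewrite big_nat_recr//= mulrDr.
    - have Ls := lipN_sum (index_iota 0 k.+1) Li.
      by apply: (iprod _ _ _ Ls); apply: sumr_ge0.
    - exact: iprod (L1 k.+1) (Li k.+1).
  by rewrite [in RHS]big_ltn//=; ring.
have -> : \int[mu]_x (2 * (u x * h x) - h x * h x) = 2 * \int[mu]_x (h x * u x) - \int[mu]_x (h x * h x).
  rewrite -RintegralZl// -RintegralB//; last exact: integrable_scalef.
  by apply: eq_Rintegral => x _; ring.
rewrite (_ : (fun k => _) = (fun k => 2 * (\int[mu]_x (h x * \sum_(0 <= i < k.+1) iter i T h x)) - \int[mu]_x (h x * h x))); last by apply/funext.
apply: cvgB; last exact: cvg_cst.
apply: cvgMr.
have Tdist k : `|\int[mu]_x (h x * u x) - \int[mu]_x (h x * \sum_(0 <= i < k.+1) iter i T h x)| <= C * r ^+ k.+1.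
  have Ls := lipN_sum (index_iota 0 k.+1) Li.
  have is' : mu.-integrable setT (EFin \o (fun x => h x * \sum_(0 <= i < k.+1) iter i T h x)).
    by apply: (iprod _ _ _ Ls); apply: sumr_ge0.
  rewrite -RintegralB// /C mulrC -RintegralZl//.
  apply: normr_Rintegral_le.
  - exact: integrable_subf.
  - exact: integrable_scalef.
  move=> x; rewrite -mulrBr normrM mulrCA ler_wpM2l// (le_trans (ud x k.+1))//.
  by rewrite /D mulrA mulrAC mulrC.
apply/cvgrPdist_le => e e0.
have Cr : (fun k => C * r ^+ k.+1) @ \oo --> (0 : R).
  rewrite -[X in _ --> X](mulr0 C); apply: cvgMr.
  rewrite (cvg_shiftS (fun k => r ^+ k)); apply: cvg_expr.
  by rewrite ger0_norm// ltW.
near=> k; rewrite (le_trans (Tdist k))// (le_trans (ler_norm _))//.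
near: k; move/cvgrPdist_le : Cr => /(_ _ e0); apply: filterS => k.
by rewrite sub0r normrN.
Unshelve. all: end_near. Qed.

(** With [phi = exp (e u + e^2 v)] this is [exp (e h x) phi (A x + z) / phi x], the integrand of a
    Doob transform; its mean over [z] would be the eigenvalue if [phi] were an exact
    eigenfunction. *)
Definition twist h u v (e : R) x z : R :=
  expR (e * h x + (e * u (A *m x + z) + e ^+ 2 * v (A *m x + z)) - (e * u x + e ^+ 2 * v x)).

(* [e u + e^2 v] is an approximate log-eigenfunction of [f |-> exp(e h) T f]:
   [u] solves the Poisson equation for [h], [v] the one for half the centred
   conditional variance of [u], which cancels the second-order fluctuation. *)
Lemma twisted_one_step h L : 0 <= L -> lip L h -> \int[mu]_x h x = 0 ->
  exists u v (L' K e0 s2 : R),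
   [/\ [/\ 0 <= L', lip L' u & lip L' v], 0 < e0 <= 1, 0 <= s2,
     (fun k => \int[mu]_x (h x * h x) + 2 * \sum_(1 <= i < k.+1) \int[mu]_x (h x * iter i T h x)) @ \oo --> s2 &
     forall e x, 0 < e <= e0 ->
       nu.-integrable setT (EFin \o twist h u v e x) /\
       `|\int[nu]_z twist h u v e x z - (1 + e ^+ 2 * (s2 / 2))| <= K * e ^+ 3].
Proof.
move=> L0 Lh h0.
have r1' : 0 < 1 - r by rewrite subr_gt0 (cn_r_lt1 hN).
have [u [Lu Tu ud]] := poisson_equation hN dl0 nuexp kp0 muexp mu_inv L0 Lh h0.
have L10 : 0 <= L / (1 - r) by rewrite divr_ge0// ltW.
set L1 := L / (1 - r) in Lu L10.
pose b := cond_variance A nu u.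
have [Kb Kb0 bK] := cond_variance_bounded hN dl0 nuexp L10 Lu.
have [Lb Lb0 bL] := cond_variance_lip hN dl0 nuexp L10 Lu.
have b0 x : 0 <= b x by exact: cond_variance_ge0.
pose s2 := \int[mu]_x b x.
have ib : mu.-integrable setT (EFin \o b) by exact: (integrable_lipN hN kp0 muexp Lb0 bL).
have s20 : 0 <= s2 by apply: Rintegral_ge0.
have s2K : s2 <= Kb.
  rewrite -(Rintegral_prob_cst mu Kb); apply: le_Rintegral => //.
  exact: integrable_prob_cst.
pose g x := 2^-1 * b x + - (2^-1 * s2).
have Lg : lip (`|2^-1| * Lb + 0) g.
  by apply: lipND; [exact: lipNZ|exact: lipN_cst].
have Lg0 : 0 <= `|2^-1| * Lb + 0 by rewrite addr0 mulr_ge0.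
have g0 : \int[mu]_x g x = 0.
  rewrite RintegralD//; [|exact: integrable_scalef|exact: integrable_prob_cst].
  by rewrite RintegralZl// Rintegral_prob_cst subrr.
have [v [Lv Tv _]] := poisson_equation hN dl0 nuexp kp0 muexp mu_inv Lg0 Lg g0.
have L20 : 0 <= (`|2^-1| * Lb + 0) / (1 - r) by rewrite divr_ge0// ltW.
set L2 := (_ + 0) / _ in Lv L20.
have n10 : 0 <= n1 := noise_moment_ge0 hN nu.
(* One constant dominates both innovation bounds and the conditional variance, so that the single
   majorant [D z] serves for all three arguments of [exp_expansion]. *)
pose C := 1 + L1 * (1 + n1) + L2 * (1 + n1) + Kb.
have C1 : 1 <= C by rewrite /C -!addrA lerDl !addr_ge0// mulr_ge0// addr_ge0.
have C0 : 0 < C by exact: lt_le_trans C1.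
have CL1 : L1 * (1 + n1) <= C.
  by rewrite /C; have := mulr_ge0 L20 (addr_ge0 ler01 n10); lra.
have CL2 : L2 * (1 + n1) <= C.
  by rewrite /C; have := mulr_ge0 L10 (addr_ge0 ler01 n10); lra.
have CKb : Kb <= C.
  by rewrite /C; have := mulr_ge0 L10 (addr_ge0 ler01 n10); have := mulr_ge0 L20 (addr_ge0 ler01 n10); lra.
pose D z := C * (1 + N z).
have N1 z : 1 <= 1 + N z by rewrite lerDl (cn_ge0 hN).
have D1 z : 1 <= D z by rewrite /D -[leLHS]mulr1 ler_pM.
(* The bound [e <= dl / (6 C)] makes the [N z] part of [3 e D z] at most [dl / 2 * N z]; the other
   half of the rate [dl] absorbs the cubic factor, a rate of [dl / 6] for each power. *)
pose e0 := Num.min 1 (dl / (6 * C)).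
have e00 : 0 < e0 by rewrite lt_min ltr01 divr_gt0// mulr_gt0.
pose a1 : R := 1 + (dl / 6)^-1.
pose K1 := C ^+ 3 * a1 ^+ 3 * expR (3 * C).
have Dbound e z : 0 < e <= e0 -> D z ^+ 3 * expR (3 * e * D z) <= K1 * expR (dl * N z).
  move=> /andP[ep ee0].
  have e1 : e <= 1 by rewrite (le_trans ee0)// ge_min lexx.
  have ed : 3 * e * C <= dl / 2.
    have : e <= dl / (6 * C) by rewrite (le_trans ee0)// ge_min lexx orbT.
    by rewrite ler_pdivlMr ?mulr_gt0//; lra.
  have h1 : (1 + N z) ^+ 3 <= a1 ^+ 3 * expR (dl / 2 * N z).
    have -> : expR (dl / 2 * N z) = expR (dl / 6 * N z) ^+ 3.
      by rewrite -expRM_natl; congr expR; field.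
    rewrite -exprMn lerXn2r ?nnegrE ?(le_trans ler01 (N1 z))//.
      by rewrite mulr_ge0 ?expR_ge0// addr_ge0// invr_ge0 divr_ge0// ltW.
    by apply: (one_plus_cn_le_exp hN); rewrite divr_gt0.
  have h2 : expR (3 * e * D z) <= expR (3 * C) * expR (dl / 2 * N z).
    rewrite -expRD ler_expR /D.
    have -> : 3 * e * (C * (1 + N z)) = 3 * e * C + (3 * e * C) * N z by ring.
    apply: lerD; last by rewrite ler_wpM2r// (cn_ge0 hN).
    by rewrite ler_pM2r//; lra.
  have -> : K1 * expR (dl * N z) = C ^+ 3 * (a1 ^+ 3 * expR (dl / 2 * N z)) * (expR (3 * C) * expR (dl / 2 * N z)).
    have -> : dl * N z = dl / 2 * N z + dl / 2 * N z by field.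
    by rewrite expRD /K1; ring.
  rewrite /D exprMn; apply: ler_pM; rewrite ?expR_ge0 ?mulr_ge0 ?exprn_ge0 ?(ltW C0) ?(le_trans ler01 (N1 z))//.
  by rewrite ler_wpM2l// exprn_ge0// ltW.
have iE := integrable_expN hN nuexp.
pose M := \int[nu]_z expR (dl * N z).
pose L' := Num.max L1 L2.
exists u, v, L', (31 * (K1 * M)), e0, s2; split.
- split.
  + by rewrite le_max L10.
  + by apply: (lipN_weak hN _ Lu); rewrite le_max lexx.
  + by apply: (lipN_weak hN _ Lv); rewrite le_max lexx orbT.
- by rewrite e00 ge_min lexx.
- by [].
- rewrite /s2 (stationary_mean_variance hN dl0 nuexp kp0 muexp mu_inv L10 Lu L0 Lh Tu).
  exact: avar_cvg ud.
move=> e x /[dup] ee /andP[ep ee0].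
have e1 : e <= 1 by rewrite (le_trans ee0)// ge_min lexx.
(* Both Poisson equations enter here: they turn the exponent of the twist into innovations of [u]
   and [v] plus [e^2] times the constant [cx]. *)
pose cx := 2^-1 * (s2 - b x).
pose au := innovation A nu u x; pose av := innovation A nu v x.
have tE z : twist h u v e x z = expR (e * au z + e ^+ 2 * (av z + cx)).
  by congr expR; rewrite /au /av /innovation Tu Tv /g /cx; field.
have aD z : `|au z| <= D z.
  by rewrite (le_trans (innovation_bound hN dl0 nuexp L10 Lu x z))// ler_wpM2r// (le_trans ler01 (N1 z)).
have bD z : `|av z| <= D z.
  by rewrite (le_trans (innovation_bound hN dl0 nuexp L20 Lv x z))// ler_wpM2r// (le_trans ler01 (N1 z)).
have cD z : `|cx| <= D z.
  apply: (@le_trans _ _ C); last by rewrite /D ler_peMr// ltW.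
  rewrite (le_trans _ CKb)// /cx normrM ger0_norm ?invr_ge0//.
  have : `|s2 - b x| <= Kb by rewrite ler_distl; have := b0 x; have := bK x; rewrite -/(b x); lra.
  by have := b0 x; lra.
have mau := innovation_measurable hN dl0 nuexp L10 Lu x.
have mav := innovation_measurable hN dl0 nuexp L20 Lv x.
have mt : measurable_fun setT (twist h u v e x).
  rewrite (_ : twist h u v e x = fun z => expR (e * au z + e ^+ 2 * (av z + cx))); last exact/funext.
  apply: measurableT_comp => //; apply: measurable_funD; apply: measurable_funM => //.
  by apply: measurable_funD.
have it : nu.-integrable setT (EFin \o twist h u v e x).
  apply: (integrable_exp_growth hN nuexp mt (K := K1)) => z.
  rewrite tE ger0_norm ?expR_ge0//; apply: (le_trans _ (Dbound e z ee)).
  have D3 : 1 <= D z ^+ 3 by rewrite exprn_ege1.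
  apply: (@le_trans _ _ (1 * expR (3 * e * D z))); last by rewrite ler_wpM2r ?expR_ge0.
  rewrite mul1r ler_expR.
  have h1 : e * au z <= e * D z by rewrite ler_pM2l// (le_trans (ler_norm _)).
  have h2 : e ^+ 2 * (av z + cx) <= e * (2 * D z).
    have w : av z + cx <= 2 * D z by have := ler_norm (av z); have := ler_norm cx; have := bD z; have := cD z; lra.
    apply: (@le_trans _ _ (e ^+ 2 * (2 * D z))); first by rewrite ler_pM2l// exprn_gt0.
    rewrite expr2 -mulrA ler_pM2l// ler_piMl// mulr_ge0//.
    exact: (le_trans ler01 (D1 z)).
  by lra.
split=> //.
(* This is the second-order polynomial of [exp_expansion]. The innovations have mean zero and
   [cx + b x / 2 = s2 / 2], so its mean is free of [x]. *)
pose G z := 1 + e * au z + e ^+ 2 * (av z + (cx + 2^-1 * au z ^+ 2)).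
have iau := innovation_integrable hN dl0 nuexp L10 Lu x.
have iav := innovation_integrable hN dl0 nuexp L20 Lv x.
have iau2 := innovation_sqr_integrable hN dl0 nuexp L10 Lu x.
have i1 : nu.-integrable setT (EFin \o (fun z => 1 + e * au z)).
  by apply: integrable_addf; [exact: integrable_prob_cst|exact: integrable_scalef].
have i2 : nu.-integrable setT (EFin \o (fun z => cx + 2^-1 * au z ^+ 2)).
  by apply: integrable_addf; [exact: integrable_prob_cst|exact: integrable_scalef].
have i3 : nu.-integrable setT (EFin \o (fun z => av z + (cx + 2^-1 * au z ^+ 2))).
  exact: integrable_addf.
have iG : nu.-integrable setT (EFin \o G).
  by apply: integrable_addf => //; exact: integrable_scalef.
have GE : \int[nu]_z G z = 1 + e ^+ 2 * (s2 / 2).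
  rewrite /G RintegralD//; last exact: integrable_scalef.
  rewrite RintegralD//; [|exact: integrable_prob_cst|exact: integrable_scalef].
  have E1 : \int[nu]_z (e * au z) = 0.
    by rewrite RintegralZl// (innovation_mean hN dl0 nuexp L10 Lu) mulr0.
  have E2 : \int[nu]_z (cx + 2^-1 * au z ^+ 2) = cx + 2^-1 * b x.
    by rewrite RintegralD ?Rintegral_prob_cst ?RintegralZl//;
      [exact: integrable_prob_cst|exact: integrable_scalef].
  have E3 : \int[nu]_z (av z + (cx + 2^-1 * au z ^+ 2)) = cx + 2^-1 * b x.
    by rewrite RintegralD// E2 (innovation_mean hN dl0 nuexp L20 Lv) add0r.
  by rewrite E1 RintegralZl// E3 Rintegral_prob_cst /cx; field.
rewrite -GE -RintegralB//.
have -> : 31 * (K1 * M) * e ^+ 3 = \int[nu]_z (e ^+ 3 * (31 * K1) * expR (dl * N z)).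
  by rewrite RintegralZl// /M; ring.
apply: normr_Rintegral_le.
- exact: integrable_subf.
- exact: integrable_scalef.
move=> z; rewrite tE /G (mulrC 2^-1).
have ee1 : 0 < e <= 1 by rewrite ep.
rewrite (le_trans (exp_expansion ee1 (D1 z) (aD z) (bD z) (cD z)))//.
rewrite -(mulrA (e ^+ 3) (31 * K1)) -(mulrA 31 K1).
apply: ler_wpM2l; first by rewrite exprn_ge0// ltW.
by apply: ler_wpM2l => //; exact: Dbound.
Qed.

End twisted_transition.

Section exp_inequalities.
Context (R : realType).
Implicit Types a b t y : R.

Lemma expR_convex a b t : 0 <= t <= 1 ->
  expR (t * a + (1 - t) * b) <= t * expR a + (1 - t) * expR b.
Proof.
move=> /andP[t0 t1]; set m := t * a + (1 - t) * b.
have H z : expR m * (1 + (z - m)) <= expR z.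
  have -> : expR z = expR m * expR (z - m) by rewrite -expRD addrC subrK.
  by rewrite ler_wpM2l ?expR_ge0// expR_ge1Dx.
have -> : expR m = t * (expR m * (1 + (a - m))) + (1 - t) * (expR m * (1 + (b - m))).
  transitivity (expR m * (1 + (t * a + (1 - t) * b - m))); last by ring.
  by rewrite -/m subrr addr0 mulr1.
by rewrite lerD// ler_wpM2l// subr_ge0.
Qed.

(** From [exp (- t) >= 1 - t] at [t = y / (1 + y)] one gets [exp (y / (1 + y)) <= 1 + y], and
    [y / (1 + y) >= y - 2 y^2] in this range. *)
Lemma expR_le_1D y : `|y| <= 2^-1 -> expR (y - 2 * y ^+ 2) <= 1 + y.
Proof.
rewrite ler_norml => /andP[y1 y2]; have y0 : 0 < 1 + y by lra.
have H : expR (- (y / (1 + y))) >= (1 + y)^-1.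
  apply: (le_trans _ (expR_ge1Dx _)); rewrite le_eqVlt; apply/orP; left; apply/eqP.
  by field; rewrite gt_eqF.
have : expR (y / (1 + y)) <= 1 + y.
  by move: H; rewrite expRN lef_pV2 ?posrE ?expR_gt0.
apply: le_trans; rewrite ler_expR ler_pdivlMr//.
have -> : (y - 2 * y ^+ 2) * (1 + y) = y - y ^+ 2 * (1 + 2 * y) by ring.
by rewrite gerBl mulr_ge0 ?sqr_ge0//; lra.
Qed.

End exp_inequalities.

Section scaling.
Context (R : realType) (alpha : R).
Hypothesis alpha_lt1 : alpha < 1.

(** The twist parameter [e] at horizon [m]. Its square times [m] is the speed, and it is also the
    factor by which a tilt of the normalized sum acts on the raw sum. *)
Definition mdp_scale (m : nat) : R := m%:R `^ (alpha - 1).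

Lemma mdp_scale_gt0 m : (0 < m)%N -> 0 < mdp_scale m.
Proof. by move=> m0; rewrite powR_gt0// ltr0n. Qed.

Lemma mdp_scale_sqr m : (0 < m)%N -> m%:R * mdp_scale m ^+ 2 = mdp_speed alpha m.
Proof.
move=> m0; rewrite /mdp_scale /mdp_speed -powR_mulrn ?powR_ge0// -powRrM.
have m0' : m%:R != 0 :> R by rewrite pnatr_eq0 -lt0n.
rewrite -{1}[m%:R](@powRr1 R)// -powRD; last by rewrite m0' implybT.
by congr (_ `^ _); ring.
Qed.

Lemma mdp_scaleE m : (0 < m)%N -> mdp_speed alpha m * (m%:R `^ alpha)^-1 = mdp_scale m.
Proof.
move=> m0; have m0' : m%:R != 0 :> R by rewrite pnatr_eq0 -lt0n.
rewrite -powRN /mdp_speed -powRD; last by rewrite m0' implybT.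
by congr (_ `^ _); ring.
Qed.

Lemma mdp_scale_small e : 0 < e -> \forall m \near \oo, 0 < mdp_scale m <= e.
Proof.
move=> e0; have b0 : 0 < 1 - alpha by rewrite subr_gt0.
near=> m; have m0 : (0 < m)%N by near: m; exists 1%N.
rewrite mdp_scale_gt0//=.
have m0' : 0 < m%:R :> R by rewrite ltr0n.
have mM : e^-1 `^ (1 - alpha)^-1 <= m%:R by near: m; exact: nbhs_infty_ger.
rewrite /mdp_scale (_ : alpha - 1 = - (1 - alpha)); last by ring.
rewrite powRN -[leRHS]invrK lef_pV2 ?posrE ?invr_gt0 ?powR_gt0//.
apply: (@le_trans _ _ ((e^-1 `^ (1 - alpha)^-1) `^ (1 - alpha))).
  by rewrite -powRrM mulVf ?gt_eqF// powRr1// invr_ge0 ltW.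
by rewrite ge0_ler_powR ?nnegrE ?(ltW b0) ?powR_ge0 ?(ltW m0').
Unshelve. all: end_near. Qed.

End scaling.

Lemma integral_prob_cst d (T : measurableType d) (R : realType) (m : probability T R) (a : R) :
  (\int[m]_x a%:E = a%:E)%E.
Proof.
rewrite integral_cst//; transitivity (a%:E * 1)%E; last by rewrite mule1.
by congr (_ * _)%E; exact: probability_setT.
Qed.

(** * Additive functionals and exponential moments along the chain *)

Section chain.
Context (R : realType) (n : nat) (A : 'M[R]_n) (N : 'cV[R]_n -> R) (r c : R).
Hypothesis hN : contracting_norm A N r c.
Context d (Omega : measurableType d) (P : probability Omega R).
Context (Z : nat -> {RV P >-> 'cV[R]_n}).
Hypothesis indep : mutually_independent Z.
Context (nu : probability 'cV[R]_n R).
Hypothesis Znu : forall i U, measurable U -> distribution P (Z i) U = nu U.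
Context (x0 : 'cV[R]_n) (X : nat -> Omega -> 'cV[R]_n).
Hypothesis X0 : forall w, X 0%N w = x0.
Hypothesis XS : forall k w, X k.+1 w = A *m X k w + Z k w.
Implicit Types (x y z : 'cV[R]_n) (f g h u : 'cV[R]_n -> R) (K L : R).
Local Notation lip := (lipN N).

Lemma chain_measurable k : measurable_fun setT (X k).
Proof.
exact: (@driven_measurable _ _ _ _ _ _ _ P Z x0 X (fun=> ar_map A) (fun=> measurable_ar_map A) X0 XS k).
Qed.

Section additive_functional.
Context (h : 'cV[R]_n -> R).
Hypothesis mh : measurable_fun setT h.

Definition partial_sum k w : R := \sum_(i < k) h (X i w).
Local Notation S := partial_sum.

Lemma partial_sum_measurable k : measurable_fun setT (S k).
Proof.
by apply: measurable_sum => i; apply: measurableT_comp mh _; exact: chain_measurable.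
Qed.

(** Adjoining the running sum to the state makes the pair a driven recursion. The increment is [h]
    at the old state, since [partial_sum k] stops at [X (k - 1)]. *)
Definition augmented_map (p : ('cV[R]_n * R) * 'cV[R]_n) := (A *m p.1.1 + p.2, p.1.2 + h p.1.1).

Lemma measurable_augmented_map : measurable_fun setT augmented_map.
Proof.
apply: measurable_fun_pair.
  rewrite (_ : (fun _ => _) = ar_map A \o (fun p : ('cV[R]_n * R) * 'cV[R]_n => (p.1.1, p.2)))//.
  apply: measurableT_comp; first exact: measurable_ar_map.
  by apply: measurable_fun_pair => //; exact: measurableT_comp measurable_fst measurable_fst.
apply: measurable_funD.
  exact: measurableT_comp measurable_snd measurable_fst.
apply: measurableT_comp mh _.
exact: measurableT_comp measurable_fst measurable_fst.
Qed.

Lemma chain_integral k (f : 'cV[R]_n * R -> \bar R) : measurable_fun setT f ->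
  (forall p, 0 <= f p)%E ->
  (\int[P]_w f (X k.+1 w, S k.+1 w) =
   \int[P]_w \int[nu]_z f ((A *m X k w + z)%R, (S k w + h (X k w))%R))%E.
Proof.
move=> mf f0.
pose Y k w := (X k w, S k w).
pose Phi := augmented_map.
have mPhi := measurable_augmented_map.
have Y0 w : Y 0%N w = (x0, 0) by rewrite /Y X0 /partial_sum big_ord0.
have YS i w : Y i.+1 w = Phi (Y i w, Z i w).
  by rewrite /Y XS /partial_sum big_ord_recr.
have := @driven_integral _ _ _ Omega 'cV[R]_n ('cV[R]_n * R)%type R P Z (x0, 0) Y (fun=> Phi) indep (fun=> mPhi) Y0 YS k (f \o Phi).
rewrite (_ : (fun w => (f \o Phi) (Y k w, Z k w)) = fun w => f (Y k.+1 w)); last first.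
  by apply/funext => w; rewrite YS.
have mfP : measurable_fun setT (f \o Phi) by exact: measurableT_comp mf mPhi.
move=> /(_ mfP (fun p => f0 _)) ->.
apply: eq_integral => w _; apply: eq_measure_integral => U mU _.
exact: Znu.
Qed.

(** Given the past, one more step multiplies the integrand by the mean of the twist at the current
    state, which lies in [[lo, hi]] wherever that state is; induction multiplies these factors. *)
Lemma twisted_iteration u v e lo hi : measurable_fun setT u -> measurable_fun setT v ->
  0 <= lo ->
  (forall x, nu.-integrable setT (EFin \o twist A h u v e x)) ->
  (forall x, lo <= \int[nu]_z twist A h u v e x z <= hi) ->
  forall k,
  ((lo ^+ k * expR (e * u x0 + e ^+ 2 * v x0))%:E <=
     \int[P]_w (expR (e * S k w + (e * u (X k w) + e ^+ 2 * v (X k w))))%:E <=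
   (hi ^+ k * expR (e * u x0 + e ^+ 2 * v x0))%:E)%E.
Proof.
move=> mu mv lo0 it ilh.
pose F (p : 'cV[R]_n * R) := (expR (e * p.2 + (e * u p.1 + e ^+ 2 * v p.1)))%:E.
have mF : measurable_fun setT F.
  apply/measurable_EFinP; apply: measurableT_comp => //.
  apply: measurable_funD; first by apply: measurable_funM => //; exact: measurable_snd.
  apply: measurable_funD; apply: measurable_funM => //; apply: measurableT_comp => //; exact: measurable_fst.
have F0 p : (0 <= F p)%E by rewrite lee_fin expR_ge0.
have mFk k : measurable_fun setT (fun w => F (X k w, S k w)).
  apply: measurableT_comp mF _; apply: measurable_fun_pair; first exact: chain_measurable.
  exact: partial_sum_measurable.
have hi0 : 0 <= hi by have /andP[h1 h2] := ilh x0; exact: le_trans (le_trans lo0 h1) h2.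
elim=> [|k /andP[ih1 ih2]].
  rewrite (eq_integral (fun=> (expR (e * u x0 + e ^+ 2 * v x0))%:E)); last first.
    by move=> w _; rewrite /partial_sum big_ord0 X0 mulr0 add0r.
  by rewrite integral_prob_cst !expr0 !mul1r lexx.
rewrite -[X in (_ <= X <= _)%E]/(\int[P]_w F (X k.+1 w, S k.+1 w))%E chain_integral//.
have E w : (\int[nu]_z F ((A *m X k w + z)%R, (S k w + h (X k w))%R) =
    (\int[nu]_z twist A h u v e (X k w) z)%:E * F (X k w, S k w))%E.
  transitivity (\int[nu]_z (F (X k w, S k w) * (twist A h u v e (X k w) z)%:E))%E.
    by apply: eq_integral => z _; rewrite /F /twist -EFinM -expRD/=; congr (expR _)%:E; ring.
  rewrite ge0_integralZl//.
  - by rewrite muleC /Rintegral fineK//; exact: integrable_fin_num (it (X k w)).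
  - by apply/measurable_EFinP; exact: integrable_measurable (it (X k w)).
  - by move=> z _; rewrite lee_fin expR_ge0.
rewrite (eq_integral _ _ (fun w _ => E w)).
have mI : measurable_fun setT (fun w => (\int[nu]_z twist A h u v e (X k w) z)%:E * F (X k w, S k w))%E.
  rewrite (_ : (fun w => _) = fun w => \int[nu]_z F ((A *m X k w + z)%R, (S k w + h (X k w))%R))%E; last first.
    by apply/funext => w; rewrite E.
  have mG : measurable_fun setT (F \o augmented_map).
    exact: measurableT_comp mF measurable_augmented_map.
  exact: (measurableT_comp (measurable_fun_fubini_tonelli_F (m2 := nu) _ mG (fun p => F0 _))
    (measurable_fun_pair (chain_measurable k) (partial_sum_measurable k))).
have Ige w : (0 <= (\int[nu]_z twist A h u v e (X k w) z)%:E * F (X k w, S k w))%E.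
  by rewrite mule_ge0// lee_fin; have /andP[h1 _] := ilh (X k w); exact: le_trans lo0 h1.
apply/andP; split.
  apply: (@le_trans _ _ (lo%:E * \int[P]_w F (X k w, S k w))%E).
    by rewrite exprS -mulrA EFinM; apply: lee_wpmul2l; rewrite ?lee_fin.
  rewrite -ge0_integralZl//; apply: ge0_le_integral => //.
  - by move=> w _; rewrite mule_ge0.
  - by apply: emeasurable_funM.
  - by move=> w _; apply: lee_wpmul2r => //; rewrite lee_fin; case/andP: (ilh (X k w)).
apply: (@le_trans _ _ (hi%:E * \int[P]_w F (X k w, S k w))%E); last first.
  by rewrite exprS -mulrA EFinM; apply: lee_wpmul2l; rewrite ?lee_fin.
rewrite -ge0_integralZl//; apply: ge0_le_integral => //.
- by apply: emeasurable_funM.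
- by move=> w _; apply: lee_wpmul2r => //; rewrite lee_fin; case/andP: (ilh (X k w)).
Qed.

End additive_functional.

(** The rate [dl (1 - r)] is chosen so that the exponent at time [k + 1] is at most the convex
    combination, with weights [r] and [1 - r], of the exponent at time [k] and of [dl N (Z k)].
    Convexity of the exponential then preserves any bound that holds at time 0 and for the noise. *)
Lemma exp_moment_bounded dl : 0 < dl -> (\int[nu]_z (expR (dl * N z))%:E < +oo)%E ->
  exists2 M : R, 0 <= M &
    forall k, (\int[P]_w (expR (dl * (1 - r) * N (X k w)))%:E <= M%:E)%E.
Proof.
move=> dl0 nuexp.
have [r0 r1] : 0 < r /\ r < 1 by rewrite (cn_r_gt0 hN) (cn_r_lt1 hN).
have mE a : measurable_fun setT (fun z => (expR (a * N z))%:E).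
  by apply/measurable_EFinP; exact: measurable_expN hN a.
set M1 := (\int[nu]_z (expR (dl * N z))%:E)%E in nuexp.
have M10 : (0 <= M1)%E by apply: integral_ge0 => z _; rewrite lee_fin expR_ge0.
have M1f : M1 \is a fin_num by rewrite ge0_fin_numE.
have ZM1 k : (\int[P]_w (expR (dl * N (Z k w)))%:E = M1)%E.
  rewrite -[LHS](@ge0_integral_distribution _ _ _ _ _ P (Z k) (fun z => (expR (dl * N z))%:E))//.
  by apply: eq_measure_integral => U mU _; exact: Znu.
pose M := Num.max (fine M1) (expR (dl * (1 - r) * N x0)).
exists M; first by rewrite le_max expR_ge0 orbT.
elim=> [|k ih].
  rewrite (eq_integral (fun=> (expR (dl * (1 - r) * N x0))%:E)); last by move=> w _; rewrite X0.
  by rewrite integral_prob_cst lee_fin le_max lexx orbT.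
have mX a : measurable_fun setT (fun w => (expR (a * N (X k w)))%:E).
  by apply: measurableT_comp (mE a) _; exact: chain_measurable.
have mXS a : measurable_fun setT (fun w => (expR (a * N (X k.+1 w)))%:E).
  by apply: measurableT_comp (mE a) _; exact: chain_measurable.
have mZ a : measurable_fun setT (fun w => (expR (a * N (Z k w)))%:E).
  by apply: measurableT_comp (mE a) _.
have r1' : 0 <= 1 - r by rewrite subr_ge0 ltW.
apply: (@le_trans _ _ (\int[P]_w (r%:E * (expR (dl * (1 - r) * N (X k w)))%:E + (1 - r)%:E * (expR (dl * N (Z k w)))%:E))%E).
  apply: ge0_le_integral => //.
    by apply: emeasurable_funD; apply: emeasurable_funM.
  move=> w _; rewrite -!EFinM -EFinD lee_fin.
  have := @expR_convex _ (dl * (1 - r) * N (X k w)) (dl * N (Z k w)) r.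
  rewrite (ltW r0) (ltW r1) => /(_ isT); apply: le_trans; rewrite ler_expR XS.
  have -> : r * (dl * (1 - r) * N (X k w)) + (1 - r) * (dl * N (Z k w)) =
    dl * (1 - r) * (r * N (X k w) + N (Z k w)) by ring.
  rewrite ler_wpM2l ?mulr_ge0 ?(ltW dl0)// (le_trans (cnD hN _ _))// lerD2r.
  exact: cn_mulmx hN _.
rewrite ge0_integralD//; last 4 first.
- by move=> w _; rewrite mule_ge0 ?lee_fin ?expR_ge0// ltW.
- by apply: emeasurable_funM.
- by move=> w _; rewrite mule_ge0 ?lee_fin ?expR_ge0.
- by apply: emeasurable_funM.
rewrite (ge0_integralZl _ measurableT (mX _)) ?lee_fin ?(ltW r0)//.
rewrite (ge0_integralZl _ measurableT (mZ _)) ?lee_fin//.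
rewrite (ZM1 k).
apply: (@le_trans _ _ (r%:E * M%:E + (1 - r)%:E * M%:E)%E); last first.
  by rewrite -!EFinM -EFinD lee_fin -mulrDl subrKC mul1r.
apply: leeD; apply: lee_wpmul2l => //; rewrite ?lee_fin ?(ltW r0)//.
by rewrite -(fineK M1f) lee_fin le_max lexx.
Qed.

End chain.

(** Turns the one-step factor, known up to a cubic error, into an exponential that can be raised to
    the power [m]. In its use [s2] stands for half the asymptotic variance. *)
Lemma quadratic_exp_bounds (R : realType) (s2 K e : R) : 0 <= s2 -> 0 <= K -> 0 < e ->
  exists2 e1 : R, 0 < e1 & forall s, 0 < s <= e1 ->
  [/\ 0 <= 1 + (s ^+ 2 * s2 - K * s ^+ 3),
      expR (s ^+ 2 * (s2 - e)) <= 1 + (s ^+ 2 * s2 - K * s ^+ 3) &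
      1 + (s ^+ 2 * s2 + K * s ^+ 3) <= expR (s ^+ 2 * (s2 + e))].
Proof.
move=> s20 K0 e0; pose M := s2 + K; pose K' := K + 2 * M ^+ 2 + M + 1.
have M0 : 0 <= M by rewrite addr_ge0.
have MM := sqr_ge0 M.
have K'0 : 0 < K' by rewrite /K'; lra.
have MK : M <= K' by rewrite /K'; lra.
have KM : K + 2 * M ^+ 2 <= K' by rewrite /K'; lra.
have KK : K <= K' by rewrite /K'; lra.
exists (Num.min 1 (Num.min (2^-1 / K') (e / K'))).
  by rewrite !lt_min ltr01 !divr_gt0.
move=> s /andP[s0]; rewrite !le_min => /and3P[s1 smK smeK].
have sK : s * K' <= 2^-1 by rewrite -ler_pdivlMr.
have seK : s * K' <= e by rewrite -ler_pdivlMr.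
have sq0 : 0 < s ^+ 2 by rewrite exprn_gt0.
have s2s : s ^+ 2 <= s by rewrite expr2 ler_piMl// (ltW s0).
set y := s ^+ 2 * s2 - K * s ^+ 3.
have s3 : s ^+ 3 = s * s ^+ 2 by rewrite exprS.
have Ks3 : 0 <= K * s ^+ 3 by rewrite mulr_ge0// exprn_ge0// ltW.
have yM : `|y| <= s ^+ 2 * M.
  rewrite /y (le_trans (ler_normB _ _))// /M mulrDr lerD//.
    by rewrite ger0_norm// mulr_ge0// ltW.
  by rewrite ger0_norm// mulrC ler_wpM2r// s3 ler_piMl// (ltW sq0).
have y2 : `|y| <= 2^-1.
  rewrite (le_trans yM)// (le_trans _ sK)//.
  apply: (@le_trans _ _ (s * M)); first by rewrite ler_wpM2r.
  by rewrite ler_pM2l.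
split.
- by move: y2; rewrite ler_norml => /andP[h _]; lra.
- apply: (le_trans _ (expR_le_1D y2)); rewrite ler_expR.
  have yy : y ^+ 2 <= s * s ^+ 2 * M ^+ 2.
    rewrite -real_normK ?num_real//.
    apply: (@le_trans _ _ ((s ^+ 2 * M) ^+ 2)).
      by rewrite lerXn2r ?nnegrE// mulr_ge0// ltW.
    by rewrite exprMn ler_wpM2r ?sqr_ge0// [leLHS]expr2 ler_wpM2r// ltW.
  have : s * s ^+ 2 * (K + 2 * M ^+ 2) <= s ^+ 2 * e.
    by rewrite mulrAC (mulrC (s ^+ 2)) ler_pM2r// (le_trans _ seK)// ler_pM2l.
  move: (y ^+ 2) yy => Y yy; rewrite /y s3.
  by move: (s ^+ 2) (M ^+ 2) yy => q Q yy; rewrite !mulrDr => H; lra.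
- apply: (le_trans _ (expR_ge1Dx _)); rewrite lerD2l mulrDr lerD2l.
  have -> : K * s ^+ 3 = s ^+ 2 * (s * K) by ring.
  by rewrite ler_pM2l// (le_trans _ seK)// ler_pM2l.
Qed.

(** * Two-sided bounds on the cumulants *)

Section log_mgf.
Context (R : realType) (n : nat) (A : 'M[R]_n) (N : 'cV[R]_n -> R) (r c : R).
Hypothesis hN : contracting_norm A N r c.
Context d (Omega : measurableType d) (P : probability Omega R).
Context (Z : nat -> {RV P >-> 'cV[R]_n}).
Hypothesis indep : mutually_independent Z.
Context (nu : probability 'cV[R]_n R).
Hypothesis Znu : forall i U, measurable U -> distribution P (Z i) U = nu U.
Context (x0 : 'cV[R]_n) (X : nat -> Omega -> 'cV[R]_n).
Hypothesis X0 : forall w, X 0%N w = x0.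
Hypothesis XS : forall k w, X k.+1 w = A *m X k w + Z k w.
Context (dl : R).
Hypothesis dl0 : 0 < dl.
Hypothesis nuexp : (\int[nu]_z (expR (dl * N z))%:E < +oo)%E.
Context (mu : probability 'cV[R]_n R) (kp : R).
Hypothesis kp0 : 0 < kp.
Hypothesis muexp : (\int[mu]_z (expR (kp * N z))%:E < +oo)%E.
Hypothesis mu_inv : forall U, measurable U -> mu U = (mu \x nu)%E (ar_map A @^-1` U).
Context (alpha : R).
Hypothesis alpha_gt : 2^-1 < alpha.
Hypothesis alpha_lt1 : alpha < 1.
Implicit Types (x y z : 'cV[R]_n) (f g h u : 'cV[R]_n -> R) (K L e : R).
Local Notation lip := (lipN N).
Local Notation T := (transition_op A nu).
Local Notation a := (mdp_speed alpha).
Local Notation sc := (mdp_scale alpha).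
Local Notation S := (partial_sum X).

(** The Green-Kubo series. Stated as convergence to a named value, so that the variance from the
    Poisson equation and the one from the covariance matrix are identified by uniqueness of
    limits. *)
Definition has_avar h (s2 : R) :=
  (fun k => \int[mu]_x (h x * h x) + 2 * \sum_(1 <= i < k.+1) \int[mu]_x (h x * iter i T h x)) @ \oo --> s2.

Lemma has_avarZ h L (s2 p : R) : 0 <= L -> lip L h -> has_avar h s2 ->
  has_avar (fun x => p * h x) (p ^+ 2 * s2).
Proof.
move=> L0 Lh hs; rewrite /has_avar.
have mh := lipN_measurable hN Lh.
have hg x := lipN_growth hN x L0 Lh.
have L1 i : 0 <= r ^+ i * L by rewrite mulr_ge0// exprn_ge0// ltW// (cn_r_gt0 hN).
have iprod i : mu.-integrable setT (EFin \o (fun x => h x * iter i T h x)).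
  have Li := transition_iter_lip hN dl0 nuexp i L0 Lh.
  have fg x := lipN_growth hN x (L1 i) Li.
  exact: (integrable_growthM hN kp0 muexp mh (lipN_measurable hN Li) hg fg).
have E i : \int[mu]_x (p * h x * iter i T (fun y => p * h y) x) = p ^+ 2 * \int[mu]_x (h x * iter i T h x).
  rewrite -RintegralZl//; apply: eq_Rintegral => x _.
  by rewrite (transition_iterZ hN dl0 nuexp i p L0 Lh); ring.
rewrite (_ : (fun k => _) = (fun k => p ^+ 2 * (\int[mu]_x (h x * h x) + 2 * \sum_(1 <= i < k.+1) \int[mu]_x (h x * iter i T h x)))).
  by apply: cvgMr.
apply/funext => k; rewrite (E 0%N) mulrDr; congr (_ + _).
rewrite mulrCA; congr (_ * _); rewrite mulr_sumr.
by apply: eq_bigr => i _; exact: E.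
Qed.

Let a_oo := mdp_speed_cvgy alpha_gt.

(** [W m] is the log-eigenfunction [e u + e^2 v] at [e = sc m]. Iterating the one-step bounds [m]
    times uses half of [e]; the other half absorbs the value of [W m] at the starting point. *)
Lemma twisted_mgf h L s2 e : 0 <= L -> lip L h -> \int[mu]_x h x = 0 -> has_avar h s2 -> 0 < e ->
  0 <= s2 /\ exists (W : nat -> 'cV[R]_n -> R) (C : R),
    [/\ 0 <= C, forall m, measurable_fun setT (W m),
      \forall m \near \oo, forall x, `|W m x| <= sc m * (C * (1 + N x)) &
      \forall m \near \oo,
        ((expR (a m * (s2 / 2 - e)))%:E <= \int[P]_w (expR (sc m * S h m w + W m (X m w)))%:E <=
         (expR (a m * (s2 / 2 + e)))%:E)%E].
Proof.
move=> L0 Lh h0 hs e0.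
have [u [v [L' [K [e1 [s2' [[L'0 Lu Lv] /andP[e10 e11] s2'0 hs' step]]]]]]] :=
  twisted_one_step hN dl0 nuexp kp0 muexp mu_inv L0 Lh h0.
have ss : s2' = s2 by exact: (cvg_unique _ hs' hs).
rewrite {}ss in s2'0 hs' step; split=> //.
have mh := lipN_measurable hN Lh.
have mu_ := lipN_measurable hN Lu; have mv := lipN_measurable hN Lv.
pose W m x := sc m * u x + sc m ^+ 2 * v x.
pose C := `|u 0| + L' + (`|v 0| + L').
have C0 : 0 <= C by rewrite !addr_ge0.
have e20 : 0 < e / 2 by rewrite divr_gt0.
have s220 : 0 <= s2 / 2 by rewrite divr_ge0.
have [e2 e20' qb] := quadratic_exp_bounds s220 (normr_ge0 K) e20.
have WC : \forall m \near \oo, forall x, `|W m x| <= sc m * (C * (1 + N x)).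
  near=> m; have /andP[sm0 sm1] : 0 < sc m <= 1 by near: m; exact: mdp_scale_small.
  move=> x; rewrite /W (le_trans (ler_normD _ _))//.
  have -> : `|sc m * u x| = sc m * `|u x| by rewrite normrM gtr0_norm.
  have -> : `|sc m ^+ 2 * v x| = sc m ^+ 2 * `|v x| by rewrite normrM gtr0_norm// exprn_gt0.
  have -> : sc m * (C * (1 + N x)) = sc m * ((`|u 0| + L') * (1 + N x)) + sc m * ((`|v 0| + L') * (1 + N x)).
    by rewrite /C; ring.
  apply: lerD; first by rewrite ler_pM2l//; exact: (lipN_growth hN).
  rewrite expr2 -mulrA ler_pM2l//; apply: (@le_trans _ _ `|v x|).
    by rewrite ler_piMl.
  exact: (lipN_growth hN).
exists W, C; split=> //.
  by move=> m; apply: measurable_funD; apply: measurable_funM.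
near=> m.
have m0 : (0 < m)%N by near: m; exists 1%N.
have /andP[sm0] : 0 < sc m <= Num.min e1 e2.
  by near: m; apply: mdp_scale_small => //; rewrite lt_min e10.
rewrite le_min => /andP[sme1 sme2].
have sm1 : sc m <= 1 by exact: le_trans e11.
have am : a m = m%:R * sc m ^+ 2 by rewrite mdp_scale_sqr.
set s := sc m in sm0 sme1 sme2 sm1 am *.
have [lo0 lo_le hi_le] := qb s (introT andP (conj sm0 sme2)).
set lo := 1 + (_ - _) in lo0 lo_le; set hi := 1 + (_ + _) in hi_le.
have st x := step s x (introT andP (conj sm0 sme1)).
have Hlh x : lo <= \int[nu]_z twist A h u v s x z <= hi.
  have [_] := st x; rewrite ler_distl => /andP[h1 h2].
  have s30 : 0 <= s ^+ 3 by rewrite exprn_ge0// ltW.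
  have Ks : K * s ^+ 3 <= `|K| * s ^+ 3 by rewrite ler_wpM2r// ler_norm.
  apply/andP; split.
    by apply: le_trans h1; rewrite /lo addrA lerB.
  by apply: (le_trans h2); rewrite /hi addrA lerD.
have := twisted_iteration indep Znu X0 XS mh mu_ mv lo0 (fun x => (st x).1) Hlh m.
move=> /andP[H1 H2].
have W0 : `|s * u x0 + s ^+ 2 * v x0| <= C * (1 + N x0).
  have : `|W m x0| <= sc m * (C * (1 + N x0)) by move: (x0); near: m.
  by move=> /le_trans; apply; rewrite -/s ler_piMl// mulr_ge0// addr_ge0// (cn_ge0 hN).
have aC : C * (1 + N x0) <= a m * (e / 2).
  rewrite -ler_pdivrMr ?divr_gt0//; near: m; exact: near_scale_ge a_oo _.
have [W1 W2] : - (a m * (e / 2)) <= s * u x0 + s ^+ 2 * v x0 /\ s * u x0 + s ^+ 2 * v x0 <= a m * (e / 2).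
  by have := le_trans W0 aC; rewrite ler_norml => /andP[].
apply/andP; split.
  apply: le_trans H1; rewrite lee_fin.
  apply: (@le_trans _ _ (expR (s ^+ 2 * (s2 / 2 - e / 2)) ^+ m * expR (s * u x0 + s ^+ 2 * v x0))).
    rewrite -expRM_natl -expRD ler_expR mulrA -am.
    by rewrite (_ : a m * (s2 / 2 - e) = a m * (s2 / 2 - e / 2) - a m * (e / 2)) ?lerD2l//; field.
  by rewrite ler_wpM2r ?expR_ge0// lerXn2r ?nnegrE ?expR_ge0.
apply: (le_trans H2); rewrite lee_fin.
apply: (@le_trans _ _ (expR (s ^+ 2 * (s2 / 2 + e / 2)) ^+ m * expR (s * u x0 + s ^+ 2 * v x0))).
  rewrite ler_wpM2r ?expR_ge0// lerXn2r ?nnegrE ?expR_ge0//.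
  by have /andP[h1 h2] := Hlh x0; exact: le_trans (le_trans lo0 h1) h2.
rewrite -expRM_natl -expRD ler_expR mulrA -am.
by rewrite (_ : a m * (s2 / 2 + e) = a m * (s2 / 2 + e / 2) + a m * (e / 2)) ?lerD2l//; field.
Unshelve. all: end_near. Qed.

Let EXp := exp_moment_bounded hN Znu X0 XS dl0 nuexp.

(** [W m] has slope of order [sc m], which tends to 0, so even a large multiple [t] of it eventually
    falls below [k (1 + N)] with [k] the rate of the uniform exponential moment. *)
Lemma near_terminal_moment (W : nat -> 'cV[R]_n -> R) C t : 0 <= C -> 0 < t ->
  (forall m, measurable_fun setT (W m)) ->
  (\forall m \near \oo, forall x, `|W m x| <= sc m * (C * (1 + N x))) ->
  exists2 M : R, 0 <= M & \forall m \near \oo, (\int[P]_w (expR (t * `|W m (X m w)|))%:E <= M%:E)%E.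
Proof.
move=> C0 t0 mW WC; have [M M0 HM] := EXp.
have [r0 r1] : 0 < r /\ r < 1 by rewrite (cn_r_gt0 hN) (cn_r_lt1 hN).
pose k := dl * (1 - r); have k0 : 0 < k by rewrite mulr_gt0// subr_gt0.
exists (expR k * M); first by rewrite mulr_ge0 ?expR_ge0.
have C1 : 0 < C + 1 by rewrite ltr_wpDl.
near=> m.
have /andP[sm0 sm1] : 0 < sc m <= k / t / (C + 1).
  by near: m; apply: mdp_scale_small => //; rewrite !divr_gt0.
have WCm : forall x, `|W m x| <= sc m * (C * (1 + N x)) by near: m.
have mX := chain_measurable X0 XS m.
apply: (@le_trans _ _ (\int[P]_w ((expR k)%:E * (expR (k * N (X m w)))%:E))%E).
  apply: ge0_le_integral => //.
  - apply/measurable_EFinP; apply: measurableT_comp => //; apply: measurable_funM => //.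
    by apply: measurableT_comp => //; exact: measurableT_comp (mW m) mX.
  - apply: emeasurable_funM => //; apply/measurable_EFinP.
    exact: measurableT_comp (measurable_expN hN k) mX.
  move=> w _; rewrite -EFinM lee_fin -expRD ler_expR.
  apply: (@le_trans _ _ (t * (sc m * (C * (1 + N (X m w)))))); first by rewrite ler_pM2l.
  have -> : k + k * N (X m w) = k * (1 + N (X m w)) by ring.
  rewrite !mulrA ler_wpM2r//; first by rewrite addr_ge0// (cn_ge0 hN).
  have : t * (sc m * (C + 1)) <= k.
    by rewrite mulrC -ler_pdivlMr// -ler_pdivlMr.
  apply: le_trans; rewrite -mulrA ler_pM2l// ler_pM2l// lerDl//.
rewrite ge0_integralZl//; last first.
  by apply/measurable_EFinP; exact: measurableT_comp (measurable_expN hN k) mX.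
by rewrite EFinM; apply: lee_wpmul2l; rewrite ?lee_fin ?expR_ge0//; exact: HM.
Unshelve. all: end_near. Qed.

Lemma measurable_exp_sum h m p (W : 'cV[R]_n -> R) : measurable_fun setT h -> measurable_fun setT W ->
  measurable_fun setT (fun w => (expR (p * S h m w + W (X m w)))%:E).
Proof.
move=> mh mW; apply/measurable_EFinP; apply: measurableT_comp => //.
apply: measurable_funD.
  by apply: measurable_funM => //; exact: (partial_sum_measurable X0 XS mh).
exact: measurableT_comp mW (chain_measurable X0 XS m).
Qed.

Lemma measurable_exp_sum0 h m p : measurable_fun setT h ->
  measurable_fun setT (fun w => (expR (p * S h m w))%:E).
Proof.
move=> mh; apply/measurable_EFinP; apply: measurableT_comp => //.
by apply: measurable_funM => //; exact: (partial_sum_measurable X0 XS mh).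
Qed.

Lemma partial_sumZ h p m w : S (fun x => p * h x) m w = p * S h m w.
Proof. by rewrite /partial_sum mulr_sumr. Qed.

(* The Hoelder exponent that strips the terminal term off a twisted moment. *)
Lemma exponent_near1 (s2 e : R) : 0 <= s2 -> 0 < e ->
  exists p : R, [/\ 1 < p <= 2, p ^+ 2 * s2 / 2 <= s2 / 2 + e &
    s2 / 2 - e <= p^-1 ^+ 2 * s2 / 2].
Proof.
move=> s20 e0; pose t := Num.min 1 (e / (2 * s2 + 1)).
have s21 : 0 < 2 * s2 + 1 by lra.
have t0 : 0 < t by rewrite lt_min ltr01 divr_gt0.
have t1 : t <= 1 by rewrite ge_min lexx.
have te : t * (2 * s2 + 1) <= e.
  by rewrite -ler_pdivlMr// ge_min lexx orbT.
have tts : t * t * s2 <= t * s2 by rewrite ler_wpM2r// ler_piMl// ltW.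
have ts : 0 <= t * s2 by rewrite mulr_ge0// ltW.
have p2s : (1 + t) ^+ 2 * s2 / 2 <= s2 / 2 + e by rewrite expr2; lra.
exists (1 + t); split=> //; first by apply/andP; split; lra.
have p20 : 0 < (1 + t) ^+ 2 by rewrite exprn_gt0//; lra.
have pe : e <= (1 + t) ^+ 2 * e by rewrite ler_peMl ?(ltW e0)// exprn_ege1//; lra.
rewrite exprVn -mulrA [leRHS]mulrC ler_pdivlMr//; move: p2s pe.
by move: ((1 + t) ^+ 2) => q; lra.
Qed.

(** The twisted bound is applied to [p h]. Pointwise, [sc S] is the convex combination with weights
    [1/p] and [1 - 1/p] of [p sc S + W] and [- W / (p - 1)], so convexity of the exponential
    replaces Hoelder; both resulting moments are below the target. *)
Lemma log_mgf_upper h L s2 e : 0 <= L -> lip L h -> \int[mu]_x h x = 0 -> has_avar h s2 -> 0 < e ->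
  \forall m \near \oo, (\int[P]_w (expR (sc m * S h m w))%:E <= (expR (a m * (s2 / 2 + e)))%:E)%E.
Proof.
move=> L0 Lh h0 hs e0.
have e30 : 0 < e / 3 by rewrite divr_gt0.
have [s20 _] := twisted_mgf L0 Lh h0 hs e0.
have [p [/andP[p1 p2] ps _]] := exponent_near1 s20 e30.
have p0 : 0 < p by exact: lt_trans p1.
have pn0 : p != 0 by rewrite gt_eqF.
have pn1 : p - 1 != 0 by rewrite gt_eqF// subr_gt0.
have mh := lipN_measurable hN Lh.
have pL0 : 0 <= `|p| * L by rewrite mulr_ge0.
have pLh : lip (`|p| * L) (fun x => p * h x) by exact: lipNZ.
have ph0 : \int[mu]_x (p * h x) = 0.
  by rewrite RintegralZl ?h0 ?mulr0//; exact: (integrable_lipN hN kp0 muexp L0 Lh).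
have phs : has_avar (fun x => p * h x) (p ^+ 2 * s2) by exact: has_avarZ L0 Lh hs.
have [_ [W [C [C0 mW WC HW]]]] := twisted_mgf pL0 pLh ph0 phs e30.
have q0 : 0 < (p - 1)^-1 by rewrite invr_gt0 subr_gt0.
have [M M0 HM] := near_terminal_moment C0 q0 mW WC.
near=> m.
have am0 : 0 <= a m by near: m; exact: near_scale_ge a_oo _.
have HWm : (\int[P]_w (expR (sc m * S (fun x => p * h x) m w + W m (X m w)))%:E <= (expR (a m * (p ^+ 2 * s2 / 2 + e / 3)))%:E)%E.
  have : ((expR (a m * (p ^+ 2 * s2 / 2 - e / 3)))%:E <= \int[P]_w (expR (sc m * S (fun x => p * h x) m w + W m (X m w)))%:E <= (expR (a m * (p ^+ 2 * s2 / 2 + e / 3)))%:E)%E by near: m.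
  by case/andP.
have HMm : (\int[P]_w (expR ((p - 1)^-1 * `|W m (X m w)|))%:E <= M%:E)%E by near: m.
have M1 : M <= expR (a m * (e / 3)) by near: m; exact: near_mul_exp.
have mX := chain_measurable X0 XS m.
have mph : measurable_fun setT (fun x => p * h x) by exact: measurable_funM.
have mE1 := measurable_exp_sum m (sc m) mph (mW m).
have mE2 : measurable_fun setT (fun w => (expR ((p - 1)^-1 * `|W m (X m w)|))%:E).
  apply/measurable_EFinP; apply: measurableT_comp => //; apply: measurable_funM => //.
  by apply: measurableT_comp => //; exact: measurableT_comp (mW m) mX.
have pV1 : 0 <= p^-1 <= 1 by rewrite invr_ge0 (ltW p0) invf_le1// ltW.
have pV2 : 0 <= 1 - p^-1 by rewrite subr_ge0; case/andP: pV1.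
apply: (@le_trans _ _ (\int[P]_w ((p^-1)%:E * (expR (sc m * S (fun x => p * h x) m w + W m (X m w)))%:E +
     (1 - p^-1)%:E * (expR ((p - 1)^-1 * `|W m (X m w)|))%:E))%E).
  apply: ge0_le_integral => //.
  - exact: measurable_exp_sum0.
  - by apply: emeasurable_funD; apply: emeasurable_funM.
  move=> w _; rewrite -!EFinM -EFinD lee_fin partial_sumZ.
  set s := sc m * (p * S h m w); set v := W m (X m w).
  have := @expR_convex _ (s + v) ((p - 1)^-1 * - v) p^-1 pV1.
  have -> : p^-1 * (s + v) + (1 - p^-1) * ((p - 1)^-1 * - v) = sc m * S h m w.
    by rewrite /s; field; rewrite ?pn0 ?pn1.
  move=> /le_trans; apply; rewrite lerD2l ler_wpM2l// ler_expR ler_pM2l//.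
  by rewrite -normrN ler_norm.
rewrite ge0_integralD//; last 4 first.
- by move=> w _; rewrite mule_ge0 ?lee_fin ?expR_ge0//; case/andP: pV1.
- by apply: emeasurable_funM.
- by move=> w _; rewrite mule_ge0 ?lee_fin ?expR_ge0.
- by apply: emeasurable_funM.
rewrite (ge0_integralZl _ measurableT mE1) ?lee_fin//; last by case/andP: pV1.
rewrite (ge0_integralZl _ measurableT mE2) ?lee_fin//.
set B := expR (a m * (s2 / 2 + e)).
have B1 : expR (a m * (p ^+ 2 * s2 / 2 + e / 3)) <= B.
  by rewrite ler_expR ler_wpM2l//; lra.
have B2 : M <= B.
  rewrite (le_trans M1)// ler_expR ler_wpM2l//; lra.
apply: (@le_trans _ _ ((p^-1)%:E * B%:E + (1 - p^-1)%:E * B%:E)%E).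
  apply: leeD; apply: lee_wpmul2l; rewrite ?lee_fin//; try by case/andP: pV1.
    by rewrite (le_trans HWm)// lee_fin.
  by rewrite (le_trans HMm)// lee_fin.
by rewrite -!EFinM -EFinD lee_fin -mulrDl subrKC mul1r.
Unshelve. all: end_near. Qed.

(** Here the twisted bound is applied to [h / p], and the roles are reversed: [sc S / p + W] is the
    convex combination of [sc S] and [p W / (p - 1)]. The five shares of [e] go to the exponent [p],
    to the twisted bound, twice to the balancing factor, and to a factor 1/2. *)
Lemma log_mgf_lower h L s2 e : 0 <= L -> lip L h -> \int[mu]_x h x = 0 -> has_avar h s2 -> 0 < e ->
  \forall m \near \oo, ((expR (a m * (s2 / 2 - e)))%:E <= \int[P]_w (expR (sc m * S h m w))%:E)%E.
Proof.
move=> L0 Lh h0 hs e0.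
have e50 : 0 < e / 5 by rewrite divr_gt0.
have [s20 _] := twisted_mgf L0 Lh h0 hs e0.
have [p [/andP[p1 p2] _ ps]] := exponent_near1 s20 e50.
have p0 : 0 < p by exact: lt_trans p1.
have pn0 : p != 0 by rewrite gt_eqF.
have pn1 : p - 1 != 0 by rewrite gt_eqF// subr_gt0.
have mh := lipN_measurable hN Lh.
have pL0 : 0 <= `|p^-1| * L by rewrite mulr_ge0.
have pLh : lip (`|p^-1| * L) (fun x => p^-1 * h x) by exact: lipNZ.
have ph0 : \int[mu]_x (p^-1 * h x) = 0.
  by rewrite RintegralZl ?h0 ?mulr0//; exact: (integrable_lipN hN kp0 muexp L0 Lh).
have phs : has_avar (fun x => p^-1 * h x) (p^-1 ^+ 2 * s2) by exact: has_avarZ L0 Lh hs.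
have [_ [W [C [C0 mW WC HW]]]] := twisted_mgf pL0 pLh ph0 phs e50.
have pm1 : 0 < p - 1 by rewrite subr_gt0.
have q0 : 0 < p / (p - 1) by rewrite divr_gt0.
have [M M0 HM] := near_terminal_moment C0 q0 mW WC.
near=> m.
have am0 : 0 <= a m by near: m; exact: near_scale_ge a_oo _.
have HWm : ((expR (a m * (p^-1 ^+ 2 * s2 / 2 - e / 5)))%:E <= \int[P]_w (expR (sc m * S (fun x => p^-1 * h x)%R m w + W m (X m w)))%:E)%E.
  have : ((expR (a m * (p^-1 ^+ 2 * s2 / 2 - e / 5)))%:E <= \int[P]_w (expR (sc m * S (fun x => p^-1 * h x)%R m w + W m (X m w)))%:E <= (expR (a m * (p^-1 ^+ 2 * s2 / 2 + e / 5)))%:E)%E by near: m.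
  by case/andP.
have HMm : (\int[P]_w (expR (p / (p - 1) * `|W m (X m w)|))%:E <= M%:E)%E by near: m.
have M1 : 2 * M <= expR (a m * (e / 5)) by near: m; exact: near_mul_exp.
have M2 : 2 <= expR (a m * (e / 5)) by near: m; exact: near_mul_exp.
have mX := chain_measurable X0 XS m.
have mph : measurable_fun setT (fun x => p^-1 * h x) by exact: measurable_funM.
have mE1 := measurable_exp_sum0 m (sc m) mh.
have mE2 : measurable_fun setT (fun w => (expR (p / (p - 1) * `|W m (X m w)|))%:E).
  apply/measurable_EFinP; apply: measurableT_comp => //; apply: measurable_funM => //.
  by apply: measurableT_comp => //; exact: measurableT_comp (mW m) mX.
(* Convexity yields a sum, not a product, so the terminal moment could swamp the estimate. Adding
   [s] to the first exponent and compensating in the second makes the terminal part at most half of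
   the left-hand side. *)
pose s := a m * (2 * (e / 5)).
have s0 : 0 <= s by rewrite mulr_ge0// mulr_ge0// ltW.
have pV1 : 0 <= p^-1 <= 1 by rewrite invr_ge0 (ltW p0) invf_le1// ltW.
have [pV0 pV1'] := andP pV1.
have pV2 : 0 <= 1 - p^-1 by rewrite subr_ge0.
have H : (\int[P]_w (expR (sc m * S (fun x => p^-1 * h x)%R m w + W m (X m w)))%:E <=
    (expR s)%:E * \int[P]_w (expR (sc m * S h m w))%:E + (expR (- s))%:E * M%:E)%E.
  apply: (@le_trans _ _ (\int[P]_w ((expR s)%:E * (expR (sc m * S h m w))%:E +
     (expR (- s))%:E * (expR (p / (p - 1) * `|W m (X m w)|))%:E))%E); last first.
    rewrite ge0_integralD//; last 2 first.
    - by apply: emeasurable_funM.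
    - by apply: emeasurable_funM.
    rewrite (ge0_integralZl _ measurableT mE1) ?lee_fin ?expR_ge0//.
    rewrite (ge0_integralZl _ measurableT mE2) ?lee_fin ?expR_ge0//.
    by apply: leeD2l; apply: lee_wpmul2l; rewrite ?lee_fin ?expR_ge0.
  apply: ge0_le_integral => //.
  - exact: measurable_exp_sum.
  - by apply: emeasurable_funD; apply: emeasurable_funM.
  move=> w _; rewrite -!EFinM -EFinD lee_fin partial_sumZ -!expRD.
  set g := sc m * S h m w; set v := W m (X m w).
  have := @expR_convex _ (s + g) (p / (p - 1) * v - s / (p - 1)) p^-1 pV1.
  have -> : p^-1 * (s + g) + (1 - p^-1) * (p / (p - 1) * v - s / (p - 1)) = sc m * (p^-1 * S h m w) + v.
    by rewrite /g; field; rewrite ?pn0 ?pn1.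
  move=> /le_trans; apply; apply: lerD; first by rewrite ler_piMl ?expR_ge0.
  apply: (@le_trans _ _ (expR (p / (p - 1) * v - s / (p - 1)))).
    by rewrite ler_piMl ?expR_ge0// gerBl.
  rewrite ler_expR addrC lerD//.
    rewrite lerN2 ler_pdivlMr// ler_piMr//; lra.
  by rewrite ler_pM2l// ler_norm.
have := le_trans HWm H; set J := (\int[P]_w (expR (sc m * S h m w))%:E)%E.
have [->|Jy] := eqVneq J +oo%E; first by rewrite leey.
have J0 : (0 <= J)%E by apply: integral_ge0 => w _; rewrite lee_fin expR_ge0.
have Jf : J \is a fin_num by rewrite ge0_fin_numE// ltey.
rewrite -(fineK Jf) -!EFinM -EFinD !lee_fin; set j := fine J.
set b := p^-1 ^+ 2 * s2 / 2 in ps *.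
have b0 : 0 <= b by rewrite /b mulr_ge0 ?invr_ge0// mulr_ge0// sqr_ge0.
have H3 : expR (- s) * M <= 2^-1 * expR (a m * (b - e / 5)).
  have -> : expR (a m * (b - e / 5)) = expR (- s) * (expR (a m * b) * expR (a m * (e / 5))).
    by rewrite -!expRD; congr expR; rewrite /s; field.
  rewrite mulrCA ler_wpM2l ?expR_ge0//.
  have E1 : 1 <= expR (a m * b) by rewrite -expR0 ler_expR mulr_ge0.
  have E2 : expR (a m * (e / 5)) <= expR (a m * b) * expR (a m * (e / 5)).
    by rewrite ler_peMl ?expR_ge0.
  by lra.
move=> H4.
have H5 : 2^-1 * expR (a m * (b - e / 5)) <= expR s * j by lra.
have H6 : expR s * expR (a m * (s2 / 2 - e)) <= 2^-1 * expR (a m * (b - e / 5)).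
  have -> : expR (a m * (b - e / 5)) = expR (a m * (e / 5)) * expR (a m * (b - 2 * (e / 5))).
    by rewrite -expRD; congr expR; field.
  apply: (@le_trans _ _ (expR (a m * (b - 2 * (e / 5))))).
    by rewrite -expRD ler_expR /s -mulrDr ler_wpM2l//; lra.
  by rewrite [leRHS]mulrA ler_peMl ?expR_ge0// ler_pdivlMl// mulr1.
by have := le_trans H6 H5; rewrite ler_pM2l ?expR_gt0.
Unshelve. all: end_near. Qed.

End log_mgf.

Lemma cvg_mx_entry (R : realType) m n (F : nat -> 'M[R]_(m, n)) (M : 'M[R]_(m, n)) :
  (forall i j, (fun k => F k i j) @ \oo --> M i j) -> F @ \oo --> M.
Proof.
move=> H U /nbhs_ballP[e /= e0 eU].
have Hij : \forall k \near \oo, forall ij : 'I_m * 'I_n, `|M ij.1 ij.2 - F k ij.1 ij.2| < e.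
  apply: filter_forall => -[i j] /=.
  by move/cvgrPdist_lt : (H i j) => /(_ _ e0).
apply: (filterS _ Hij) => k Hk; apply: eU; split=> // i j; rewrite /ball/=.
exact: (Hk (i, j)).
Qed.

(** * The stationary law *)

Section lipschitz_test_functions.
Context (R : realType) (n : nat) (A : 'M[R]_n) (N : 'cV[R]_n -> R) (r c : R).
Hypothesis hN : contracting_norm A N r c.
Implicit Types (x y z : 'cV[R]_n) (f : 'cV[R]_n -> R) (U : set 'cV[R]_n).

Definition setdist U x : R := inf [set N (x - y) | y in ~` U].

Section setdist.
Context (U : set 'cV[R]_n) (y0 : 'cV[R]_n).
Hypothesis Uy0 : ~ U y0.

Let ne x : [set N (x - y) | y in ~` U] !=set0.
Proof. by exists (N (x - y0)); exists y0. Qed.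

Let lb x : lbound [set N (x - y) | y in ~` U] 0.
Proof. by move=> _ [y _ <-]; exact: cn_ge0 hN _. Qed.

Lemma setdist_le x y : ~ U y -> setdist U x <= N (x - y).
Proof. by move=> Uy; apply: ge_inf; [exists 0; exact: lb|exists y]. Qed.

Lemma setdist_ge0 x : 0 <= setdist U x.
Proof. by apply: lb_le_inf; [exact: ne|exact: lb]. Qed.

Lemma setdist_lip : lipN N 1 (setdist U).
Proof.
have H x y : setdist U x - N (x - y) <= setdist U y.
  apply: lb_le_inf; first exact: ne.
  move=> _ [z Uz <-]; rewrite lerBlDr (le_trans (setdist_le x Uz))//.
  by have := cnD hN (y - z) (x - y); rewrite [y - z + _]addrC subrKA.
move=> x y; rewrite mul1r ler_distl; apply/andP; split.
  by have := H y x; rewrite -(cnN hN) opprB; lra.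
by have := H x y; lra.
Qed.

Lemma setdist_gt0 x : open U -> U x -> 0 < setdist U x.
Proof.
move=> oU Ux; have /nbhs_ballP[e /= e0 eU] : nbhs x U by exact: open_nbhs_nbhs.
apply: (lt_le_trans e0); apply: lb_le_inf; first exact: ne.
move=> _ [y Uy <-]; rewrite leNgt; apply/negP => Nxy; apply: Uy; apply: eU.
split=> // i j; rewrite ord1 /ball/=; apply: le_lt_trans Nxy.
apply: le_trans (cn_ge_norm1 hN _).
by have := norm1_coord (x - y) i; rewrite !mxE.
Qed.

Lemma setdist_eq0 x : ~ U x -> setdist U x = 0.
Proof.
move=> Ux; apply/eqP; rewrite eq_le setdist_ge0 andbT.
by have := setdist_le x Ux; rewrite subrr (cn0 hN).
Qed.

(** For open [U] other than the whole space, Lipschitz functions that increase with [k] to the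
    indicator of [U]. *)
Definition bump_fun (k : nat) x : R := Num.min 1 (k%:R * setdist U x).

Lemma bump_fun_lip k : lipN N k%:R (bump_fun k).
Proof.
have H x y : bump_fun k x <= bump_fun k y + k%:R * N (x - y).
  have kd : k%:R * setdist U x <= k%:R * setdist U y + k%:R * N (x - y).
    rewrite -mulrDr ler_wpM2l// -lerBlDl.
    by have := setdist_lip x y; rewrite mul1r; exact: le_trans (ler_norm _).
  rewrite /bump_fun {2}/Num.min; case: ifP => _.
    by rewrite ge_min; rewrite lerDl mulr_ge0// (cn_ge0 hN).
  by rewrite ge_min kd orbT.
move=> x y; rewrite ler_distl; apply/andP; split.
  by have := H y x; rewrite -(cnN hN) opprB; lra.
by have := H x y; lra.
Qed.

Lemma bump_fun_01 k x : 0 <= bump_fun k x <= 1.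
Proof. by rewrite /bump_fun le_min ler01 mulr_ge0 ?setdist_ge0//= ge_min lexx. Qed.

Lemma bump_fun_cvg x : open U -> (fun k => (bump_fun k x)%:E) @ \oo --> (\1_U x)%:E.
Proof.
move=> oU; apply: cvg_near_cst; have [Ux|Ux] := pselect (U x).
  rewrite indicE mem_set//=.
  have d0 := setdist_gt0 oU Ux.
  near=> k; congr (_%:E); apply/min_idPl.
  by rewrite -ler_pdivrMr// mul1r; near: k; exact: nbhs_infty_ger.
rewrite indicE memNset//=; near=> k.
by rewrite /bump_fun setdist_eq0// mulr0 min_r.
Unshelve. all: end_near. Qed.

End setdist.

(** Open sets are stable under intersection and generate the Borel sets, and monotone convergence
    along [bump_fun] reaches them. Invariance and uniqueness thus reduce to test functions that [T]
    contracts. *)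
Lemma eq_measure_lipschitz (m1 : probability 'cV[R]_n R) (m2 : {measure set 'cV[R]_n -> \bar R}) :
  (forall (f : 'cV[R]_n -> R) (L : R), 0 <= L -> lipN N L f -> (forall x, 0 <= f x <= 1) ->
    (\int[m1]_x (f x)%:E = \int[m2]_x (f x)%:E)%E) ->
  forall U, measurable U -> m1 U = m2 U.
Proof.
move=> H.
have m1f : (m1 setT < +oo)%E.
  by apply: le_lt_trans (probability_le1 m1 measurableT) _; rewrite ltry.
have HT : m1 setT = m2 setT.
  have := H (fun=> 1) 0 (lexx 0) (lipN_cst _ _) (fun=> introT andP (conj ler01 (lexx 1))).
  by rewrite !integral_cst// !mul1e.
apply: (measure_unique (@open 'cV[R]_n) (fun=> setT)) => //.
- by move=> U V; exact: openI.
- by move=> _; exact: openT.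
- by rewrite bigcup_const.
(* The whole space is set apart: its complement is empty, so [setdist] would be an infimum over
   nothing. There the constant test function 1 has already given equality. *)
move=> U oU; have [->//|/eqP UT] := eqVneq U setT.
have [y0 Uy0] : exists y0, ~ U y0.
  by apply/existsNP => UU; apply: UT; apply/seteqP; split.
have mU : measurable U by exact: open_measurable_cV.
have lim (m : {measure set 'cV[R]_n -> \bar R}) :
    (fun k => \int[m]_x (bump_fun U k x)%:E)%E @ \oo --> m U.
  rewrite -[X in _ --> m X]setIT -integral_indic//.
  have -> : (\int[m]_x (\1_U x)%:E = \int[m]_x (limn (fun k => (bump_fun U k x)%:E)))%E.
    by apply: eq_integral => x _; apply/esym/cvg_lim => //; exact: bump_fun_cvg Uy0 x oU.
  apply: cvg_monotone_convergence => //.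
  - move=> k; apply/measurable_EFinP; exact: (lipN_measurable hN (bump_fun_lip Uy0 k)).
  - by move=> k x _; rewrite lee_fin; case/andP: (bump_fun_01 Uy0 k x).
  - move=> x _ k l kl; rewrite lee_fin /bump_fun le_min ge_min lexx/= ge_min.
    by rewrite ler_wpM2r ?orbT ?ler_nat ?setdist_ge0//; exact: setdist_ge0 Uy0 x.
have l1 := lim m1.
have l2 : (fun k => \int[m1]_x (bump_fun U k x)%:E)%E @ \oo --> m2 U.
  rewrite (_ : (fun k => _) = (fun k => \int[m2]_x (bump_fun U k x)%:E)%E); first exact: lim.
  apply/funext => k; apply: (H _ k%:R) => //; first exact: bump_fun_lip Uy0 k.
  exact: bump_fun_01 Uy0 k.
exact: (cvg_unique _ l1 l2).
Qed.

End lipschitz_test_functions.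

(** * Construction of the stationary law by backward iteration *)

Section backward_iteration.
Context (R : realType) (n : nat) (A : 'M[R]_n) (N : 'cV[R]_n -> R) (r c : R).
Hypothesis hN : contracting_norm A N r c.
Context d (Omega : measurableType d) (P : probability Omega R).
Context (Z : nat -> {RV P >-> 'cV[R]_n}).
Hypothesis indep : mutually_independent Z.
Context (nu : probability 'cV[R]_n R).
Hypothesis Znu : forall i U, measurable U -> distribution P (Z i) U = nu U.
Context (dl : R).
Hypothesis dl0 : 0 < dl.
Hypothesis nuexp : (\int[nu]_z (expR (dl * N z))%:E < +oo)%E.
Implicit Types (x y z : 'cV[R]_n) (f g h u : 'cV[R]_n -> R) (K L : R).
Local Notation lip := (lipN N).
Local Notation T := (transition_op A nu).

Definition mulA_iter k x : 'cV[R]_n := iter k (mulmx A) x.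

Lemma mulA_iterD k x y : mulA_iter k (x + y) = mulA_iter k x + mulA_iter k y.
Proof. by elim: k => //= k ->; rewrite mulmxDr. Qed.

Lemma mulA_iter_bound k x : N (mulA_iter k x) <= r ^+ k * N x.
Proof.
elim: k => [|k ih]; first by rewrite expr0 mul1r.
rewrite /= (le_trans (cn_mulmx hN _))// exprS -mulrA ler_wpM2l//.
exact: ltW (cn_r_gt0 hN).
Qed.

Lemma measurable_mulA_iter k : measurable_fun setT (mulA_iter k).
Proof.
elim: k => [|k ih]; first exact: measurable_id.
rewrite (_ : mulA_iter k.+1 = ar_map A \o (fun x => (mulA_iter k x, 0))); last first.
  by apply/funext => x; rewrite /ar_map /= addr0.
by apply: measurableT_comp; [exact: measurable_ar_map|exact: measurable_fun_pair].
Qed.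

Definition backward_sum m w : 'cV[R]_n := \sum_(k < m) mulA_iter k (Z k w).
Local Notation B := backward_sum.

Let Phi m (p : 'cV[R]_n * 'cV[R]_n) : 'cV[R]_n := p.1 + mulA_iter m p.2.

Lemma measurable_addmx : measurable_fun setT (fun p : 'cV[R]_n * 'cV[R]_n => p.1 + p.2).
Proof.
apply/measurable_mxP => i j; under eq_fun do rewrite mxE.
apply: measurable_funD.
  exact: measurableT_comp (measurable_mx_coord i j) measurable_fst.
exact: measurableT_comp (measurable_mx_coord i j) measurable_snd.
Qed.

Let mPhi m : measurable_fun setT (Phi m).
Proof.
rewrite (_ : Phi m = (fun p => p.1 + p.2) \o (fun p => (p.1, mulA_iter m p.2)))//.
apply: measurableT_comp; first exact: measurable_addmx.
apply: measurable_fun_pair => //.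
exact: (measurableT_comp (measurable_mulA_iter m) measurable_snd).
Qed.

Let B0 w : B 0%N w = 0. Proof. by rewrite /backward_sum big_ord0. Qed.
Let BS m w : B m.+1 w = Phi m (B m w, Z m w).
Proof. by rewrite /backward_sum big_ord_recr. Qed.

Lemma backward_sum_measurable m : measurable_fun setT (B m).
Proof. exact: (driven_measurable mPhi B0 BS). Qed.

Lemma transition_01 f L : 0 <= L -> lip L f -> (forall x, 0 <= f x <= 1) ->
  forall x, 0 <= T f x <= 1.
Proof.
move=> L0 Lf f01 x; apply/andP; split.
  by apply: Rintegral_ge0 => z _; case/andP: (f01 (A *m x + z)).
rewrite -(Rintegral_prob_cst nu 1); apply: le_Rintegral => //.
- exact: (shift_integrable hN dl0 nuexp _ L0 Lf).
- exact: integrable_prob_cst.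
- by move=> z _; case/andP: (f01 (A *m x + z)).
Qed.

Lemma transition_iter_01 f L k : 0 <= L -> lip L f -> (forall x, 0 <= f x <= 1) ->
  forall x, 0 <= iter k T f x <= 1.
Proof.
move=> L0 Lf f01; elim: k => // k ih; rewrite iterS; apply: (@transition_01 _ (r ^+ k * L)) => //.
  by rewrite mulr_ge0// exprn_ge0// ltW// (cn_r_gt0 hN).
exact: (transition_iter_lip hN dl0 nuexp k L0 Lf).
Qed.

Lemma transition_EFin f L x : 0 <= L -> lip L f ->
  (\int[nu]_z (f (A *m x + z)%R)%:E = (T f x)%:E)%E.
Proof.
move=> L0 Lf; rewrite /T /Rintegral fineK//.
exact: integrable_fin_num (shift_integrable hN dl0 nuexp (A *m x) L0 Lf).
Qed.

Lemma shift_measurable f L (a : 'cV[R]_n) : lip L f ->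
  measurable_fun setT (fun w : 'cV[R]_n => (f (a + w))%:E).
Proof.
by move=> Lf; apply/measurable_EFinP; exact: (lipN_measurable hN (lipN_shift a Lf)).
Qed.

(** Relative to the forward chain the noises enter in reverse order, so the newest one, [Z m], acts
    as the first step: [A^(m+1) x + A^m z = A^m (A x + z)]. *)
Lemma backward_integral f L m x : 0 <= L -> lip L f -> (forall x, 0 <= f x <= 1) ->
  (\int[P]_w (f (mulA_iter m x + B m w)%R)%:E = (iter m T f x)%:E)%E.
Proof.
move=> L0 Lf f01; have f0 y : 0 <= f y by case/andP: (f01 y).
elim: m x => [|m ih] x.
  transitivity (\int[P]_w (f x)%:E)%E; last exact: integral_prob_cst.
  by apply: eq_integral => w _; rewrite B0 addr0.
pose F (p : 'cV[R]_n * 'cV[R]_n) := (f (mulA_iter m.+1 x + Phi m p))%:E.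
have mF : measurable_fun setT F.
  exact: measurableT_comp (shift_measurable (mulA_iter m.+1 x) Lf) (mPhi m).
have F0 p : (0 <= F p)%E by rewrite lee_fin.
transitivity (\int[P]_w F (B m w, Z m w))%E.
  by apply: eq_integral => w _; rewrite /F BS.
rewrite (driven_integral indep mPhi B0 BS)//.
transitivity (\int[P]_w \int[nu]_z F (B m w, z))%E.
  by apply: eq_integral => w _; apply: eq_measure_integral => U mU _; exact: Znu.
pose BR : {RV P >-> 'cV[R]_n} := mfun_of (backward_sum_measurable m).
transitivity (\int[distribution P BR]_y \int[nu]_z F (y, z))%E.
  rewrite ge0_integral_distribution//.
  - exact: measurable_fun_fubini_tonelli_F.
  - by move=> y; apply: integral_ge0.
(* The integrals are exchanged so that, for frozen [z], the induction hypothesis applies at the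
   point [A x + z]. *)
rewrite fubini_tonelli//.
transitivity (\int[nu]_z (iter m T f (A *m x + z)%R)%:E)%E.
  apply: eq_integral => z _; rewrite -ih ge0_integral_distribution//; last first.
    exact: measurableT_comp mF (measurable_pair2 z).
  apply: eq_integral => w _; rewrite /= /F /Phi/= mulA_iterD.
  by congr (f _)%:E; rewrite /mulA_iter -iterSr iterS addrAC addrA.
apply: (@transition_EFin _ (r ^+ m * L)).
  by rewrite mulr_ge0// exprn_ge0// ltW// (cn_r_gt0 hN).
exact: (transition_iter_lip hN dl0 nuexp m L0 Lf).
Qed.

(** One integrable variable with two uses: where it is finite the backward sums converge, and it
    dominates their exponential moments for all [m] at once. *)
Definition exp_series w : \bar R := (\sum_(k <oo) (r ^+ k * expR (dl * N (Z k w)))%:E)%E.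
Local Notation G := exp_series.

Let r0 : 0 < r. Proof. exact: cn_r_gt0 hN. Qed.
Let r1 : r < 1. Proof. exact: cn_r_lt1 hN. Qed.
Let term_ge0 k w : (0 <= (r ^+ k * expR (dl * N (Z k w)))%:E)%E.
Proof. by rewrite lee_fin mulr_ge0 ?expR_ge0// exprn_ge0// ltW. Qed.
Let mterm k : measurable_fun setT (fun w => (r ^+ k * expR (dl * N (Z k w)))%:E).
Proof.
apply/measurable_EFinP; apply: measurable_funM => //.
exact: measurableT_comp (measurable_expN hN dl) _.
Qed.

Lemma exp_series_measurable : measurable_fun setT G.
Proof. exact: ge0_emeasurable_sum. Qed.

Lemma exp_series_ge0 w : (0 <= G w)%E.
Proof. exact: nneseries_ge0. Qed.

Lemma exp_series_integrable : P.-integrable setT G.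
Proof.
apply/integrableP; split; first exact: exp_series_measurable.
under eq_integral do rewrite gee0_abs ?exp_series_ge0//.
rewrite integral_nneseries//.
have nuexp' := nuexp; set M := (\int[nu]_z (expR (dl * N z))%:E)%E in nuexp'.
have M0 : (0 <= M)%E by apply: integral_ge0 => z _; rewrite lee_fin expR_ge0.
have Mf : M \is a fin_num by rewrite ge0_fin_numE.
have mE : measurable_fun setT (fun z => (expR (dl * N z))%:E).
  by apply/measurable_EFinP; exact: measurable_expN hN dl.
have E k : (\int[P]_w (r ^+ k * expR (dl * N (Z k w)))%:E = (fine M * r ^+ k)%:E)%E.
  under eq_integral do rewrite EFinM.
  rewrite ge0_integralZl//; last 2 first.
  - exact: (measurableT_comp mE).
  - by rewrite lee_fin exprn_ge0// ltW.
  rewrite mulrC EFinM fineK//; congr (_ * _)%E.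
  rewrite -[LHS](@ge0_integral_distribution _ _ _ _ _ P (Z k) (fun z => (expR (dl * N z))%:E))//.
  by apply: eq_measure_integral => U mU _; exact: Znu.
apply: (@le_lt_trans _ _ (fine M / (1 - r))%:E); last exact: ltry.
apply: lime_le.
  by apply: is_cvg_nneseries => k _ _; rewrite E lee_fin mulr_ge0 ?fine_ge0// exprn_ge0// ltW.
apply: nearW => k; rewrite (eq_bigr (fun k => (fine M * r ^+ k)%:E)); last by move=> i _; exact: E.
rewrite sumEFin lee_fin -mulr_sumr ler_wpM2l ?fine_ge0//.
by rewrite (le_trans (geometric_sum_le _ 0 k)) ?r0// expr0 mul1r.
Qed.

(* Jensen's inequality for the weights [(1 - r) * r ^+ k] and [r ^+ m]. *)
Lemma exp_weighted_sum (y : nat -> R) m :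
  expR (dl * (1 - r) * \sum_(k < m) r ^+ k * y k) <=
  (1 - r) * \sum_(k < m) r ^+ k * expR (dl * y k) + r ^+ m.
Proof.
elim: m y => [|m ih] y; first by rewrite !big_ord0 !mulr0 expR0 add0r expr0.
rewrite !big_ord_recl !expr0 !mul1r.
have -> : dl * (1 - r) * (y 0%N + \sum_(i < m) r ^+ bump 0 i * y (bump 0 i)) =
    (1 - r) * (dl * y 0%N) + (1 - (1 - r)) * (dl * (1 - r) * \sum_(k < m) r ^+ k * y k.+1).
  rewrite subKr (eq_bigr (fun i : 'I_m => r * (r ^+ i * y i.+1))).
    by rewrite -mulr_sumr; ring.
  by move=> i _; rewrite /bump/= add1n exprS mulrA.
have r01 : 0 <= 1 - r <= 1 by rewrite subr_ge0 (ltW r1) gerBl (ltW r0).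
apply: (le_trans (expR_convex _ _ r01)); rewrite subKr.
apply: (le_trans (lerD (lexx _) (ler_wpM2l (ltW r0) (ih (fun k => y k.+1))))).
rewrite le_eqVlt; apply/orP; left; apply/eqP.
rewrite [in RHS](eq_bigr (fun i : 'I_m => r * (r ^+ i * expR (dl * y i.+1)))).
  by rewrite -mulr_sumr exprS; ring.
by move=> i _; rewrite lift0 exprS mulrA.
Qed.

Lemma backward_sum_bound m w : N (B m w) <= \sum_(k < m) r ^+ k * N (Z k w).
Proof.
elim: m => [|m ih]; first by rewrite B0 (cn0 hN) big_ord0.
rewrite BS big_ord_recr/= (le_trans (cnD hN _ _))// lerD//.
exact: mulA_iter_bound.
Qed.

Let kp := dl * (1 - r).
Let kp0 : 0 < kp. Proof. by rewrite mulr_gt0// subr_gt0. Qed.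

Lemma exp_backward_sum m w : ((expR (kp * N (B m w)))%:E <= (1 - r)%:E * G w + 1)%E.
Proof.
apply: (@le_trans _ _ ((1 - r) * \sum_(k < m) r ^+ k * expR (dl * N (Z k w)) + r ^+ m)%:E).
  rewrite lee_fin; apply: le_trans (exp_weighted_sum (fun k => N (Z k w)) m).
  by rewrite ler_expR ler_pM2l//; exact: backward_sum_bound.
rewrite EFinD EFinM; apply: leeD; last by rewrite lee_fin exprn_ile1// ltW.
apply: lee_wpmul2l; first by rewrite lee_fin subr_ge0 ltW.
rewrite -sumEFin -(big_mkord xpredT (fun k => (r ^+ k * expR (dl * N (Z k w)))%:E)).
exact: nneseries_lim_ge.
Qed.

(* The upper limit gives a measurable function defined everywhere; it is the
   limit of the backward iteration where [exp_series] is finite. *)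
Definition backward_limit w : 'cV[R]_n :=
  \col_i fine (limn_esup (fun m => (B m w i 0)%:E)).
Local Notation Boo := backward_limit.

Lemma backward_limit_measurable : measurable_fun setT Boo.
Proof.
apply/measurable_mxP => i j.
rewrite (_ : (fun _ => _) = fine \o (fun w => limn_esup (fun m => (B m w i 0)%:E))); last first.
  by apply/funext => w; rewrite /backward_limit mxE.
apply: measurableT_comp; first exact: fine_measurable.
apply: measurable_fun_limn_esup => m; apply/measurable_EFinP.
exact: measurableT_comp (measurable_mx_coord i 0) (backward_sum_measurable m).
Qed.

(** Each entry converges absolutely: its [k]-th term is at most [r^k N (Z k)], and
    [dl t <= exp (dl t)] compares this with the series [exp_series]. *)
Lemma backward_sum_cvg w : (G w < +oo)%E -> (fun m => B m w) @ \oo --> Boo w.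
Proof.
move=> Gw; apply: cvg_mx_entry => i j; rewrite ord1.
have cB : cvgn (fun m => B m w i 0).
  rewrite (_ : (fun m => _) = series (fun k => mulA_iter k (Z k w) i 0)); last first.
    by apply/funext => m; rewrite /backward_sum summxE /series/= big_mkord.
  apply: normed_cvg; apply: nondecreasing_is_cvgn.
    by apply: nondecreasing_series => k _ _; exact: normr_ge0.
  exists (dl^-1 * fine (G w)) => _ [m _ <-].
  have Gf : G w \is a fin_num by rewrite ge0_fin_numE// exp_series_ge0.
  have H : \sum_(0 <= k < m) r ^+ k * expR (dl * N (Z k w)) <= fine (G w).
    by rewrite -lee_fin fineK// -sumEFin; exact: nneseries_lim_ge.
  apply: (@le_trans _ _ (dl^-1 * \sum_(0 <= k < m) r ^+ k * expR (dl * N (Z k w)))); last first.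
    by rewrite ler_wpM2l// invr_ge0 ltW.
  rewrite /series/= mulr_sumr; apply: ler_sum => k _.
  apply: (@le_trans _ _ (r ^+ k * N (Z k w))).
    rewrite (le_trans _ (mulA_iter_bound k _))// (le_trans _ (cn_ge_norm1 hN _))//.
    exact: norm1_coord.
  rewrite mulrCA ler_wpM2l ?exprn_ge0 ?(ltW r0)// ler_pdivlMl//.
  by apply: le_trans (expR_ge1Dx _); rewrite lerDr.
have cE : (fun m => (B m w i 0)%:E) @ \oo --> (limn (fun m => B m w i 0))%:E.
  by apply: cvg_EFin => //; exact: nearW.
have -> : Boo w i 0 = limn (fun m => B m w i 0).
  rewrite /backward_limit mxE is_cvg_limn_esupE; last by apply/cvg_ex; eexists; exact: cE.
  by rewrite (cvg_lim _ cE).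
exact: cB.
Qed.

Lemma exp_backward_limit w : ((expR (kp * N (Boo w)))%:E <= (1 - r)%:E * G w + 1)%E.
Proof.
have r1' : 0 < 1 - r by rewrite subr_gt0.
(* Where the series diverges [backward_limit] need not be a limit, but there the bound is
   trivial. *)
have [->|Gy] := eqVneq (G w) +oo%E; first by rewrite gt0_muley ?lte_fin// leey.
have Gw : (G w < +oo)%E by rewrite ltey.
have c1 : (fun m => (expR (kp * N (B m w)))%:E) @ \oo --> (expR (kp * N (Boo w)))%:E.
  apply: cvg_EFin; first exact: nearW.
  apply: continuous_cvg; first exact: continuous_expR.
  apply: cvgMr; apply: continuous_cvg; last exact: backward_sum_cvg.
  exact: (lipN_continuous hN (cn_lip hN)).
rewrite -(cvg_lim _ c1)//; apply: lime_le; first by apply/cvg_ex; eexists; exact: c1.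
by apply: nearW => m; exact: exp_backward_sum.
Qed.

Definition stationary_law : probability 'cV[R]_n R :=
  distribution P (mfun_of backward_limit_measurable).
Local Notation mu := stationary_law.

Lemma stationary_law_exp : (\int[mu]_z (expR (kp * N z))%:E < +oo)%E.
Proof.
have mE : measurable_fun setT (fun z => (expR (kp * N z))%:E).
  by apply/measurable_EFinP; exact: measurable_expN hN kp.
rewrite ge0_integral_distribution//.
apply: (@le_lt_trans _ _ (\int[P]_w ((1 - r)%:E * G w + 1))%E).
  apply: ge0_le_integral => //.
  - by move=> w _; rewrite lee_fin expR_ge0.
  - exact: (measurableT_comp mE backward_limit_measurable).
  - apply: emeasurable_funD => //; apply: emeasurable_funM => //; exact: exp_series_measurable.
  - by move=> w _; exact: exp_backward_limit.
have i1 : P.-integrable setT (fun w => (1 - r)%:E * G w + 1)%E.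
  apply: integrableD => //; first exact: integrableZl exp_series_integrable.
  exact: (integrable_prob_cst P 1).
have := integrable_fin_num measurableT i1; by rewrite fin_numE => /andP[_]; rewrite -ltey.
Qed.

(** The backward sum at time [m] integrates [f] to [T^m f] at 0; almost sure convergence and the
    bound 1 on [f] give the limit by dominated convergence. *)
Lemma stationary_law_limit f L : 0 <= L -> lip L f -> (forall x, 0 <= f x <= 1) ->
  (fun m => (iter m T f 0)%:E) @ \oo --> (\int[mu]_x (f x)%:E)%E.
Proof.
move=> L0 Lf f01.
have mf : measurable_fun setT (fun x => (f x)%:E).
  by apply/measurable_EFinP; exact: (lipN_measurable hN Lf).
have f0 x : (0 <= (f x)%:E)%E by rewrite lee_fin; case/andP: (f01 x).
rewrite ge0_integral_distribution//=.
rewrite (_ : (fun m => _) = (fun m => \int[P]_w (f (B m w))%:E)%E); last first.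
  apply/funext => m; rewrite -(backward_integral m 0 L0 Lf f01).
  apply: eq_integral => w _; suff -> : mulA_iter m (0 : 'cV[R]_n) = 0 by rewrite add0r.
  by elim: m => //= m ->; rewrite mulmx0.
have ae1 : {ae P, forall w, setT w -> (fun m => (f (B m w))%:E) @ \oo --> (f (Boo w))%:E}.
  have := integrable_ae measurableT exp_series_integrable.
  apply: filterS => w /(_ Logic.I); rewrite ge0_fin_numE ?exp_series_ge0// => Gw _.
  apply: cvg_EFin; first exact: nearW.
  apply: continuous_cvg; last exact: backward_sum_cvg.
  exact: (lipN_continuous hN Lf).
have ae2 : {ae P, forall w (m : nat), setT w -> (`|(f (B m w))%:E| <= 1)%E}.
  apply: aeW => w m _; rewrite gee0_abs ?lee_fin//; by case/andP: (f01 (B m w)).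
have [_ _] := dominated_convergence measurableT
  (fun m => measurableT_comp mf (backward_sum_measurable m))
  (measurableT_comp mf backward_limit_measurable) ae1 (integrable_prob_cst P 1) ae2.
exact.
Qed.

Lemma product_transition (m : probability 'cV[R]_n R) f L : 0 <= L -> lip L f -> (forall x, 0 <= f x <= 1) ->
  (\int[m \x nu]_p (f (ar_map A p))%:E = \int[m]_x (T f x)%:E)%E.
Proof.
move=> L0 Lf f01.
have mf : measurable_fun setT (fun x => (f x)%:E).
  by apply/measurable_EFinP; exact: (lipN_measurable hN Lf).
rewrite fubini_tonelli1//.
- by apply: eq_integral => x _; exact: (transition_EFin x L0 Lf).
- exact: measurableT_comp mf (measurable_ar_map A).
- by move=> p; rewrite lee_fin; case/andP: (f01 (ar_map A p)).
Qed.

Lemma eq_product_image (m1 m2 : probability 'cV[R]_n R) :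
  (forall f L, 0 <= L -> lip L f -> (forall x, 0 <= f x <= 1) ->
    (\int[m1]_x (f x)%:E = \int[m2]_x (T f x)%:E)%E) ->
  forall U, measurable U -> m1 U = (m2 \x nu)%E (ar_map A @^-1` U).
Proof.
move=> H U mU.
pose phi := mfun_of (measurable_ar_map A).
rewrite (eq_measure_lipschitz hN (m1 := m1)
  (m2 := pushforward (m2 \x nu)%E phi) _ mU)//.
move=> f L L0 Lf f01.
have mf : measurable_fun setT (fun x => (f x)%:E).
  by apply/measurable_EFinP; exact: (lipN_measurable hN Lf).
rewrite ge0_integral_pushforward//=; last 2 first.
- exact: measurable_ar_map.
- by move=> x _; rewrite lee_fin; case/andP: (f01 x).
by rewrite preimage_setT (H _ _ L0 Lf f01) -(product_transition m2 L0 Lf f01).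
Qed.

(** The sequence of [stationary_law_limit] for [T f] is the one for [f] shifted by one, so [f] and
    [T f] have the same integral. *)
Lemma stationary_law_inv U : measurable U -> mu U = (mu \x nu)%E (ar_map A @^-1` U).
Proof.
apply: eq_product_image => f L L0 Lf f01.
have c1 := stationary_law_limit L0 Lf f01.
have rL0 : 0 <= r * L by rewrite mulr_ge0// ltW.
have c2 := stationary_law_limit rL0 (transition_lip hN dl0 nuexp L0 Lf) (transition_01 L0 Lf f01).
apply: (cvg_unique _ _ c2) => //.
rewrite (_ : (fun m => _) = (fun m => (iter m.+1 T f 0)%:E)).
  have c3 : [sequence (iter m.+1 T f 0)%:E]_m @ \oo --> (\int[mu]_x (f x)%:E)%E.
    by rewrite (cvg_shiftS (fun m => (iter m T f 0)%:E)).
  exact: c3.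
by apply/funext => m; rewrite iterSr.
Qed.

End backward_iteration.

(** * Uniqueness of the stationary law *)

Section stationary_uniqueness.
Context (R : realType) (n : nat) (A : 'M[R]_n) (N : 'cV[R]_n -> R) (r c : R).
Hypothesis hN : contracting_norm A N r c.
Context (nu : probability 'cV[R]_n R) (dl : R).
Hypothesis dl0 : 0 < dl.
Hypothesis nuexp : (\int[nu]_z (expR (dl * N z))%:E < +oo)%E.
Context (mu : probability 'cV[R]_n R) (kp : R).
Hypothesis kp0 : 0 < kp.
Hypothesis muexp : (\int[mu]_z (expR (kp * N z))%:E < +oo)%E.
Hypothesis mu_inv : forall U, measurable U -> mu U = (mu \x nu)%E (ar_map A @^-1` U).
Local Notation T := (transition_op A nu).

(** The integral of [f] against [m] equals that of [T^k f], and [T^k f] tends pointwise to the mean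
    of [f] under [mu]. Boundedness of the test functions permits dominated convergence, so the
    competitor [m] may be any probability measure, with or without moments. *)
Lemma stationary_unique (m : probability 'cV[R]_n R) :
  (forall U, measurable U -> m U = (m \x nu)%E (ar_map A @^-1` U)) ->
  forall U, measurable U -> m U = mu U.
Proof.
move=> m_inv; apply: (eq_measure_lipschitz hN) => f L L0 Lf f01.
have mlip (g : 'cV[R]_n -> R) (K : R) : lipN N K g -> measurable_fun setT (fun x => (g x)%:E).
  by move=> Lg; apply/measurable_EFinP; exact: (lipN_measurable hN Lg).
have it01 k := transition_iter_01 hN dl0 nuexp k L0 Lf f01.
have rL0 k : 0 <= r ^+ k * L by rewrite mulr_ge0// exprn_ge0// ltW// (cn_r_gt0 hN).
have itL k := transition_iter_lip hN dl0 nuexp k L0 Lf.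
have E k : (\int[m]_x (f x)%:E = \int[m]_x (iter k T f x)%:E)%E.
  elim: k => // k ->; rewrite -(product_transition hN dl0 nuexp m (rL0 k) (itL k) (it01 k)).
  apply: (ge0_integral_image (measurable_ar_map A) m_inv); first exact: mlip (itL k).
  by move=> x; rewrite lee_fin; case/andP: (it01 k x).
have r1 : `|r| < 1 by rewrite ger0_norm ?(cn_r_lt1 hN)// ltW// (cn_r_gt0 hN).
have muf : (\int[mu]_x f x)%:E = (\int[mu]_x (f x)%:E)%E.
  rewrite /Rintegral fineK//.
  exact: integrable_fin_num (integrable_lipN hN kp0 muexp L0 Lf).
have ae1 : {ae m, forall x, setT x -> (fun k => (iter k T f x)%:E) @ \oo --> (\int[mu]_y f y)%:E}.
  apply: aeW => x _; apply: cvg_EFin; first exact: nearW.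
  apply/subr_cvg0; apply: (squeeze_cvgr (f := fun k => - (L * (N x + stationary_moment N mu) * r ^+ k))
      (h := fun k => L * (N x + stationary_moment N mu) * r ^+ k)).
  - apply: nearW => k; rewrite -ler_norml.
    exact: (transition_iter_ergodic hN dl0 nuexp kp0 muexp mu_inv k x L0 Lf).
  - by rewrite -[X in _ --> X]oppr0; apply: cvgN; exact: (cvg_geometric _ r1).
  - exact: (cvg_geometric _ r1).
have ae2 : {ae m, forall x (k : nat), setT x -> (`|(iter k T f x)%:E| <= 1)%E}.
  by apply: aeW => x k _; case/andP: (it01 k x) => h0 h1; rewrite gee0_abs ?lee_fin.
have [_ _] := dominated_convergence measurableT (fun k => mlip _ _ (itL k))
  (measurable_cst _) ae1 (integrable_prob_cst m 1) ae2.
rewrite (_ : (fun k => _) = (fun=> \int[m]_x (f x)%:E)%E); last by apply/funext => k; rewrite -E.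
move=> H; rewrite -muf -[RHS](integral_prob_cst m).
by apply: (cvg_unique _ (@cvg_cst _ _ _ _ _) H).
Qed.

End stationary_uniqueness.

(** * Asymptotic covariance *)

Section real_integral_sums.
Context d (T : measurableType d) (R : realType) (m : {measure set T -> \bar R}).

Lemma integrable_sumf I (s : seq I) (f : I -> T -> R) :
  (forall i, m.-integrable setT (EFin \o f i)) ->
  m.-integrable setT (EFin \o (fun x => \sum_(i <- s) f i x)).
Proof.
move=> fi; elim: s => [|i s ih].
  rewrite (_ : _ \o _ = cst 0%E); first exact: integrable0.
  by apply/funext => x /=; rewrite big_nil.
rewrite (_ : _ \o _ = (EFin \o (fun x => f i x + \sum_(i <- s) f i x))).
  exact: integrable_addf.
by apply/funext => x /=; rewrite big_cons.
Qed.

Lemma Rintegral_sum I (s : seq I) (f : I -> T -> R) :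
  (forall i, m.-integrable setT (EFin \o f i)) ->
  \int[m]_x (\sum_(i <- s) f i x) = \sum_(i <- s) \int[m]_x f i x.
Proof.
move=> fi; elim: s => [|i s ih].
  rewrite big_nil; under eq_Rintegral do rewrite big_nil.
  by rewrite /Rintegral integral0.
rewrite big_cons -ih -RintegralD//; last exact: integrable_sumf.
by apply: eq_Rintegral => x _; rewrite big_cons.
Qed.

End real_integral_sums.

Section mxint_linear.
Context d (T : measurableType d) (R : realType) (m : {measure set T -> \bar R}).

Lemma dot_mxint q (F : T -> 'cV[R]_q) (l : 'cV[R]_q) :
  (forall i, m.-integrable setT (EFin \o (fun x => F x i 0))) ->
  dot l (mxint m F) = \int[m]_x dot l (F x).
Proof.
move=> Fi; rewrite dotE.
transitivity (\int[m]_x \sum_i (l i 0 * F x i 0)); last first.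
  by apply: eq_Rintegral => x _; rewrite dotE.
rewrite Rintegral_sum => [|i]; last exact: integrable_scalef.
by apply: eq_bigr => i _; rewrite RintegralZl// mxE.
Qed.

Lemma mxint_mulr p q (F : T -> 'M[R]_(p, q)) (l : 'cV[R]_q) :
  (forall i j, m.-integrable setT (EFin \o (fun x => F x i j))) ->
  mxint m F *m l = mxint m (fun x => F x *m l).
Proof.
move=> Fi; apply/colP => i; rewrite !mxE.
transitivity (\int[m]_x \sum_j (l j 0 * F x i j)); last first.
  by apply: eq_Rintegral => x _; rewrite mxE; apply: eq_bigr => j _; rewrite mulrC.
rewrite Rintegral_sum => [|j]; last exact: integrable_scalef.
by apply: eq_bigr => j _; rewrite RintegralZl// mxE mulrC.
Qed.

End mxint_linear.

Section symmetric_convergence.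
Context (R : realType) (q : nat).
Implicit Types (C : nat -> 'M[R]_q) (s : 'cV[R]_q -> R).

Lemma dot_mx_delta (M : 'M[R]_q) i j :
  dot (delta_mx i 0) (M *m delta_mx j 0) = M i j.
Proof.
rewrite dot_delta mxE (bigD1 j)//= big1 ?addr0 => [|k kj].
  by rewrite mxE !eqxx mulr1.
by rewrite mxE (negbTE kj) mulr0.
Qed.

Lemma polarization (M : 'M[R]_q) i j : M^T = M ->
  M i j = 2^-1 * (dot (delta_mx i 0 + delta_mx j 0) (M *m (delta_mx i 0 + delta_mx j 0)) -
    dot (delta_mx i 0) (M *m delta_mx i 0) - dot (delta_mx j 0) (M *m delta_mx j 0)).
Proof.
move=> MT; rewrite mulmxDr !dotDr !dotDl !dot_mx_delta.
have -> : M j i = M i j by rewrite -{1}MT mxE.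
by field.
Qed.

Lemma cvg_sumr (I : Type) (t : seq I) (f : I -> nat -> R) (a : I -> R) :
  (forall i, f i @ \oo --> a i) -> (fun k => \sum_(i <- t) f i k) @ \oo --> \sum_(i <- t) a i.
Proof.
move=> fa; elim: t => [|i t ih].
  by rewrite big_nil; under eq_fun do rewrite big_nil; exact: cvg_cst.
by rewrite big_cons; under eq_fun do rewrite big_cons; exact: cvgD.
Qed.

Lemma cvg_quad C (M : 'M[R]_q) l : C @ \oo --> M ->
  (fun k => dot l (C k *m l)) @ \oo --> dot l (M *m l).
Proof.
move=> CM; rewrite dotE.
under eq_fun do rewrite dotE.
have cij i j : (fun k => C k i j) @ \oo --> M i j.
  exact: (cvg_comp C (fun M' : 'M[R]_q => M' i j) CM (@coord_continuous _ _ _ i j M)).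
apply: cvg_sumr => i; apply: cvgMr.
rewrite mxE; under eq_fun do rewrite mxE.
by apply: cvg_sumr => j; exact: cvgMl.
Qed.

(* By polarization a sequence of symmetric matrices converges as soon as its
   quadratic forms do. *)
Lemma cvg_symmetric C s : (forall k, (C k)^T = C k) ->
  (forall l, (fun k => dot l (C k *m l)) @ \oo --> s l) ->
  [/\ cvgn C, (limn C)^T = limn C & forall l, dot l (limn C *m l) = s l].
Proof.
move=> CT Cs.
pose e i : 'cV[R]_q := delta_mx i 0.
pose M : 'M[R]_q := \matrix_(i, j) (2^-1 * (s (e i + e j) - s (e i) - s (e j))).
have CM : C @ \oo --> M.
  apply: cvg_mx_entry => i j; rewrite mxE.
  under eq_fun do rewrite (polarization i j (CT _)).
  by apply: cvgMr; apply: cvgB; [apply: cvgB|]; exact: Cs.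
have -> : limn C = M by exact: cvg_lim.
split; first exact: CM.
  by apply/matrixP => i j; rewrite !mxE (addrC (e i)) addrAC.
by move=> l; rewrite -(cvg_lim _ (Cs l))// -(cvg_lim _ (@cvg_quad C M l CM)).
Qed.

End symmetric_convergence.

Lemma maxr0_dist (R : realType) (a b : R) : `|Num.max a 0 - Num.max b 0| <= `|a - b|.
Proof.
have := ler_norm (a - b); have := ler_norm (b - a); rewrite distrC => h1 h2.
rewrite ler_norml /Num.max.
by case: (ltrP a 0) => ha; case: (ltrP b 0) => hb; apply/andP; split; lra.
Qed.

Lemma maxr0_decomp (R : realType) (a : R) : a = Num.max a 0 - Num.max (- a) 0.
Proof.
by rewrite /Num.max; case: (ltrP a 0) => ha; case: (ltrP (- a) 0) => hb; lra.
Qed.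

Section nstep_kernel.
Context d (E : measurableType d) (R : realType) (K : R.-spker E ~> E).

Lemma nstep_ge0_integral k x (f : E -> \bar R) : measurable_fun setT f ->
  (forall y, 0 <= f y)%E ->
  (\int[nstep K k.+1 x]_y f y = \int[nstep K k x]_y \int[K y]_z f z)%E.
Proof.
move=> mf f0.
rewrite -[RHS](integral_kcomp (nstep K k) (kernel.kernel_snd K : R.-sfker E * E ~> E) x f0 mf).
by apply: eq_measure_integral => U mU _.
Qed.

Lemma nstep0_ge0_integral x (f : E -> \bar R) : measurable_fun setT f ->
  (\int[nstep K 0 x]_y f y = f x)%E.
Proof.
move=> mf.
transitivity (\int[dirac x]_y f y)%E; first by apply: eq_measure_integral => U mU _.
by rewrite integral_dirac// diracT mul1e.
Qed.

End nstep_kernel.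

Section asymptotic_covariance.
Context (R : realType) (n : nat) (A : 'M[R]_n) (N : 'cV[R]_n -> R) (r c : R).
Hypothesis hN : contracting_norm A N r c.
Context (nu : probability 'cV[R]_n R) (dl : R).
Hypothesis dl0 : 0 < dl.
Hypothesis nuexp : (\int[nu]_z (expR (dl * N z))%:E < +oo)%E.
Context (mu : probability 'cV[R]_n R) (kp : R).
Hypothesis kp0 : 0 < kp.
Hypothesis muexp : (\int[mu]_z (expR (kp * N z))%:E < +oo)%E.
Hypothesis mu_inv : forall U, measurable U -> mu U = (mu \x nu)%E (ar_map A @^-1` U).
Context (K : R.-spker 'cV[R]_n ~> 'cV[R]_n).
Hypothesis KE : forall y U, measurable U -> K y U = nu ((fun z => A *m y + z) @^-1` U).
Implicit Types (x y z : 'cV[R]_n) (f g : 'cV[R]_n -> R).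
Local Notation lip := (lipN N).
Local Notation T := (transition_op A nu).

Let mshift y : measurable_fun setT (fun z : 'cV[R]_n => A *m y + z).
Proof. exact: (measurableT_comp (measurable_ar_map A) (measurable_pair1 y)). Qed.

Let rL_ge0 k (L : R) : 0 <= L -> 0 <= r ^+ k * L.
Proof. by move=> L0; rewrite mulr_ge0// exprn_ge0// ltW// (cn_r_gt0 hN). Qed.

Lemma nstep_ge0_lip k x f (L : R) : 0 <= L -> lip L f -> (forall y, 0 <= f y) ->
  (\int[nstep K k x]_y (f y)%:E = (iter k T f x)%:E)%E.
Proof.
elim: k L f => [|k ih] L f L0 Lf f0.
  apply: nstep0_ge0_integral; apply/measurable_EFinP; exact: (lipN_measurable hN Lf).
have mf : measurable_fun setT (fun x => (f x)%:E).
  by apply/measurable_EFinP; exact: (lipN_measurable hN Lf).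
rewrite nstep_ge0_integral//.
rewrite iterSr -(ih (r * L)).
- apply: eq_integral => y _.
  rewrite (ge0_integral_image (mshift y) (KE y))//.
  exact: (transition_EFin hN dl0 nuexp y L0 Lf).
- by rewrite -[r]expr1 rL_ge0.
- exact: (transition_lip hN dl0 nuexp L0 Lf).
- by move=> y; apply: Rintegral_ge0 => z _.
Qed.

(** Composition of kernels is integrated for nonnegative functions first; a signed [f] is split into
    its positive and negative parts, which have the same Lipschitz constant, and linearity of [T]
    reassembles them. *)
Lemma nstep_lip k x f (L : R) : 0 <= L -> lip L f ->
  \int[nstep K k x]_y f y = iter k T f x.
Proof.
move=> L0 Lf.
pose fp y := Num.max (f y) 0; pose fm y := Num.max (- f y) 0.
have maxL g : lip L g -> lip L (fun y => Num.max (g y) 0).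
  by move=> Lg y z; apply: le_trans (Lg y z); exact: maxr0_dist.
have Lp : lip L fp by exact: maxL.
have Lm : lip L fm by apply: (maxL (fun y => - f y)) => y z; rewrite -opprD normrN; exact: Lf.
have fpm y : f y = fp y - fm y.
  exact: maxr0_decomp.
have p0 y : 0 <= fp y by rewrite /fp le_max lexx orbT.
have m0 y : 0 <= fm y by rewrite /fm le_max lexx orbT.
have nint g : lip L g -> (forall y, 0 <= g y) -> (nstep K k x).-integrable setT (EFin \o g).
  move=> Lg g0; apply/integrableP; split.
    by apply/measurable_EFinP; exact: (lipN_measurable hN Lg).
  under eq_integral do rewrite /= ger0_norm//.
  by rewrite (nstep_ge0_lip k x L0 Lg g0) ltry.
transitivity (\int[nstep K k x]_y (fp y - fm y)); first by apply: eq_Rintegral => y _.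
rewrite RintegralB//; [|exact: nint..].
rewrite /Rintegral (nstep_ge0_lip k x L0 Lp p0) (nstep_ge0_lip k x L0 Lm m0)/=.
have NL : 0 <= `|-1| * L by rewrite mulr_ge0.
have Nm : lip (`|-1| * L) (fun y => -1 * fm y) by exact: lipNZ.
have -> : f = (fun y => fp y + (-1) * fm y) by apply/funext => y; rewrite mulN1r.
by rewrite (transition_iterD hN dl0 nuexp k L0 Lp NL Nm) (transition_iterZ hN dl0 nuexp k (-1) L0 Lm) mulN1r.
Qed.

Context (q : nat) (H : 'cV[R]_n -> 'cV[R]_q) (L : R).
Hypothesis L0 : 0 <= L.
Hypothesis HL : forall i, lip L (fun x => H x i 0).
Hypothesis H0 : mxint mu H = 0.
Implicit Types l : 'cV[R]_q.

Lemma linear_form_lip l : lip (\sum_i (`|l i 0| * L)) (fun x => dot l (H x)).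
Proof.
rewrite (_ : (fun x => _) = (fun x => \sum_i l i 0 * H x i 0)); last first.
  by apply/funext => x; rewrite dotE.
by apply: lipN_sum => i; exact: lipNZ.
Qed.

Let Ll_ge0 l : 0 <= \sum_i (`|l i 0| * L).
Proof. by apply: sumr_ge0 => i _; rewrite mulr_ge0. Qed.

Lemma linear_form_centered l : \int[mu]_x dot l (H x) = 0.
Proof.
rewrite -dot_mxint ?H0 1?dotC ?dot0l// => i.
exact: (integrable_lipN hN kp0 muexp L0 (HL i)).
Qed.

Lemma nstep_intE k x i : nstep_int K H k x i 0 = iter k T (fun y => H y i 0) x.
Proof. by rewrite mxE; exact: nstep_lip L0 (HL i). Qed.

Lemma nstep_int_linear k x l : iter k T (fun y => dot l (H y)) x = dot l (nstep_int K H k x).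
Proof.
rewrite -(nstep_lip k x (Ll_ge0 l) (linear_form_lip l)) dot_mxint// => i.
have LHp := HL i.
apply/integrableP; split.
  by apply/measurable_EFinP; exact: (lipN_measurable hN LHp).
have aL : lip L (fun y => `|H y i 0|).
  by move=> y z; apply: le_trans (LHp y z); exact: ler_dist_dist.
under eq_integral do rewrite /=.
by rewrite (nstep_ge0_lip k x L0 aL)// ltry.
Qed.

Let entry_growth k i x : `|nstep_int K H k x i 0| <=
  (`|nstep_int K H k 0 i 0| + r ^+ k * L) * (1 + N x).
Proof.
rewrite !nstep_intE; apply: (lipN_growth hN); first exact: rL_ge0.
exact: (transition_iter_lip hN dl0 nuexp k L0 (HL i)).
Qed.

Let entry_measurable k i : measurable_fun setT (fun x => nstep_int K H k x i 0).
Proof.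
under eq_fun do rewrite nstep_intE.
exact: (lipN_measurable hN (transition_iter_lip hN dl0 nuexp k L0 (HL i))).
Qed.

Let iH k i j : mu.-integrable setT (EFin \o (fun x => H x i 0 * nstep_int K H k x j 0)).
Proof.
apply: (integrable_growthM hN kp0 muexp (lipN_measurable hN (HL i)) (entry_measurable k j) _ (entry_growth k j)).
by move=> x; exact: (lipN_growth hN x L0 (HL i)).
Qed.

Let lag_entry k x i j :
  (H x *m (nstep_int K H k x)^T + nstep_int K H k x *m (H x)^T) i j =
  H x i 0 * nstep_int K H k x j 0 + H x j 0 * nstep_int K H k x i 0.
Proof. by move: (nstep_int K H k x) => g; rewrite !mxE !big_ord1 !mxE (mulrC (g i 0)). Qed.

Let lag_integrable k i j : mu.-integrable setT (EFin \o
  (fun x => (H x *m (nstep_int K H k x)^T + nstep_int K H k x *m (H x)^T) i j)).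
Proof.
rewrite (_ : _ \o _ = EFin \o (fun x => H x i 0 * nstep_int K H k x j 0 + H x j 0 * nstep_int K H k x i 0)).
  by apply: integrable_addf; exact: iH.
by apply/funext => x /=; rewrite lag_entry.
Qed.

Lemma lag_cov_sym k : (lag_cov K mu H k)^T = lag_cov K mu H k.
Proof.
apply/matrixP => i j; rewrite !mxE; apply: eq_Rintegral => x _.
by rewrite !lag_entry addrC.
Qed.

Lemma dot_outer l (u v : 'cV[R]_q) : dot l (u *m v^T *m l) = dot l u * dot l v.
Proof. by rewrite -mulmxA [v^T *m l]mx11_scalar mul_mx_scalar dotZr mulrC [X in _ * X]dotC. Qed.

(** The two outer products of the symmetrized lag contribute the same scalar, whence the factor 2
    that appears in [has_avar]. *)
Lemma lag_cov_quad k l : dot l (lag_cov K mu H k *m l) =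
  2 * \int[mu]_x (dot l (H x) * iter k T (fun y => dot l (H y)) x).
Proof.
rewrite mxint_mulr; last exact: lag_integrable.
rewrite dot_mxint => [|i]; last first.
  rewrite (_ : _ \o _ = EFin \o (fun x => \sum_j (l j 0 *
      (H x *m (nstep_int K H k x)^T + nstep_int K H k x *m (H x)^T) i j))).
    by apply: integrable_sumf => j; exact: integrable_scalef.
  by apply/funext => x /=; rewrite mxE; congr (_%:E); apply: eq_bigr => j _; rewrite mulrC.
rewrite -RintegralZl//; last first.
  have Lf := linear_form_lip l.
  have Lk := transition_iter_lip hN dl0 nuexp k (Ll_ge0 l) Lf.
  apply: (integrable_growthM hN kp0 muexp (lipN_measurable hN Lf) (lipN_measurable hN Lk)).
    by move=> x; exact: (lipN_growth hN x (Ll_ge0 l) Lf).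
  by move=> x; exact: (lipN_growth hN x (rL_ge0 k (Ll_ge0 l)) Lk).
apply: eq_Rintegral => x _; rewrite nstep_int_linear mulmxDl dotDr !dot_outer; ring.
Qed.

Let B0 := mxint mu (fun x => H x *m (H x)^T).

Let B0_sym : B0^T = B0.
Proof.
by apply/matrixP => i j; rewrite !mxE; apply: eq_Rintegral => x _; rewrite !mxE !big_ord1 !mxE mulrC.
Qed.

Let B0_quad l : dot l (B0 *m l) = \int[mu]_x (dot l (H x) * dot l (H x)).
Proof.
have iHH i j : mu.-integrable setT (EFin \o (fun x => (H x *m (H x)^T) i j)).
  rewrite (_ : _ \o _ = EFin \o (fun x => H x i 0 * H x j 0)); last first.
    by apply/funext => x /=; rewrite !mxE big_ord1 !mxE.
  by apply: (integrable_growthM hN kp0 muexp (lipN_measurable hN (HL i)) (lipN_measurable hN (HL j)));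
    move=> x; apply: (lipN_growth hN x L0); exact: HL.
rewrite mxint_mulr// dot_mxint => [|i]; last first.
  rewrite (_ : _ \o _ = EFin \o (fun x => \sum_j (l j 0 * (H x *m (H x)^T) i j))).
    by apply: integrable_sumf => j; exact: integrable_scalef.
  by apply/funext => x /=; rewrite mxE; congr (_%:E); apply: eq_bigr => j _; rewrite mulrC.
by apply: eq_Rintegral => x _; rewrite dot_outer.
Qed.

(** For each direction [l] the Poisson construction supplies a nonnegative variance as the limit of
    the quadratic forms of the partial sums. Polarization lifts this to convergence of the matrices,
    and nonnegativity of the limit is inherited from the variances. *)
Lemma asymptotic_cov_avar :
  [/\ cvgn (lag_cov_sum K mu H), (asymptotic_cov K mu H)^T = asymptotic_cov K mu H &
    forall l, 0 <= dot l (asymptotic_cov K mu H *m l) /\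
      has_avar A nu mu (fun x => dot l (H x)) (dot l (asymptotic_cov K mu H *m l))].
Proof.
have /choice[s Hs] l : exists s2, 0 <= s2 /\ has_avar A nu mu (fun x => dot l (H x)) s2.
  have [u [v [? [? [? [s2 [_ _ s20 hs _]]]]]]] :=
    twisted_one_step hN dl0 nuexp kp0 muexp mu_inv (Ll_ge0 l) (linear_form_lip l) (linear_form_centered l).
  by exists s2.
have sumT k : (lag_cov_sum K mu H k)^T = lag_cov_sum K mu H k.
  by rewrite /lag_cov_sum raddf_sum; apply: eq_bigr => i _; exact: lag_cov_sym.
have sum_quad k l : dot l (lag_cov_sum K mu H k *m l) =
    2 * \sum_(1 <= i < k.+1) \int[mu]_x (dot l (H x) * iter i T (fun y => dot l (H y)) x).
  rewrite /lag_cov_sum mulmx_suml /dot mulmx_sumr summxE mulr_sumr.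
  by apply: eq_bigr => i _; exact: lag_cov_quad.
have cq l : (fun k => dot l (lag_cov_sum K mu H k *m l)) @ \oo --> s l - dot l (B0 *m l).
  rewrite (_ : (fun k => _) = (fun k => (dot l (B0 *m l) + 2 * \sum_(1 <= i < k.+1)
      \int[mu]_x (dot l (H x) * iter i T (fun y => dot l (H y)) x)) - dot l (B0 *m l))); last first.
    by apply/funext => k; rewrite sum_quad addrAC subrr add0r.
  by apply: cvgB; [rewrite B0_quad; exact: (Hs l).2|exact: cvg_cst].
have [cC CT Cq] := cvg_symmetric sumT cq.
split=> //; first by rewrite /asymptotic_cov linearD /= CT B0_sym.
move=> l; have -> : dot l (asymptotic_cov K mu H *m l) = s l.
  by rewrite /asymptotic_cov mulmxDl dotDr Cq addrC subrK.
exact: Hs.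
Qed.

End asymptotic_covariance.

(** * Lipschitz functionals of the chain *)

Section euclidean_norm.
Context (R : realType) (n : nat).
Implicit Types x y : 'cV[R]_n.

Lemma sqr_norm2 x : norm2 x ^+ 2 = dot x x.
Proof. by rewrite sqr_sqrtr// dot_ge0. Qed.

Lemma norm2_le_norm1 x : norm2 x <= norm1 x.
Proof.
rewrite -[leRHS](ger0_norm (norm1_ge0 x)) -sqrtr_sqr ler_wsqrtr// expr2.
exact: le_trans (ler_norm _) (dot_norm1_le x x).
Qed.

Lemma norm2_coord x i : `|x i 0| <= norm2 x.
Proof.
rewrite -sqrtr_sqr ler_wsqrtr// dotE (bigD1 i)//= expr2 lerDl.
by apply: sumr_ge0 => j _; rewrite -expr2 sqr_ge0.
Qed.

End euclidean_norm.

Lemma lipschitz2_lipN (R : realType) n q (A : 'M[R]_n) (N : 'cV[R]_n -> R) r c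
    (H : 'cV[R]_n -> 'cV[R]_q) : contracting_norm A N r c -> lipschitz2 H ->
  exists2 L : R, 0 <= L & forall i, lipN N L (fun x => H x i 0).
Proof.
move=> hN [L HL]; exists `|L| => // i x y.
have -> : H x i 0 - H y i 0 = (H x - H y) i 0 by rewrite !mxE.
apply: (le_trans (norm2_coord _ _)); apply: (le_trans (HL x y)).
apply: le_trans (ler_wpM2r _ (ler_norm L)) _; first exact: sqrtr_ge0.
rewrite ler_wpM2l//; apply: le_trans (norm2_le_norm1 _) _.
exact: (cn_ge_norm1 hN).
Qed.

Lemma second_moment (R : realType) n (A : 'M[R]_n) (N : 'cV[R]_n -> R) r c
    (mu : probability 'cV[R]_n R) (kp : R) : contracting_norm A N r c -> 0 < kp ->
  (\int[mu]_z (expR (kp * N z))%:E < +oo)%E ->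
  (\int[mu]_z (norm2 z ^+ 2)%:E < +oo)%E.
Proof.
move=> hN kp0 muexp.
have Lc i : lipN N 1 (fun z : 'cV[R]_n => z i 0).
  move=> x y; rewrite mul1r; apply: le_trans (cn_ge_norm1 hN (x - y)).
  by have := norm1_coord (x - y) i; rewrite !mxE.
have sq : mu.-integrable setT (EFin \o (fun z : 'cV[R]_n => \sum_i z i 0 * z i 0)).
  apply: integrable_sumf => i.
  by apply: (integrable_growthM hN kp0 muexp (lipN_measurable hN (Lc i)) (lipN_measurable hN (Lc i)));
    move=> x; apply: (lipN_growth hN x ler01); exact: Lc.
rewrite (_ : (\int[mu]_z _)%E = (\int[mu]_z (\sum_i z i 0 * z i 0)%:E)%E); last first.
  by apply: eq_integral => z _; rewrite sqr_norm2 dotE.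
by have := integrable_fin_num measurableT sq; rewrite fin_numE => /andP[_]; rewrite -ltey.
Qed.

Section ar_kernel_product.
Context (R : realType) (n : nat) (A : 'M[R]_n) d (Omega : measurableType d)
  (P : probability Omega R) (Z : {RV P >-> 'cV[R]_n}).
Local Notation nu := (distribution P Z).

Lemma ar_kernelE y U : measurable U -> ar_kernel A Z y U = nu ((fun z => A *m y + z) @^-1` U).
Proof. by []. Qed.

Lemma ar_kernel_integral (m : probability 'cV[R]_n R) U : measurable U ->
  (\int[m]_x ar_kernel A Z x U = (m \x nu) (ar_map A @^-1` U))%E.
Proof.
move=> mU; rewrite /product_measure1/=; apply: eq_integral => x _.
by rewrite ar_kernelE// xsectionE.
Qed.

Lemma invariant_measure_product (m : probability 'cV[R]_n R) :
  invariant_measure (ar_kernel A Z) m <->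
  forall U, measurable U -> m U = (m \x nu)%E (ar_map A @^-1` U).
Proof.
by split=> H U mU; have := H U mU; rewrite -ar_kernel_integral// => ->.
Qed.

End ar_kernel_product.

Lemma noise_exp_moment (R : realType) n (A : 'M[R]_n) (N : 'cV[R]_n -> R) r c
    d (Omega : measurableType d) (P : probability Omega R) (Z : {RV P >-> 'cV[R]_n}) :
  contracting_norm A N r c ->
  (\forall delta \near 0^'+, ('E_P[fun w => expR (delta * norm1 (Z w))] < +oo)%E) ->
  exists2 dl : R, 0 < dl & (\int[distribution P Z]_z (expR (dl * N z))%:E < +oo)%E.
Proof.
move=> hN hexp.
have [delta [d0 hd]] : exists delta : R, 0 < delta /\ ('E_P[fun w => expR (delta * norm1 (Z w))] < +oo)%E.
  have p0 : \forall delta \near (0:R)^'+, 0 < delta by exact: nbhs_right_gt.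
  exact: filter_ex (filterI p0 hexp).
(* The noise moment is given in the norm [norm1] and [N <= c norm1], so the rate is divided by [c],
   replaced by its maximum with 1 to be surely positive. *)
have c10 : 0 < Num.max c 1 by rewrite lt_max ltr01 orbT.
exists (delta / Num.max c 1); first by rewrite divr_gt0.
have mE (a : R) : measurable_fun setT (fun z => (expR (a * N z))%:E).
  by apply/measurable_EFinP; exact: (measurable_expN hN a).
have m1 : measurable_fun setT (fun z : 'cV[R]_n => (expR (delta * norm1 z))%:E).
  apply/measurable_EFinP; apply: measurableT_comp => //; apply: measurable_funM => //.
  apply: (@norm1_lip_measurable _ _ _ 1) => x y; rewrite mul1r.
  have := norm1D (x - y) y; have := norm1D (y - x) x; rewrite !subrK -opprB norm1N => h1 h2.
  by rewrite ler_norml; apply/andP; split; lra.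
rewrite ge0_integral_distribution//.
apply: le_lt_trans hd; rewrite unlock; apply: ge0_le_integral => //.
- by move=> w _; rewrite lee_fin expR_ge0.
- exact: (measurableT_comp (mE _)).
- exact: (measurableT_comp m1).
move=> w _; rewrite lee_fin ler_expR -mulrA ler_pM2l// mulrC ler_pdivrMr// mulrC.
apply: (le_trans (cn_le_norm1 hN _)); rewrite ler_wpM2r ?norm1_ge0//.
by rewrite le_max lexx.
Qed.

Section moderate_deviations.
Context (R : realType) (n : nat) (A : 'M[R]_n) (N : 'cV[R]_n -> R) (r c : R).
Hypothesis hN : contracting_norm A N r c.
Context d (Omega : measurableType d) (P : probability Omega R).
Context (Z : nat -> {RV P >-> 'cV[R]_n}).
Hypothesis indep : mutually_independent Z.
Context (nu : probability 'cV[R]_n R).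
Hypothesis Znu : forall i U, measurable U -> distribution P (Z i) U = nu U.
Context (x0 : 'cV[R]_n) (X : nat -> Omega -> 'cV[R]_n).
Hypothesis X0 : forall w, X 0%N w = x0.
Hypothesis XS : forall k w, X k.+1 w = A *m X k w + Z k w.
Context (dl : R).
Hypothesis dl0 : 0 < dl.
Hypothesis nuexp : (\int[nu]_z (expR (dl * N z))%:E < +oo)%E.
Context (mu : probability 'cV[R]_n R) (kp : R).
Hypothesis kp0 : 0 < kp.
Hypothesis muexp : (\int[mu]_z (expR (kp * N z))%:E < +oo)%E.
Hypothesis mu_inv : forall U, measurable U -> mu U = (mu \x nu)%E (ar_map A @^-1` U).
Context (alpha : R).
Hypothesis alpha_gt : 2^-1 < alpha.
Hypothesis alpha_lt1 : alpha < 1.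
Context (q : nat) (H : 'cV[R]_n -> 'cV[R]_q) (L : R).
Hypothesis L0 : 0 <= L.
Hypothesis HL : forall i, lipN N L (fun x => H x i 0).
Hypothesis H0 : mxint mu H = 0.

Let S k w : 'cV[R]_q := (k%:R `^ alpha)^-1 *: \sum_(1 <= i < k.+1) H (X i.-1 w).

Let S_measurable k : measurable_fun setT (S k).
Proof.
apply/measurable_mxP => i j; rewrite ord1 /S.
under eq_fun do rewrite mxE summxE.
apply: measurable_funM => //; apply: measurable_sum => m.
exact: (measurableT_comp (lipN_measurable hN (HL i)) (chain_measurable X0 XS m.-1)).
Qed.

Lemma mgf_partial_sum k l : (0 < k)%N -> mgf P S (mdp_speed alpha) k l =
  (\int[P]_w (expR (mdp_scale alpha k * partial_sum X (fun x => dot l (H x)) k w))%:E)%E.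
Proof.
move=> k0; apply: eq_integral => w _; congr (expR _)%:E.
rewrite /S dotZr mulrA mdp_scaleE//; congr (_ * _).
(* Reindexing: the sum of [H (X i.-1)] for [i] from 1 to [k] is the sum over the states [X 0] to
   [X (k - 1)], as in [partial_sum]. *)
by rewrite big_add1 /= big_mkord /partial_sum /dot mulmx_sumr summxE.
Qed.

Lemma lipschitz_functional_mdp (B : 'M[R]_q) : B^T = B ->
  (forall l, 0 <= dot l (B *m l) /\ has_avar A nu mu (fun x => dot l (H x)) (dot l (B *m l))) ->
  moderate_deviation_principle P alpha S (mdp_rate B).
Proof.
move=> BT HB.
have half l : half_quad B l = dot l (B *m l) / 2 by rewrite /half_quad mulrC.
have Ll0 (l : 'cV[R]_q) : 0 <= \sum_i (`|l i 0| * L) by apply: sumr_ge0 => i _; rewrite mulr_ge0.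
have h0 l := linear_form_centered hN kp0 muexp L0 HL H0 l.
apply: gartner_ellis_mdp => // [l|l e e0|l e e0]; first exact: (HB l).1.
- near=> k; rewrite mgf_partial_sum; last by near: k; exact: nbhs_infty_gt.
  rewrite half; near: k.
  exact: (log_mgf_upper hN indep Znu X0 XS dl0 nuexp kp0 muexp mu_inv alpha_gt alpha_lt1
    (Ll0 l) (linear_form_lip HL l) (h0 l) (HB l).2 e0).
- near=> k; rewrite mgf_partial_sum; last by near: k; exact: nbhs_infty_gt.
  rewrite half; near: k.
  exact: (log_mgf_lower hN indep Znu X0 XS dl0 nuexp kp0 muexp mu_inv alpha_gt alpha_lt1
    (Ll0 l) (linear_form_lip HL l) (h0 l) (HB l).2 e0).
Unshelve. all: end_near. Qed.

End moderate_deviations.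

Theorem theorem2p2 (R : realType) (disp : measure_display)
    (Omega : measurableType disp) (P : probability Omega R) (d q : nat)
    (hd : (1 <= d)%N) (hq : (1 <= q)%N)
    (A : 'M[R]_d) (hA : eigenvalues_in_unit_disk A)
    (xi : nat -> {RV P >-> 'cV[R]_d})
    (hiid : iid (fun n => xi n.+1))
    (hexp : \forall delta \near 0^'+,
      ('E_P[fun w => expR (delta * norm1 (xi 1%N w))] < +oo)%E)
    (x : 'cV[R]_d) (X : nat -> Omega -> 'cV[R]_d)
    (hX0 : forall w, X 0%N w = x)
    (hX : forall n w, X n.+1 w = A *m X n w + xi n.+1 w) :
  exists mu : probability 'cV[R]_d R,
    [/\ ergodic (ar_kernel A (xi 1%N)) mu,
        (\int[mu]_z (norm2 z ^+ 2)%:E < +oo)%E &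
        forall (alpha : R) (H : 'cV[R]_d -> 'cV[R]_q),
          2^-1 < alpha < 1 -> lipschitz2 H -> mxint mu H = 0 ->
          cvgn (lag_cov_sum (ar_kernel A (xi 1%N)) mu H) /\
          moderate_deviation_principle P alpha
            (fun n w => (n%:R `^ alpha)^-1 *: \sum_(1 <= i < n.+1) H (X i.-1 w))
            (mdp_rate (asymptotic_cov (ar_kernel A (xi 1%N)) mu H))].
Proof.
have [N [r [c hN]]] := exists_contracting_norm hd hA.
have [dl dl0 nuexp] := noise_exp_moment hN hexp.
have [indep Zid] := hiid.
pose nu := distribution P (xi 1%N).
have Znu i U : measurable U -> distribution P (xi i.+1) U = nu U by move=> mU; exact: (Zid i 0%N).
(* The stationary law is built on the given probability space from the innovations themselves,
   shifted so that index 0 stands for [xi 1]. *)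
pose mu := stationary_law A (fun n => xi n.+1).
have mu_inv := stationary_law_inv hN indep Znu dl0 nuexp.
have muexp := stationary_law_exp hN Znu dl0 nuexp.
have kp0 : 0 < dl * (1 - r) by rewrite mulr_gt0// subr_gt0 (cn_r_lt1 hN).
exists mu; split.
- split; first by apply/invariant_measure_product; exact: mu_inv.
  move=> m /invariant_measure_product m_inv.
  exact: (stationary_unique hN dl0 nuexp kp0 muexp mu_inv m_inv).
- exact: (second_moment hN kp0 muexp).
move=> alpha H /andP[alpha_gt alpha_lt1] /(lipschitz2_lipN hN)[L L0 HL] H0.
have [cC BT HB] := asymptotic_cov_avar hN dl0 nuexp kp0 muexp mu_inv
  (ar_kernelE A (xi 1%N)) L0 HL H0.
split=> //.
exact: (lipschitz_functional_mdp hN indep Znu hX0 hX dl0 nuexp kp0 muexp mu_inv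
  alpha_gt alpha_lt1 L0 HL H0 BT HB).
Qed.
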